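(* For a partition $\nu$ of $m$ and a removable node $(k,l)=(k_0,l_0)$ of $\nu$, define $P_{\nu,(k,l)}\in\mathcal H_{\mathcal K,m}$ as follows. Let $(k_1,l_1),\dots,(k_N,l_N)$ ($N\ge0$) be the removable nodes of $\nu$ strictly below $(k,l)$, with $k_0<k_1<\cdots<k_N$; $c_j:=t^\nu[k_j,l_j]$; for each row $i$ let $a_i$ (resp. $b_i$) be the last entry of row $i-1$ (resp. row $i$) of $t^\nu$ and $R_i:=1+T_{a_i,a_i+1}+\cdots+T_{a_i,b_i-1}$; for $0\le j<N$ let $\widetilde\sigma_j:=\sigma_{c_j,c_{j+1}}$, $\widetilde\sigma_j^{\,i}:=\sigma_{c_j,c_j+i\,l_{j+1}}$, $\varphi_j^1:=R_{k_j+1}$, $\varphi_j^i:=(T_{\widetilde\sigma_j^{\,i-1}}-q\varphi_j^{i-1})R_{k_j+i}$ for $2\le i\le k_{j+1}-k_j$, $\mathcal F_j:=\varphi_j^{k_{j+1}-k_j}$; let $r_j$ be the radial distance from $(k_j,l_j)$ to $(k,l)$. Then $$P_{\nu,(k,l)}:=\prod_{j=0}^{N-1}\Big(T_{\widetilde\sigma_j}+\frac{1}{[r_{j+1}]_q}\mathcal F_j\Big)$$ (product taken in the order $j=0,1,\dots,N-1$ from left to right; empty product $=1$). Now let $\lambda$ be a partition of $n$ and $t$ a standard $\lambda$-tableau. For $1\le i\le n$ let $\lambda^{\le i}$ be the shape of the tableau obtained from $t$ by deleting the nodes containing $i+1,\dots,n$ (so the node of $t$ containing $i$ is a removable node of $\lambda^{\le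 i}$), and put $P_i:=P_{\lambda^{\le i},\,\text{node of }i\text{ in }t}\in\mathcal H_{\mathcal K,i}\subseteq\mathcal H_{\mathcal K,n}$. Let $P_t:=P_nP_{n-1}\cdots P_2P_1$. Then $$f_t=e_\lambda P_t.$$
   Context: $\mathcal A=\mathbb C[q,q^{-1}]$, $\mathcal K=\mathbb C(q)$. $\mathcal H_{\mathcal A,m}$ is the Iwahori–Hecke algebra over $\mathcal A$ with generators $T_1,\dots,T_{m-1}$ and relations $T_iT_j=T_jT_i$ for $|i-j|>1$, $T_iT_jT_i=T_jT_iT_j$ for $|i-j|=1$, $(T_i-q)(T_i+1)=0$; $\mathcal H_{\mathcal K,m}=\mathcal H_{\mathcal A,m}\otimes\mathcal K$, and $\mathcal H_{\mathcal K,i}\subset\mathcal H_{\mathcal K,n}$ for $i\le n$ via $T_j\mapsto T_j$. Permutations compose left to right; $s_i=(i,i+1)$; $T_w=T_{i_1}\cdots T_{i_N}$ for reduced $w=s_{i_1}\cdots s_{i_N}$. For $i\le j$, $\sigma_{i,j}=(i,i+1)(i+1,i+2)\cdots(j-1,j)$ ($\sigma_{i,i}=1$), $T_{i,j}=T_{\sigma_{i,j}}=T_i\cdots T_{j-1}$. $[k]_q=(q^k-1)/(q-1)$. Nodes $(r,c)$ = (row, column); $t[r,c]$ is the entry in node $(r,c)$; a node is removable if deleting it leaves a partition diagram. A $\lambda$-tableau is a bijective filling with $1,\dots,n$; standard = increasing along rows and columns; $t^\lambda$ has $1,\dots,n$ filled along rows, top first. $S_n$ acts on the right on tableaux by permuting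 entries; $t=t^\lambda d(t)$. Radial distance from $(a,b)$ to $(a',b')$ is $b'-b-(a'-a)$. Specht module: $x_\lambda=\sum_{w\in S_\lambda}T_w$ ($S_\lambda$ the row stabilizer of $t^\lambda$), $x_{st}=T_{d(s)^{-1}}x_\lambda T_{d(t)}$, $\overline N_\lambda$ the $\mathcal A$-span of $x_{st}$ for $\mu$-tableaux $s,t$ with $\mu$ strictly dominating $\lambda$; $S^\lambda_{\mathcal A}$ is the right module generated by $x_\lambda+\overline N_\lambda$; $e_t=x_{t^\lambda t}+\overline N_\lambda=e_{t^\lambda}T_{d(t)}$, $e_\lambda=e_{t^\lambda}$; $S^\lambda=S^\lambda_{\mathcal A}\otimes\mathcal K$. Seminormal basis: $L_p=\sum_{i=1}^{p-1}q^{-i}T_{(p-i,p)}$; residue of $(r,c)$ is $[c-r]_q$; $r_t(p)$ = residue of the node of $p$ in $t$; $\mathrm R$ = set of residues of nodes of partitions of $n$; $E_t=\prod_{p=1}^n\prod_{c\in\mathrm R\setminus\{r_t(p)\}}\frac{L_p-c}{r_t(p)-c}$, $f_t=e_tE_t\in S^\lambda$. *)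

(* Defs.v *)
From HB Require Import structures.
From mathcomp Require Import all_boot all_order all_algebra all_fingroup.
From mathcomp Require Import fraction complex Rstruct.
Set Implicit Arguments.
Unset Strict Implicit.
Unset Printing Implicit Defensive.
Import GRing.Theory.
Local Open Scope ring_scope.

Definition CC : fieldType := (Rdefinitions.R)[i].
Definition KK : fieldType := {fraction {poly CC}}.
Definition qq : KK := FracField.tofrac ('X : {poly CC}).

(* ---------- Partitions, nodes, tableaux (all 1-based) ---------- *)
(* A partition is a seq nat (row lengths); nodes are (row, column). *)
Definition row (la : seq nat) (r : nat) : nat := nth 0%N la r.-1.

Definition is_part (la : seq nat) : bool :=
  sorted geq la && all (fun x => 0 < x)%N la.

Definition part_of (n : nat) (la : seq nat) : bool :=
  is_part la && (sumn la == n).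

Definition nodes (la : seq nat) : seq (nat * nat) :=
  flatten [seq [seq (r, c) | c <- iota 1 (row la r)] | r <- iota 1 (size la)].

Definition diagram_closed (D : seq (nat * nat)) : bool :=
  all (fun y => ((1 < y.1)%N ==> ((y.1.-1, y.2) \in D))
             && ((1 < y.2)%N ==> ((y.1, y.2.-1) \in D))) D.

Definition removable (la : seq nat) (x : nat * nat) : bool :=
  (x \in nodes la) && diagram_closed (rem x (nodes la)).

Definition tla (la : seq nat) (r c : nat) : nat := (sumn (take r.-1 la) + c)%N.

Definition rad (a b a' b' : nat) : int :=
  (b'%:Z - b%:Z) - (a'%:Z - a%:Z).

Definition nodeof (la : seq nat) (t : nat -> nat -> nat) (x : nat) : nat * nat :=
  head (0%N, 0%N) [seq y <- nodes la | t y.1 y.2 == x].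

Definition is_tableau (n : nat) (la : seq nat) (t : nat -> nat -> nat) : bool :=
  (sumn la == n)
  && all (fun y => (0 < t y.1 y.2 <= n)%N) (nodes la)
  && uniq [seq t y.1 y.2 | y <- nodes la].

Definition standard (la : seq nat) (t : nat -> nat -> nat) : bool :=
  all (fun y =>
         (((y.1, y.2.+1) \in nodes la) ==> (t y.1 y.2 < t y.1 y.2.+1)%N)
      && (((y.1.+1, y.2) \in nodes la) ==> (t y.1 y.2 < t y.1.+1 y.2)%N))
      (nodes la).

Definition sub_shape (la : seq nat) (t : nat -> nat -> nat) (i : nat) : seq nat :=
  [seq x <- [seq count (fun c => t r c <= i)%N (iota 1 (row la r))
            | r <- iota 1 (size la)] | x != 0%N].

Definition dominates (mu la : seq nat) : Prop :=
  forall k, (sumn (take k la) <= sumn (take k mu))%N.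
Definition sdominates (mu la : seq nat) : Prop := dominates mu la /\ mu <> la.

Fixpoint cands (n k : nat) : seq (seq nat) :=
  if k is k'.+1 then [::] :: [seq x :: s | x <- iota 1 n, s <- cands n k']
  else [:: [::]].
Definition partitions (n : nat) : seq (seq nat) := [seq la <- cands n n | part_of n la].

Definition rowof (la : seq nat) (x : nat) : nat :=
  (count (fun r => sumn (take r la) < x)%N (iota 1 (size la))).+1.

(* ---------- Permutations ('S_n acts on 'I_n; entry x <-> ordinal x-1) ---- *)
(* mathcomp composes permutations left to right: (u * v) x = v (u x). *)
Section Perms.
Variable n : nat.

Definition tp (a b : nat) : 'S_n :=
  match insub a, insub b with
  | Some x, Some y => tperm x y
  | _, _ => 1%g
  end.

(* s_i = (i, i+1), 1-based *)
Definition sgen (i : nat) : 'S_n := tp i.-1 i.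

Definition ninv (w : 'S_n) : nat :=
  #|[set p : 'I_n * 'I_n | (p.1 < p.2)%N && (w p.2 < w p.1)%N]|.

Fixpoint redword (fuel : nat) (w : 'S_n) : seq nat :=
  if fuel is f.+1 then
    match [pick i : 'I_n | (0 < i)%N && (ninv (w * sgen i)%g < ninv w)%N] with
    | Some i => rcons (redword f (w * sgen i)%g) i
    | None => [::]
    end
  else [::].
Definition rword (w : 'S_n) : seq nat := redword (n * n) w.

(* the permutation x |-> f x on entries 1..n (1 if f is not a bijection) *)
Definition perm_of (f : nat -> nat) : 'S_n :=
  odflt 1%g [pick s : 'S_n | [forall i : 'I_n, (s i : nat) == (f i.+1).-1]].

(* d(t): t = t^la d(t), i.e. d(t) (t^la[r,c]) = t[r,c] *)
Definition dperm (la : seq nat) (t : nat -> nat -> nat) : 'S_n :=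
  perm_of (fun x => let y := nodeof la (tla la) x in t y.1 y.2).

Definition rowstab (la : seq nat) (w : 'S_n) : bool :=
  [forall i : 'I_n, rowof la (w i).+1 == rowof la i.+1].
End Perms.

Section Hecke.
Variables (K : fieldType) (q : K) (A : algType K) (T : nat -> A).

Definition qint (k : int) : K := (q ^ k - 1) / (q - 1).

(* T_{i,j} = T_{sigma_{i,j}} = T_i ... T_{j-1} *)
Definition Tij (i j : nat) : A := \prod_(i <= k < j) T k.

Definition Tw n (w : 'S_n) : A := \prod_(i <- rword w) T i.

Definition Rrow (nu : seq nat) (i : nat) : A :=
  let a := sumn (take i.-1 nu) in let b := sumn (take i nu) in
  \sum_(a <= e < b) Tij a e.

(* phi_j^i, for the data kj = k_j, cj = c_j, l' = l_{j+1} *)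
Fixpoint phi (nu : seq nat) (kj cj l' : nat) (i : nat) : A :=
  match i with
  | 0 => 1
  | i'.+1 =>
      if i' is 0 then Rrow nu kj.+1
      else (Tij cj (cj + i' * l') - q *: phi nu kj cj l' i') * Rrow nu (kj + i'.+1)
  end.

Definition Pnode (nu : seq nat) (x : nat * nat) : A :=
  let: (k, l) := x in
  let ks := (k, l) :: [seq y <- nodes nu | removable nu y && (k < y.1)%N] in
  \prod_(j < (size ks).-1)
    (let: (kj, lj) := nth (0%N, 0%N) ks j in
     let: (kj1, lj1) := nth (0%N, 0%N) ks j.+1 in
     let cj := tla nu kj lj in
     let cj1 := tla nu kj1 lj1 in
     Tij cj cj1 + (qint (rad kj1 lj1 k l))^-1 *: phi nu kj cj lj1 (kj1 - kj)).

Variable n : nat.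

Definition xla (la : seq nat) : A := \sum_(w : 'S_n | rowstab la w) Tw w.

(* x_{st} = T_{d(s)^{-1}} x_mu T_{d(t)}, the tableaux s, t being given
   by u = d(s), v = d(t) *)
Definition xst (mu : seq nat) (u v : 'S_n) : A := Tw (u^-1)%g * xla mu * Tw v.

(* membership in bar N_la (tensored with K): K-span of the x_{st},
   s, t mu-tableaux, mu a partition of n strictly dominating la *)
Definition in_Nbar (la : seq nat) (h : A) : Prop :=
  exists (m : nat) (c : 'I_m -> K) (mu : 'I_m -> seq nat) (u v : 'I_m -> 'S_n),
    (forall i, part_of n (mu i) /\ sdominates (mu i) la) /\
    h = \sum_(i < m) c i *: xst (mu i) (u i) (v i).

Definition Lp (p : nat) : A :=
  \sum_(1 <= i < p) (q^-1 ^+ i) *: Tw (tp n (p - i).-1 p.-1).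

Definition res (y : nat * nat) : K := qint (y.2%:Z - y.1%:Z).

Definition Rset : seq K :=
  undup [seq res y | y <- flatten [seq nodes mu | mu <- partitions n]].

Definition Et (la : seq nat) (t : nat -> nat -> nat) : A :=
  \prod_(1 <= p < n.+1)
    let r := res (nodeof la t p) in
    \prod_(c <- Rset | c != r) ((r - c)^-1 *: (Lp p - c%:A)).

Definition Pi (la : seq nat) (t : nat -> nat -> nat) (i : nat) : A :=
  Pnode (sub_shape la t i) (nodeof la t i).
Definition Pt (la : seq nat) (t : nat -> nat -> nat) : A :=
  \prod_(j < n) Pi la t (n - j).

(* x_{t^la t} (a representative of e_t) *)
Definition xtt (la : seq nat) (t : nat -> nat -> nat) : A :=
  xst la (dperm n la (tla la)) (dperm n la t).

Definition hecke_rels : Prop :=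
  [/\ forall i j, (1 <= i < n)%N -> (1 <= j < n)%N -> (i.+1 < j)%N ->
        T i * T j = T j * T i,
      forall i, (1 <= i)%N -> (i.+1 < n)%N ->
        T i * T i.+1 * T i = T i.+1 * T i * T i.+1
    & forall i, (1 <= i < n)%N -> (T i - q%:A) * (T i + 1) = 0].
End Hecke.

(* Main.v *)
(* The vector e_la E_n, where n sits at a removable node (k, l) and E_n is the
   L_n-part of E_t, can be computed by moving the end c_0 of row k through the
   later positions of t^la with the normalised intertwiners
   T_p + 1/[rho - content(p+1)]: the result is an L_n-eigenvector with residue
   that of (k, l), it differs from e_la T_{c_0,n} by vectors with other
   L_n-eigenvalues, and these are killed by E_n because L_n acts semisimply.
   Multiplying out the intertwiners along one row collapses to
   T_{c,c'} + R/[s], and along a block of rows of equal length the Garnir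
   relations collapse the product further to T + F/[r], which is the factor of
   P_{la,(k,l)}. Finally e_la P_{la,(k,l)} generates a copy of S^mu for
   mu = la minus (k, l): it is a multiple of x_mu, and it sends the ideal N_mu
   into N_la because the central element L_2 + ... + L_{n-1} separates S^mu from
   all more dominant shapes. Induction on n concludes. The same central element
   yields the semisimplicity of L_n, since q is transcendental and the multiset
   of contents determines a partition. *)
Require Import Defs.
From HB Require Import structures.
From mathcomp Require Import all_boot all_order all_algebra all_fingroup.
From mathcomp Require Import fraction complex Rstruct.
From mathcomp Require Import zify ring.
Import GRing.Theory.
Local Open Scope ring_scope.
Set Implicit Arguments.
Unset Strict Implicit.
Unset Printing Implicit Defensive.

(** * Reduced words and Matsumoto's theorem *)

Section Inversions.
Variable n : nat.
Implicit Types (w : 'S_n) (i : nat).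

Lemma sgenE i (x : 'I_n) : (0 < i < n)%N ->
  sgen n i x = (if x == i.-1 :> nat then i else if x == i :> nat then i.-1 else x) :> nat.
Proof.
move=> /andP[i0 iN]; have i1N : (i.-1 < n)%N by lia.
rewrite /sgen /tp !insubT /= permE /=.
rewrite -!val_eqE /=; case: eqP => // _; case: eqP => //.
Qed.

Lemma sgenK i : (sgen n i * sgen n i)%g = 1%g.
Proof.
rewrite /sgen /tp; case: insub => [x|]; last by rewrite mulg1.
by case: insub => [y|]; rewrite ?tperm2 ?mulg1.
Qed.

Lemma mulsgK w i : (w * sgen n i * sgen n i)%g = w.
Proof. by rewrite -mulgA sgenK mulg1. Qed.

(* [i] stands left, resp. right, of [i.+1] in the one-line notation of [w^-1];
   entries are 1-based, ordinals 0-based. *)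
Definition asc w i := forall a b : 'I_n, (w a).+1 = i -> w b = i :> nat -> (a < b)%N.
Definition desc w i := forall a b : 'I_n, (w a).+1 = i -> w b = i :> nat -> (b < a)%N.

Lemma perm_preim w k : (k < n)%N -> exists a : 'I_n, w a = k :> nat.
Proof. by move=> kn; exists ((w^-1)%g (Ordinal kn)); rewrite permKV. Qed.

Lemma asc_or_desc w i : (0 < i < n)%N -> asc w i \/ desc w i.
Proof.
move=> Hi; have [|a Ea] := @perm_preim w i.-1; first lia.
have [|b Eb] := @perm_preim w i; first lia.
have U a' b' : (w a').+1 = i -> w b' = i :> nat -> a' = a /\ b' = b.
  move=> Ea' Eb'; split; apply: (@perm_inj _ w); apply: val_inj => /=; lia.
case: (ltngtP a b) => [ab|ba|ab].
- by left => a' b' /U H /H [-> ->].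
- by right => a' b' /U H /H [-> ->].
- by move: Eb; rewrite -(val_inj ab); lia.
Qed.

Lemma asc_sgen w i : (0 < i < n)%N -> desc w i -> asc (w * sgen n i)%g i.
Proof.
move=> Hi H a b; rewrite !permM !sgenE // => Ha Hb; apply: H.
  by move: Hb; repeat case: ifP => ?; lia.
by move: Ha; repeat case: ifP => ?; lia.
Qed.

Lemma desc_sgen w i : (0 < i < n)%N -> asc w i -> desc (w * sgen n i)%g i.
Proof.
move=> Hi H a b; rewrite !permM !sgenE // => Ha Hb; apply: H.
  by move: Hb; repeat case: ifP => ?; lia.
by move: Ha; repeat case: ifP => ?; lia.
Qed.

Lemma ninv_asc w i : (0 < i < n)%N -> asc w i -> ninv (w * sgen n i)%g = (ninv w).+1.
Proof.
move=> Hi H; have [|a Ea] := @perm_preim w i.-1; first lia.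
have [|b Eb] := @perm_preim w i; first lia.
have ab : (a < b)%N by apply: H; lia.
rewrite /ninv.
have -> : [set p : 'I_n * 'I_n | (p.1 < p.2)%N &
   ((w * sgen n i)%g p.2 < (w * sgen n i)%g p.1)%N] =
   (a, b) |: [set p : 'I_n * 'I_n | (p.1 < p.2)%N & (w p.2 < w p.1)%N].
  apply/setP => -[x y]; rewrite !inE /= !permM !sgenE // xpair_eqE.
  have Da : (x == a) = (w x == i.-1 :> nat).
    by apply/eqP/eqP => [->//|E]; apply: (@perm_inj _ w); apply: val_inj => /=; lia.
  have Db : (y == b) = (w y == i :> nat).
    by apply/eqP/eqP => [->//|E]; apply: (@perm_inj _ w); apply: val_inj => /=; lia.
  have Dxy : (w x == w y :> nat) -> (x == y :> nat).
    by move=> /eqP/val_inj/perm_inj ->.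
  rewrite Da Db; case: (ltnP x y) => xy /=.
    have {}Dxy : w x != w y :> nat by apply/negP => /Dxy; lia.
    have Hyx : ((w y).+1 = i -> w x = i :> nat -> False)%N.
      by move=> E1 E2; have := H _ _ E1 E2; lia.
    by repeat case: ifP => ?; lia.
  symmetry; apply/negbTE/negP => /orP[] // /andP[/eqP E1 /eqP E2].
  by have := H x y; lia.
rewrite cardsU1 inE /= ab /=.
by rewrite Ea Eb; have -> : (i < i.-1)%N = false by lia.
Qed.

Lemma ninv_desc w i : (0 < i < n)%N -> desc w i ->
  ninv w = (ninv (w * sgen n i)%g).+1.
Proof. by move=> Hi H; rewrite -[in LHS](mulsgK w i) ninv_asc //; apply: asc_sgen. Qed.

Lemma ninv_lt_desc w i : (0 < i < n)%N ->
  (ninv (w * sgen n i)%g < ninv w)%N -> desc w i.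
Proof.
by move=> Hi H; case: (asc_or_desc w Hi) => // A; move: H; rewrite ninv_asc //; lia.
Qed.

Lemma ninv1 : ninv (1%g : 'S_n) = 0%N.
Proof.
apply/eqP; rewrite cards_eq0; apply/eqP/setP => -[x y].
by rewrite !inE !perm1 /=; apply/negbTE/negP; lia.
Qed.

Lemma all_asc_1 w : (forall i, (0 < i < n)%N -> asc w i) -> w = 1%g.
Proof.
move=> H; have mono k : forall a b : 'I_n, (w a + k.+1)%N = w b -> (a < b)%N.
  elim: k => [|k IH] a b E.
    by apply: (H (w b)); have := ltn_ord (w b); lia.
  have [|c Ec] := @perm_preim w (w a + k.+1); first by have := ltn_ord (w b); lia.
  have ac := IH a c (esym Ec).
  by have := H (w b) _ c b; have := ltn_ord (w b); lia.
have mono' a b : (w a < w b)%N -> (a < b)%N.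
  by move=> ab; apply: (mono (w b - w a).-1); lia.
have up m : forall a : 'I_n, w a = m :> nat -> (m <= a)%N.
  elim: m => // m IH a Ea.
  have [|c Ec] := @perm_preim w m; first by have := ltn_ord (w a); lia.
  have := IH c Ec; have := mono' c a; lia.
have dn m : forall a : 'I_n, (w a + m.+1)%N = n -> (a + m.+1 <= n)%N.
  elim: m => [|m IH] a Ea; first by have := ltn_ord a; lia.
  have [|c Ec] := @perm_preim w (w a).+1; first by lia.
  have := IH c; have := mono' a c; lia.
apply/permP => a; rewrite perm1; apply: val_inj => /=.
have := up _ a erefl; have := dn (n - (w a).+1)%N a.
by have := ltn_ord (w a); lia.
Qed.

Lemma ninv_le_sq w : (ninv w <= n * n)%N.
Proof. by rewrite -[X in (_ <= X)%N](_ : #|{: 'I_n * 'I_n}| = _) ?max_card // card_prod card_ord. Qed.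

Lemma asc_mull w i : (0 < i < n)%N ->
  (forall a b : 'I_n, a.+1 = i -> b = i :> nat -> (w a < w b)%N) ->
  ninv (sgen n i * w)%g = (ninv w).+1.
Proof.
move=> Hi H; have Hi1 : (i.-1 < n)%N by lia.
have Hi2 : (i < n)%N by lia.
pose a := Ordinal Hi1; pose b := Ordinal Hi2.
have Ea : a = i.-1 :> nat by [].
have Eb : b = i :> nat by [].
have Hab : (w a < w b)%N by apply: H; rewrite /=; lia.
pose f (p : 'I_n * 'I_n) := (sgen n i p.1, sgen n i p.2).
have sK x : sgen n i (sgen n i x) = x by rewrite -permM sgenK perm1.
have fK : involutive f by case=> x y; rewrite /f /= !sK.
rewrite /ninv -(card_imset _ (inv_inj fK)).
have -> : [set f p | p in [set p : 'I_n * 'I_n | (p.1 < p.2)%N &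
     ((sgen n i * w)%g p.2 < (sgen n i * w)%g p.1)%N]] =
   (b, a) |: [set p : 'I_n * 'I_n | (p.1 < p.2)%N & (w p.2 < w p.1)%N].
  apply/setP => -[x y]; rewrite -{1}[(x, y)]fK (mem_imset _ _ (inv_inj fK)).
  rewrite !inE /= !permM !sK !sgenE // xpair_eqE -!val_eqE /=.
  have Dxy : (x == y :> nat) -> w x = w y :> nat by move=> /eqP/val_inj ->.
  have Hba : x = i :> nat -> y = i.-1 :> nat -> (w y < w x)%N.
    by move=> E1 E2; apply: H; lia.
  have Hab' : x = i.-1 :> nat -> y = i :> nat -> (w x < w y)%N.
    by move=> E1 E2; apply: H; lia.
  case: (ltnP (w y) (w x)) => xy /=; rewrite ?andbF ?andbT ?orbF.
    have {}Dxy : x != y :> nat by apply/negP => /Dxy; lia.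
    by repeat case: ifP => ?; lia.
  by symmetry; apply/negbTE/negP => /andP[/eqP E1 /eqP E2]; have := Hba E1 E2; lia.
rewrite cardsU1 inE /= [_.+1]/=.
by have -> : (i < i.-1)%N = false by lia.
Qed.

End Inversions.

Ltac split_ifs := repeat match goal with
  | |- context [if ?c then _ else _] =>
    lazymatch c with context [if _ then _ else _] => fail | _ => case: (boolP c) => ? end
  end.

Section HeckeTw.
Variables (K : fieldType) (q : K) (A : algType K) (T : nat -> A) (n : nat).
Hypothesis HT : hecke_rels q T n.

Lemma T_far i j : (0 < i < n)%N -> (0 < j < n)%N -> (i.+1 < j)%N || (j.+1 < i)%N ->
  T i * T j = T j * T i.
Proof.
case: HT => far _ _ Hi Hj /orP[] H; first by apply: far; lia.
by symmetry; apply: far; lia.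
Qed.

Lemma T_braid i : (0 < i)%N -> (i.+1 < n)%N -> T i * T i.+1 * T i = T i.+1 * T i * T i.+1.
Proof. by case: HT => _ + _; apply. Qed.

Lemma T_sqr i : (0 < i < n)%N -> T i * T i = (q - 1) *: T i + q%:A.
Proof.
case: HT => _ _ quad Hi; have := quad i Hi.
rewrite mulrDr mulr1 mulrBl mulr_algl => /eqP.
rewrite addr_eq0 subr_eq => /eqP ->.
by rewrite scalerBl scale1r opprB -addrA addrC (addrC (- T i)).
Qed.

Lemma Tw1 : Tw T (1%g : 'S_n) = 1.
Proof.
rewrite /Tw /rword; case: (n * n)%N => [|f] /=; first by rewrite big_nil.
by case: pickP => [i|_]; rewrite ?big_nil // ninv1 ltn0 andbF.
Qed.

Lemma redword_fuel f1 f2 (w : 'S_n) : (ninv w <= f1)%N -> (ninv w <= f2)%N ->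
  redword f1 w = redword f2 w.
Proof.
elim: f1 f2 w => [|f1 IH] [|f2] w H1 H2 //=.
- by case: pickP => // i /andP[_]; move: H1; lia.
- by case: pickP => // i /andP[_]; move: H2; lia.
case: pickP => // i /andP[_ Hi]; rewrite (IH f2) //; lia.
Qed.

Lemma Tw_rec (w : 'S_n) : w <> 1%g ->
  exists i, [/\ (0 < i < n)%N, desc w i & Tw T w = Tw T (w * sgen n i)%g * T i].
Proof.
move=> w1; rewrite /Tw /rword.
have E : redword (n * n) w = redword (ninv w).+1 w.
  by apply: redword_fuel => //; apply: ninv_le_sq.
rewrite E /=; case: pickP => [i /andP[i0 Hi]|Hno].
  have iN : (0 < i < n)%N by rewrite i0 ltn_ord.
  exists i; split=> //; first exact: ninv_lt_desc.
  rewrite big_rcons /= /Monoid.Law.sort /=.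
  by rewrite (@redword_fuel (n * n) (ninv w)) //; [exact: ninv_le_sq|lia].
case: w1; apply: all_asc_1 => i Hi; case: (asc_or_desc w Hi) => // D.
have iN : (i < n)%N by lia.
have := Hno (Ordinal iN); rewrite /= (ninv_desc Hi D); lia.
Qed.

(* Matsumoto's theorem: the word chosen by [rword] is irrelevant. *)
Lemma Tw_asc (w : 'S_n) i : (0 < i < n)%N -> asc w i -> Tw T (w * sgen n i)%g = Tw T w * T i.
Proof.
move: {2}(ninv w) (leqnn (ninv w)) => m; elim: m w i => [|m IH] w i Hm Hi Hasc.
  have -> : w = 1%g.
    apply: all_asc_1 => j Hj; case: (asc_or_desc w Hj) => // D.
    by move: Hm; rewrite (ninv_desc Hj D).
  rewrite Tw1 !mul1g mul1r.
  have Hd : desc (sgen n i) i by rewrite -[sgen n i]mul1g; apply: desc_sgen => // a b; rewrite !perm1; lia.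
  have Hw : sgen n i <> 1%g by move=> E; move: Hd; rewrite E => Hd;
    have H1 : (i.-1 < n)%N by [lia]; have H2 : (i < n)%N by [lia];
    have := Hd (Ordinal H1) (Ordinal H2); rewrite !perm1 /=; lia.
  have [j [Hj Hdj ->]] := Tw_rec Hw.
  have <- : i = j.
    apply/eqP/negP => /negP ij.
    have Hj1 : (j.-1 < n)%N by lia.
    have Hj2 : (j < n)%N by lia.
    have [a Ea] := perm_preim (sgen n i) Hj1.
    have [b Eb] := perm_preim (sgen n i) Hj2.
    have Hba : (b < a)%N by apply: Hdj => //; lia.
    by move: Ea Eb; rewrite !sgenE //; split_ifs; lia.
  by rewrite sgenK Tw1 mul1r.
have [v Ev] : exists v, v = (w * sgen n i)%g by eexists.
have Dv : desc v i by rewrite Ev; apply: desc_sgen.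
have Lv : ninv v = (ninv w).+1 by rewrite Ev; apply: ninv_asc.
rewrite -Ev.
have v1 : v <> 1%g by move=> E; move: Lv; rewrite E ninv1.
have [j [Hj Dj ->]] := Tw_rec v1.
have [<-|ij] := eqVneq i j; first by rewrite Ev mulsgK.
have Lj := ninv_desc Hj Dj.
have Ew : w = (v * sgen n i)%g by rewrite Ev mulsgK.
have preim (u : 'S_n) k : (0 < k < n)%N -> exists a b : 'I_n, (u a).+1 = k /\ u b = k :> nat.
  move=> Hk; have [|a Ea] := @perm_preim _ u k.-1; first lia.
  by have [|b Eb] := @perm_preim _ u k; [lia | exists a, b; split; lia].
have [far|near] := boolP ((i.+1 < j)%N || (j.+1 < i)%N).
  have Di' : desc (v * sgen n j)%g i.
    move=> a b; rewrite !permM !sgenE // => Ea Eb; apply: Dv.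
      by move: Ea; split_ifs; lia.
    by move: Eb; split_ifs; lia.
  have Dj' : desc w j.
    rewrite Ew => a b; rewrite !permM !sgenE // => Ea Eb; apply: Dj.
      by move: Ea; split_ifs; lia.
    by move: Eb; split_ifs; lia.
  have comm : (sgen n i * sgen n j = sgen n j * sgen n i)%g.
    apply/permP => a; apply: val_inj => /=; rewrite !permM !sgenE //.
    by split_ifs; lia.
  set u := (v * sgen n j * sgen n i)%g.
  have Eu : u = (w * sgen n j)%g by rewrite Ew /u -!mulgA comm.
  have E1 : (v * sgen n j)%g = (u * sgen n i)%g by rewrite mulsgK.
  have E2 : w = (u * sgen n j)%g by rewrite Eu mulsgK.
  rewrite E1 IH //; last first.
  - by rewrite /u; apply: asc_sgen.
  - by have := ninv_desc Hi Di'; rewrite -/u; lia.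
  rewrite [in RHS]E2 IH //; last first.
  - by rewrite Eu; apply: asc_sgen.
  - by have := ninv_desc Hi Di'; rewrite -/u; lia.
  by rewrite -!mulrA (T_far Hi Hj).
have braid : (sgen n i * sgen n j * sgen n i = sgen n j * sgen n i * sgen n j)%g.
  apply/permP => a; apply: val_inj => /=; rewrite !permM !sgenE //.
  by split_ifs; lia.
set u := (w * sgen n j * sgen n i)%g.
have [a [b [Ea Eb]]] := preim v _ Hi; have [c [d [Ec Ed]]] := preim v _ Hj.
have Hba := Dv _ _ Ea Eb; have Hdc := Dj _ _ Ec Ed.
have vI x y : v x = v y :> nat -> x = y by move=> E; apply: (@perm_inj _ v); apply: val_inj.
(* Descents survive along both sides of the braid hexagon. *)
have D1 : desc w j.
  rewrite Ew => x y; rewrite !permM !sgenE // => Ex Ey.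
  case: (ltngtP i j) => [lt|lt|/eqP]; last by rewrite (negbTE ij).
    have -> : x = a by apply: vI; move: Ex; split_ifs; lia.
    have -> : y = d by apply: vI; move: Ey; split_ifs; lia.
    by have := vI b c; move=> /(_ ltac:(lia)) E; move: Hba; rewrite E; lia.
  have -> : x = c by apply: vI; move: Ex; split_ifs; lia.
  have -> : y = b by apply: vI; move: Ey; split_ifs; lia.
  by have := vI a d; move=> /(_ ltac:(lia)) E; move: Hba; rewrite E; lia.
have D2 : desc (w * sgen n j)%g i.
  rewrite Ew => x y; rewrite !permM !sgenE // => Ex Ey.
  case: (ltngtP i j) => [lt|lt|/eqP]; last by rewrite (negbTE ij).
    have -> : x = c by apply: vI; move: Ex; split_ifs; lia.
    by have -> : y = d by apply: vI; move: Ey; split_ifs; lia.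
  have -> : x = c by apply: vI; move: Ex; split_ifs; lia.
  by have -> : y = d by apply: vI; move: Ey; split_ifs; lia.
have D3 : desc (v * sgen n j)%g i.
  move=> x y; rewrite !permM !sgenE // => Ex Ey.
  case: (ltngtP i j) => [lt|lt|/eqP]; last by rewrite (negbTE ij).
    have -> : x = a by apply: vI; move: Ex; split_ifs; lia.
    have -> : y = d by apply: vI; move: Ey; split_ifs; lia.
    by have := vI b c; move=> /(_ ltac:(lia)) E; move: Hba; rewrite E; lia.
  have -> : x = c by apply: vI; move: Ex; split_ifs; lia.
  have -> : y = b by apply: vI; move: Ey; split_ifs; lia.
  by have := vI a d; move=> /(_ ltac:(lia)) E; move: Hba; rewrite E; lia.
have E4 : u = (v * sgen n j * sgen n i * sgen n j)%g.
  by rewrite /u Ew -!mulgA; congr (_ * _)%g; rewrite !mulgA braid.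
have D4 : desc (v * sgen n j * sgen n i)%g j.
  move=> x y; rewrite !permM !sgenE // => Ex Ey.
  case: (ltngtP i j) => [lt|lt|/eqP]; last by rewrite (negbTE ij).
    have -> : x = a by apply: vI; move: Ex; split_ifs; lia.
    by have -> : y = b by apply: vI; move: Ey; split_ifs; lia.
  have -> : x = a by apply: vI; move: Ex; split_ifs; lia.
  by have -> : y = b by apply: vI; move: Ey; split_ifs; lia.
have L1 := ninv_desc Hj D1; have L2 := ninv_desc Hi D2; rewrite -/u in L2.
have L3 := ninv_desc Hi D3; have L4 := ninv_desc Hj D4; rewrite -E4 in L4.
have -> : Tw T (v * sgen n j)%g = Tw T u * T j * T i.
  rewrite -[(v * sgen n j)%g](mulsgK _ i) IH //; [|lia|exact: asc_sgen].
  rewrite -[(v * sgen n j * sgen n i)%g](mulsgK _ j) IH //; last exact: asc_sgen.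
    by rewrite -E4.
  by rewrite -E4; lia.
have -> : Tw T w = Tw T u * T i * T j.
  rewrite -[w](mulsgK _ j) IH //; [|lia|exact: asc_sgen].
  rewrite -[(w * sgen n j)%g](mulsgK _ i) IH //; last exact: asc_sgen.
  by rewrite -/u; lia.
rewrite -!mulrA; congr (_ * _); rewrite !mulrA.
have [E|E] : j = i.+1 \/ i = j.+1 by lia.
- by rewrite E in Hj *; rewrite T_braid //; lia.
- by rewrite E in Hi *; rewrite T_braid //; lia.
Qed.

End HeckeTw.

Section Gen.
Variables (K : fieldType) (A : algType K) (T : nat -> A).

(* The image in [A] of the Hecke algebra on [m] strands. *)
Inductive gen (m : nat) : A -> Prop :=
| gen_cst c : gen m c%:A
| gen_T i : (0 < i < m)%N -> gen m (T i)
| gen_add x y : gen m x -> gen m y -> gen m (x + y)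
| gen_mul x y : gen m x -> gen m y -> gen m (x * y).

Lemma gen_one m : gen m 1.
Proof. by rewrite -[1](scale1r); apply: gen_cst. Qed.

Lemma gen_zero m : gen m 0.
Proof. by rewrite -[0](scale0r (1 : A)); apply: gen_cst. Qed.

Lemma gen_scale m c x : gen m x -> gen m (c *: x).
Proof. by move=> Hx; rewrite -mulr_algl; apply: gen_mul => //; apply: gen_cst. Qed.

Lemma gen_opp m x : gen m x -> gen m (- x).
Proof. by rewrite -scaleN1r; apply: gen_scale. Qed.

Lemma gen_sub m x y : gen m x -> gen m y -> gen m (x - y).
Proof. by move=> Hx Hy; apply: gen_add => //; apply: gen_opp. Qed.

Lemma gen_sum m (I : eqType) (r : seq I) (P : pred I) F :
  (forall i, i \in r -> P i -> gen m (F i)) -> gen m (\sum_(i <- r | P i) F i).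
Proof.
move=> H; rewrite big_seq_cond; apply: big_ind => [||i /andP[]]; first exact: gen_zero.
  by move=> ? ?; apply: gen_add.
exact: H.
Qed.

Lemma gen_prod m (I : eqType) (r : seq I) (P : pred I) F :
  (forall i, i \in r -> P i -> gen m (F i)) -> gen m (\prod_(i <- r | P i) F i).
Proof.
move=> H; rewrite big_seq_cond; apply: big_ind => [||i /andP[]]; first exact: gen_one.
  by move=> ? ?; apply: gen_mul.
exact: H.
Qed.

Lemma gen_le m p x : (m <= p)%N -> gen m x -> gen p x.
Proof.
move=> mp; elim=> [c|i Hi|y z _ Hy _ Hz|y z _ Hy _ Hz].
- exact: gen_cst.
- by apply: gen_T; lia.
- exact: gen_add.
- exact: gen_mul.
Qed.

Lemma gen_comm m z g : (forall i, (0 < i < m)%N -> z * T i = T i * z) -> gen m g -> z * g = g * z.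
Proof.
move=> H; elim=> [c|i Hi|y w _ Hy _ Hw|y w _ Hy _ Hw].
- by rewrite mulr_algl mulr_algr.
- exact: H.
- by rewrite mulrDr mulrDl Hy Hw.
- by rewrite mulrA Hy -mulrA Hw mulrA.
Qed.

End Gen.

Lemma sumn_take_mono (b : seq nat) r1 r2 : (r1 <= r2)%N -> (sumn (take r1 b) <= sumn (take r2 b))%N.
Proof.
move=> r12; have -> : r2 = (r1 + (r2 - r1))%N by lia.
by rewrite takeD sumn_cat leq_addr.
Qed.

(* [s] and [s.+1] lie in the same row. *)
Definition inner (b : seq nat) (s : nat) : Prop := forall r, sumn (take r b) <> s.

Lemma innerP b s : inner b s \/ exists r, sumn (take r b) = s.
Proof.
case: (boolP (has (fun r => sumn (take r b) == s) (iota 0 (size b).+1))) => [/hasP[r _ /eqP E]|H].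
  by right; exists r.
left=> r E; move/hasP: H; apply; exists (minn r (size b)).
  by rewrite mem_iota add0n; lia.
apply/eqP; rewrite -E; case: leqP => // H.
by rewrite take_size take_oversize // ltnW.
Qed.

Lemma rowof_inner b s : inner b s -> rowof b s.+1 = rowof b s.
Proof.
move=> H; rewrite /rowof; congr _.+1; apply: eq_count => r /=.
by have := H r; lia.
Qed.

Lemma rowof_mono b x y : (x <= y)%N -> (rowof b x <= rowof b y)%N.
Proof. by move=> xy; rewrite /rowof ltnS; apply: sub_count => r /=; lia. Qed.

Lemma rowof_bdry b r s : (0 < s)%N -> sumn (take r b) = s -> (rowof b s < rowof b s.+1)%N.
Proof.
move=> s0 E; rewrite /rowof ltnS.
have -> : count (fun r => sumn (take r b) < s.+1)%N (iota 1 (size b)) =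
  (count (fun r => sumn (take r b) < s)%N (iota 1 (size b)) +
   count (fun r => sumn (take r b) == s)%N (iota 1 (size b)))%N.
  rewrite -count_predUI; set c := count (predI _ _) _; suff -> : c = 0%N.
    by rewrite addn0; apply: eq_count => k /=; lia.
  by apply/eqP; rewrite /c -leqn0 leqNgt -has_count; apply/hasP => -[k _ /=]; lia.
rewrite -[X in (X < _)%N]addn0 ltn_add2l -has_count; apply/hasP.
exists (minn r (size b)).
  rewrite mem_iota; case: r E => [|r]; first by rewrite take0 /=; lia.
  by case: (b) => [|? ?] /=; lia.
apply/eqP; rewrite -E; case: leqP => // H.
by rewrite take_size take_oversize // ltnW.
Qed.

Section HeckeXla.
Variables (K : fieldType) (q : K) (A : algType K) (T : nat -> A) (n : nat).
Hypothesis HT : hecke_rels q T n.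

Lemma Tw_desc (w : 'S_n) i : (0 < i < n)%N -> desc w i ->
  Tw T w * T i = (q - 1) *: Tw T w + q *: Tw T (w * sgen n i)%g.
Proof.
move=> Hi D; have E : Tw T w = Tw T (w * sgen n i)%g * T i.
  by rewrite -(Tw_asc HT) ?mulsgK //; apply: asc_sgen.
by rewrite {1}E -mulrA (T_sqr HT) // mulrDr -scalerAr -E mulr_algr.
Qed.

Definition lasc (w : 'S_n) i := forall a b : 'I_n, a.+1 = i -> b = i :> nat -> (w a < w b)%N.

Lemma Tw_lasc (w : 'S_n) i : (0 < i < n)%N -> lasc w i -> Tw T (sgen n i * w)%g = T i * Tw T w.
Proof.
move: {2}(ninv w) (leqnn (ninv w)) => m; elim: m w => [|m IH] w Hm Hi Hl.
  have -> : w = 1%g.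
    apply: all_asc_1 => j Hj; case: (asc_or_desc w Hj) => // D.
    by move: Hm; rewrite (ninv_desc Hj D).
  by rewrite Tw1 mulr1 mulg1 -[sgen n i]mul1g (Tw_asc HT) ?Tw1 ?mul1r // => a b; rewrite !perm1; lia.
have [->|/eqP w1] := eqVneq w 1%g.
  by rewrite Tw1 mulr1 mulg1 -[sgen n i]mul1g (Tw_asc HT) ?Tw1 ?mul1r // => a b; rewrite !perm1; lia.
have [j [Hj Dj ->]] := Tw_rec T w1.
have Lj := ninv_desc Hj Dj.
have Hl' : lasc (w * sgen n j)%g i.
  move=> a b Ea Eb; have Hab := Hl a b Ea Eb; rewrite !permM !sgenE //.
  have : ~ (w a = j.-1 :> nat /\ w b = j :> nat).
    by case=> E1 E2; have := Dj a b; lia.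
  by split_ifs; lia.
rewrite mulrA -IH //; last by lia.
have Hasc : asc (sgen n i * (w * sgen n j))%g j.
  case: (asc_or_desc (sgen n i * (w * sgen n j))%g Hj) => //.
  by move/(ninv_desc Hj); rewrite (asc_mull Hi Hl') -!mulgA sgenK mulg1 (asc_mull Hi Hl); lia.
by rewrite -(Tw_asc HT Hj Hasc) -!mulgA sgenK mulg1.
Qed.

Lemma lasc_or_ldesc (w : 'S_n) i : (0 < i < n)%N -> lasc w i \/ lasc (sgen n i * w)%g i.
Proof.
move=> Hi; have H1 : (i.-1 < n)%N by lia.
have H2 : (i < n)%N by lia.
pose a := Ordinal H1; pose b := Ordinal H2.
have U (c d : 'I_n) : c.+1 = i -> d = i :> nat -> c = a /\ d = b.
  by move=> Ec Ed; split; apply: val_inj => /=; lia.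
have E1 : sgen n i a = b by apply: val_inj; rewrite /= sgenE //=; split_ifs; lia.
have E2 : sgen n i b = a by apply: val_inj; rewrite /= sgenE //=; split_ifs; lia.
have [lt|le] := ltnP (w a) (w b).
  by left=> c d /U H /H [-> ->].
right=> c d /U H /H [-> ->]; rewrite !permM E1 E2 ltn_neqAle le andbT.
by apply/negP => /eqP/val_inj/perm_inj/(congr1 val) /=; lia.
Qed.

Lemma Tw_ldesc (w : 'S_n) i : (0 < i < n)%N -> lasc (sgen n i * w)%g i ->
  T i * Tw T w = (q - 1) *: Tw T w + q *: Tw T (sgen n i * w)%g.
Proof.
move=> Hi D; have E : Tw T w = T i * Tw T (sgen n i * w)%g.
  by rewrite -Tw_lasc // mulgA sgenK mul1g.
by rewrite {1}E mulrA (T_sqr HT) // mulrDl -scalerAl -E mulr_algl.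
Qed.

Lemma Tw_gen (w : 'S_n) : gen T n (Tw T w).
Proof.
move: {2}(ninv w) (leqnn (ninv w)) => m; elim: m w => [|m IH] w Hm;
  have [->|/eqP w1] := eqVneq w 1%g; rewrite ?Tw1; try exact: gen_one.
  by have [j [Hj Dj _]] := Tw_rec T w1; move: Hm; rewrite (ninv_desc Hj Dj).
have [j [Hj Dj ->]] := Tw_rec T w1; apply: gen_mul; last exact: gen_T.
by apply: IH; have := ninv_desc Hj Dj; lia.
Qed.

Lemma T_inv i : q != 0 -> (0 < i < n)%N -> T i * (q^-1 *: (T i - (q - 1)%:A)) = 1.
Proof.
move=> q0 Hi; rewrite -scalerAr mulrBr (T_sqr HT) // mulr_algr addrAC subrr add0r.
by rewrite scalerA mulVf // scale1r.
Qed.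

Lemma Tw_inv (w : 'S_n) : q != 0 -> exists2 v, gen T n v & Tw T w * v = 1.
Proof.
move=> q0; move: {2}(ninv w) (leqnn (ninv w)) => m; elim: m w => [|m IH] w Hm;
  have [->|/eqP w1] := eqVneq w 1%g; try by exists 1; [exact: gen_one|rewrite Tw1 mulr1].
  by have [j [Hj Dj _]] := Tw_rec T w1; move: Hm; rewrite (ninv_desc Hj Dj).
have [j [Hj Dj ->]] := Tw_rec T w1.
have [|v Gv Ev] := IH (w * sgen n j)%g; first by have := ninv_desc Hj Dj; lia.
exists ((q^-1 *: (T j - (q - 1)%:A)) * v).
  apply: gen_mul => //; apply: gen_scale; apply: gen_sub; last exact: gen_cst.
  exact: gen_T.
by rewrite -mulrA (mulrA (T j)) T_inv // mul1r.
Qed.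

Lemma Tw_parallel (w : 'S_n) s s' : (0 < s < n)%N -> (0 < s' < n)%N ->
  (forall a : 'I_n, a.+1 = s -> (w a).+1 = s') ->
  (forall a : 'I_n, a = s :> nat -> w a = s' :> nat) ->
  T s * Tw T w = Tw T w * T s'.
Proof.
move=> Hs Hs' E1 E2.
have Hl : lasc w s by move=> a b /E1 + /E2; lia.
have inj (a b : 'I_n) : w a = w b :> nat -> a = b by move=> E; apply: (@perm_inj _ w); apply: val_inj.
have H1 : (s.-1 < n)%N by lia.
have H2 : (s < n)%N by lia.
have F1 := E1 (Ordinal H1) ltac:(rewrite /=; lia); have F2 := E2 (Ordinal H2) erefl.
have Ha : asc w s'.
  move=> a b Ea Eb; have -> : a = Ordinal H1 by apply: inj; lia.
  by have -> /= : b = Ordinal H2 by [apply: inj; rewrite F2; lia]; lia.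
rewrite -Tw_lasc // -(Tw_asc HT) //; congr (Tw T _).
apply/permP => x; apply: val_inj; rewrite /= !permM (sgenE _ Hs').
case: (x =P Ordinal H1 :> 'I_n) => [->|N1].
  have -> : sgen n s (Ordinal H1) = Ordinal H2.
    by apply: val_inj; rewrite /= sgenE //=; split_ifs; lia.
  by split_ifs; lia.
case: (x =P Ordinal H2 :> 'I_n) => [->|N2].
  have -> : sgen n s (Ordinal H2) = Ordinal H1.
    by apply: val_inj; rewrite /= sgenE //=; split_ifs; lia.
  by split_ifs; lia.
have -> : sgen n s x = x.
  apply: val_inj; rewrite /= sgenE //.
  have := N1; have := N2.
  by case: eqP => [E|_] => [|]; [move=> _ []; apply: val_inj|case: eqP => [E|_] // []; apply: val_inj].
case: eqP => [E|_]; first by case: N1; apply: inj; lia.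
by case: eqP => [E|_] //; case: N2; apply: inj; lia.
Qed.

End HeckeXla.

(** * Young symmetrisers and the ideal of more dominant shapes *)

Section Young.
Variable n : nat.
Implicit Types (w : 'S_n) (b : seq nat).

Lemma rowstab_mulr b i w : (0 < i < n)%N -> inner b i ->
  rowstab b (w * sgen n i)%g = rowstab b w.
Proof.
move=> Hi Hb; apply: eq_forallb => x; rewrite permM; congr (_ == _).
rewrite sgenE //; have Ei : i.-1.+1 = i by lia.
case: eqP => [->|_]; first by rewrite Ei rowof_inner.
by case: eqP => [->|_] //; rewrite Ei rowof_inner.
Qed.

Lemma rowstab_desc b i w : (0 < i < n)%N -> rowstab b w -> desc w i -> inner b i.
Proof.
move=> Hi /forallP Hw D; case: (innerP b i) => // -[r Er].
have [|x Ex] := @perm_preim _ w i.-1; first lia.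
have [|y Ey] := @perm_preim _ w i; first lia.
have Hyx : (y < x)%N by apply: D => //; lia.
have /eqP := Hw x; have /eqP := Hw y; rewrite Ex Ey => E1 E2.
have Ei : i.-1.+1 = i by lia.
have : (rowof b i < rowof b i.+1)%N by apply: rowof_bdry Er; lia.
rewrite E1 -{1}Ei E2; have := @rowof_mono b y.+1 x.+1; lia.
Qed.

Lemma rowstab1 b : rowstab b (1%g : 'S_n).
Proof. by apply/forallP => x; rewrite perm1. Qed.

End Young.

Section HeckeYoung.
Variables (K : fieldType) (q : K) (A : algType K) (T : nat -> A) (n : nat).
Hypothesis HT : hecke_rels q T n.
Implicit Types (b : seq nat).

Lemma xla_gen b : gen T n (xla T n b).
Proof. by apply: gen_sum => w _ _; apply: Tw_gen. Qed.

Lemma xlaR b i : (0 < i < n)%N -> inner b i -> xla T n b * T i = q *: xla T n b.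
Proof.
move=> Hi Hb; rewrite /xla mulr_suml scaler_sumr.
pose up w : bool := (ninv w < ninv (w * sgen n i)%g)%N.
have upP w : up w -> asc w i.
  rewrite /up; case: (asc_or_desc w Hi) => // D.
  by rewrite (ninv_desc Hi D); lia.
have dnP w : ~~ up w -> desc w i.
  rewrite /up; case: (asc_or_desc w Hi) => // D.
  by rewrite (ninv_asc Hi D); lia.
have upN w : up (w * sgen n i)%g = ~~ up w.
  rewrite /up mulsgK; case: (asc_or_desc w Hi) => D.
    by rewrite (ninv_asc Hi D); lia.
  by rewrite (ninv_desc Hi D); lia.
have sI : injective (fun w : 'S_n => w * sgen n i)%g by move=> x y /mulIg.
have swap (P : pred 'S_n) (F : 'S_n -> A) : (forall w, P (w * sgen n i)%g = P w) ->
    \sum_(w | P w && up w) F (w * sgen n i)%g = \sum_(w | P w && ~~ up w) F w.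
  move=> HP; rewrite [RHS](reindex_inj sI) /=; apply: eq_bigl => w.
  by rewrite HP upN negbK.
have swap' (P : pred 'S_n) (F : 'S_n -> A) : (forall w, P (w * sgen n i)%g = P w) ->
    \sum_(w | P w && ~~ up w) F (w * sgen n i)%g = \sum_(w | P w && up w) F w.
  move=> HP; rewrite [RHS](reindex_inj sI) /=; apply: eq_bigl => w.
  by rewrite HP upN.
have HP w : rowstab b (w * sgen n i)%g = rowstab b w by apply: rowstab_mulr.
rewrite (bigID up) [RHS](bigID up) /=.
have -> : \sum_(w : 'S_n | rowstab b w && up w) Tw T w * T i =
          \sum_(w : 'S_n | rowstab b w && up w) Tw T (w * sgen n i)%g.
  by apply: eq_bigr => w /andP[_ /upP U]; rewrite (Tw_asc HT).
have -> : \sum_(w : 'S_n | rowstab b w && ~~ up w) Tw T w * T i =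
          \sum_(w : 'S_n | rowstab b w && ~~ up w)
            ((q - 1) *: Tw T w + q *: Tw T (w * sgen n i)%g).
  by apply: eq_bigr => w /andP[_ /dnP U]; rewrite (Tw_desc HT).
rewrite (swap _ (fun w => Tw T w) HP) big_split /= (swap' _ (fun w => q *: Tw T w) HP).
by rewrite addrA -!scaler_sumr scalerBl scale1r [X in X + _]addrC subrK addrC.
Qed.

Definition poinc b : K := \sum_(w : 'S_n | rowstab b w) q ^+ ninv w.

Lemma xla_absorbR b y : (forall i, (0 < i < n)%N -> inner b i -> y * T i = q *: y) ->
  y * xla T n b = poinc b *: y.
Proof.
move=> Hy; rewrite /xla /poinc mulr_sumr scaler_suml; apply: eq_bigr => w.
move: {2}(ninv w) (leqnn (ninv w)) => m; elim: m w => [|m IH] w Hm Hw;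
  have [->|/eqP w1] := eqVneq w 1%g; rewrite ?Tw1 ?ninv1 ?mulr1 ?scale1r //.
  by have [j [Hj Dj _]] := Tw_rec T w1; move: Hm; rewrite (ninv_desc Hj Dj).
have [j [Hj Dj ->]] := Tw_rec T w1; have L := ninv_desc Hj Dj.
have Hb := rowstab_desc Hj Hw Dj.
rewrite mulrA IH ?rowstab_mulr //; last by lia.
by rewrite -scalerAl Hy // scalerA L exprSr.
Qed.

End HeckeYoung.

Section Lists.
Implicit Types (s b : seq nat).

Lemma inner_between b r (s : nat) : (sumn (take r b) < s < sumn (take r.+1 b))%N -> inner b s.
Proof.
move=> H k E; have [kr|rk] := leqP k r.
  by have := sumn_take_mono b kr; lia.
by have := sumn_take_mono b rk; lia.
Qed.

Lemma unsorted_split s : ~~ sorted geq s ->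
  exists s1 (x y : nat) s2, s = s1 ++ x :: y :: s2 /\ (x < y)%N.
Proof.
elim: s => // x [|y s] IH //=; rewrite negb_and => /orP[H|H].
  by exists [::], x, y, s; split => //; rewrite ltnNge.
have [s1 [a [b [s2 [-> ab]]]]] := IH H.
by exists (x :: s1), a, b, s2.
Qed.

Lemma sorted_filter_pos s r : sorted geq s ->
  sumn (take r [seq x <- s | (0 < x)%N]) = sumn (take r s).
Proof.
elim: s r => // x s IH r Hs.
have tr : transitive geq by move=> a b c; rewrite /= /geq /=; lia.
have /allP Hx := order_path_min tr Hs.
rewrite /=; case: (posnP x) => x0; last first.
  by case: r => //= r; rewrite IH //; apply: path_sorted Hs.
rewrite x0 in Hx *; have Z y : y \in s -> y = 0%N by move/Hx; rewrite /= /geq /=; lia.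
have -> : [seq y <- s | (0 < y)%N] = [::].
  by apply/eqP; rewrite -[_ == _]negbK -has_filter; apply/hasPn => y /Z ->.
rewrite /=; case: r => //= r; rewrite add0n; symmetry.
by apply/eqP; rewrite sumnE big_seq big1 // => y /mem_take /Z.
Qed.

Lemma sumn_take_pair s1 (x y x' y' : nat) s2 r : (x + y = x' + y')%N ->
  sumn (take r (s1 ++ x :: y :: s2)) =
  if r == (size s1).+1 then (sumn s1 + x)%N else sumn (take r (s1 ++ x' :: y' :: s2)).
Proof.
move=> E0; rewrite !take_cat; case: ltnP => H; first by have -> : (r == (size s1).+1) = false by lia.
rewrite !sumn_cat; case: eqP => [->|N]; first by rewrite subSn // subnn /= ?take0 /=; lia.
have [->|E] : r = size s1 \/ (r - size s1 = (r - size s1).-2.+2)%N by lia.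
  by rewrite subnn.
by rewrite E /=; lia.
Qed.

Lemma sumn_take_swap s1 (a b : nat) s2 r :
  sumn (take r (s1 ++ a :: b :: s2)) =
  if r == (size s1).+1 then (sumn s1 + a)%N else sumn (take r (s1 ++ b :: a :: s2)).
Proof. exact/sumn_take_pair/addnC. Qed.

End Lists.

Section HeckeNbar.
Variables (K : fieldType) (q : K) (A : algType K) (T : nat -> A) (n : nat).
Hypothesis HT : hecke_rels q T n.
Implicit Types (la mu b : seq nat).

Local Notation N := (in_Nbar T n).

Lemma Nbar0 la : N la 0.
Proof.
exists 0%N, (fun=> 0), (fun=> [::]), (fun=> 1%g), (fun=> 1%g).
by split=> [[]//|]; rewrite big_ord0.
Qed.

Lemma NbarZ la c h : N la h -> N la (c *: h).
Proof.
case=> m [d [mu [u [v [H ->]]]]]; exists m, (fun i => c * d i), mu, u, v; split=> //.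
by rewrite scaler_sumr; apply: eq_bigr => i _; rewrite scalerA.
Qed.

Lemma NbarD la h1 h2 : N la h1 -> N la h2 -> N la (h1 + h2).
Proof.
case=> m1 [d1 [mu1 [u1 [v1 [H1 ->]]]]] [m2 [d2 [mu2 [u2 [v2 [H2 ->]]]]]].
pose pick C (f1 : 'I_m1 -> C) (f2 : 'I_m2 -> C) (i : 'I_(m1 + m2)) :=
  match split i with inl j => f1 j | inr j => f2 j end.
exists (m1 + m2)%N, (pick _ d1 d2), (pick _ mu1 mu2), (pick _ u1 u2), (pick _ v1 v2).
split=> [i|]; first by rewrite /pick; case: (split i).
rewrite big_split_ord /=; congr (_ + _); apply: eq_bigr => i _; rewrite /pick.
  by rewrite (unsplitK (inl i)).
by rewrite (unsplitK (inr i)).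
Qed.

Lemma NbarN la h : N la h -> N la (- h).
Proof. by rewrite -scaleN1r; apply: NbarZ. Qed.

Lemma Nbar_sum la (I : Type) (r : seq I) (P : pred I) F :
  (forall i, P i -> N la (F i)) -> N la (\sum_(i <- r | P i) F i).
Proof. by move=> H; apply: big_ind => //; [apply: Nbar0|apply: NbarD]. Qed.

Lemma Nbar_xst la mu (u v : 'S_n) : part_of n mu -> sdominates mu la -> N la (xst T mu u v).
Proof.
move=> H1 H2; exists 1%N, (fun=> 1), (fun=> mu), (fun=> u), (fun=> v).
by split=> //; rewrite big_ord_recl big_ord0 addr0 scale1r.
Qed.

Lemma Nbar_ind la (Q : A -> Prop) : Q 0 -> (forall x y, Q x -> Q y -> Q (x + y)) ->
  (forall c x, Q x -> Q (c *: x)) ->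
  (forall mu (u v : 'S_n), part_of n mu -> sdominates mu la -> Q (xst T mu u v)) ->
  forall h, N la h -> Q h.
Proof.
move=> Q0 QD QZ Qx h [m [d [mu [u [v [H ->]]]]]].
apply: big_ind => // i _; apply: QZ.
by have [H1 H2] := H i; apply: Qx.
Qed.

Lemma Nbar_mulr la h g : N la h -> gen T n g -> N la (h * g).
Proof.
move=> Hh Hg; elim: Hg h Hh => [c|i Hi|y z _ Hy _ Hz|y z _ Hy _ Hz] h Hh.
- by rewrite mulr_algr; apply: NbarZ.
- move: h Hh; apply: Nbar_ind => [|x y|c x|mu u v H1 H2].
  + by rewrite mul0r; apply: Nbar0.
  + by rewrite mulrDl; apply: NbarD.
  + by rewrite -scalerAl; apply: NbarZ.
  case: (asc_or_desc v Hi) => Hv.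
    have -> : xst T mu u v * T i = xst T mu u (v * sgen n i)%g.
      by rewrite /xst -!mulrA (Tw_asc HT).
    exact: Nbar_xst.
  have -> : xst T mu u v * T i = (q - 1) *: xst T mu u v + q *: xst T mu u (v * sgen n i)%g.
    by rewrite /xst -!mulrA (Tw_desc HT) // !mulrDr -!scalerAr.
  by apply: NbarD; apply: NbarZ; apply: Nbar_xst.
- by rewrite mulrDr; apply: NbarD; [apply: Hy|apply: Hz].
- by rewrite mulrA; apply: Hz; apply: Hy.
Qed.

Lemma Nbar_mull la h g : N la h -> gen T n g -> N la (g * h).
Proof.
move=> Hh Hg; elim: Hg h Hh => [c|i Hi|y z _ Hy _ Hz|y z _ Hy _ Hz] h Hh.
- by rewrite mulr_algl; apply: NbarZ.
- move: h Hh; apply: Nbar_ind => [|x y|c x|mu u v H1 H2].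
  + by rewrite mulr0; apply: Nbar0.
  + by rewrite mulrDr; apply: NbarD.
  + by rewrite -scalerAr; apply: NbarZ.
  have sV : (sgen n i)^-1%g = sgen n i by apply/eqP; rewrite eq_invg_mul sgenK.
  have E w : (u * sgen n i)^-1%g = w -> w = (sgen n i * u^-1)%g by move<-; rewrite invMg sV.
  case: (lasc_or_ldesc u^-1%g Hi) => Hv.
    have -> : T i * xst T mu u v = xst T mu (u * sgen n i)%g v.
      by rewrite /xst (E _ erefl) (Tw_lasc HT) // !mulrA.
    exact: Nbar_xst.
  have -> : T i * xst T mu u v = (q - 1) *: xst T mu u v + q *: xst T mu (u * sgen n i)%g v.
    by rewrite /xst (E _ erefl) !mulrA (Tw_ldesc HT) // !mulrDl -!scalerAl.
  by apply: NbarD; apply: NbarZ; apply: Nbar_xst.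
- by rewrite mulrDl; apply: NbarD; [apply: Hy|apply: Hz].
- by rewrite -mulrA; apply: Hy; apply: Hz.
Qed.

Lemma Nbar_ideal la mu g g' : part_of n mu -> sdominates mu la -> gen T n g -> gen T n g' ->
  N la (g * xla T n mu * g').
Proof.
move=> H1 H2 Hg Hg'; apply: Nbar_mulr => //; apply: Nbar_mull => //.
by have := Nbar_xst 1%g 1%g H1 H2; rewrite /xst invg1 Tw1 mul1r mulr1.
Qed.

Hypothesis q0 : q != 0.
Hypothesis poinc0 : forall b, poinc q n b != 0.

Lemma xla_factor b y : (forall i, (0 < i < n)%N -> inner b i -> y * T i = q *: y) ->
  y = (poinc q n b)^-1 *: y * xla T n b.
Proof.
by move=> Hy; rewrite -scalerAl (xla_absorbR Hy) scalerA mulVf // scale1r.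
Qed.

(* [Tw T w] for the permutation [w] exchanging the two blocks of strands
   intertwines the two Young subalgebras. *)
Lemma xla_swap s1 (a b : nat) s2 : (sumn (s1 ++ [:: a, b & s2]) = n)%N ->
  exists g g', [/\ gen T n g, gen T n g' &
    xla T n (s1 ++ [:: a, b & s2]) = g * xla T n (s1 ++ [:: b, a & s2]) * g'].
Proof.
set be := s1 ++ _; set be' := s1 ++ [:: b, a & s2] => Hn.
set c := sumn s1; have cn : (c + a + b <= n)%N by rewrite -Hn /be sumn_cat /= -/c; lia.
pose f x := (if x < c then x else if x < c + a then x + b
             else if x < c + a + b then x - a else x)%N.
have fn (x : 'I_n) : (f x < n)%N by have := ltn_ord x; rewrite /f; split_ifs; lia.
have fI : injective (fun x => Ordinal (fn x)).
  by move=> x y /(congr1 val) /= E; apply: val_inj; move: E; rewrite /f /=; split_ifs; lia.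
pose w := perm fI; have wE x : w x = f x :> nat by rewrite permE.
have [V GV EV] := Tw_inv HT w q0.
have sA := sumn_take_swap s1 a b s2; have sB := sumn_take_swap s1 b a s2.
have Hb : sumn (take (size s1) be') = c by rewrite /be' take_size_cat.
have Hb1 : sumn (take (size s1).+1 be') = (c + b)%N by rewrite sB eqxx.
have Hb2 : sumn (take (size s1).+2 be') = (c + a + b)%N.
  by rewrite /be' -[(size s1).+2]addn2 takeD take_size_cat // drop_size_cat // sumn_cat /= ?take0 /=; lia.
have Ha : sumn (take (size s1) be) = c by rewrite /be take_size_cat.
have Ha1 : sumn (take (size s1).+1 be) = (c + a)%N by rewrite sA eqxx.
have Ha2 : sumn (take (size s1).+2 be) = (c + a + b)%N.
  by rewrite /be -[(size s1).+2]addn2 takeD take_size_cat // drop_size_cat // sumn_cat /= ?take0 /=; lia.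
have eig i : (0 < i < n)%N -> inner be' i ->
    xla T n be * Tw T w * T i = q *: (xla T n be * Tw T w).
  move=> Hi Hin; have B0 := Hin (size s1); have B1 := Hin (size s1).+1; have B2 := Hin (size s1).+2.
  rewrite Hb in B0; rewrite Hb1 in B1; rewrite Hb2 in B2.
  have out : i <> (c + a)%N -> inner be i.
    by move=> Ni r; rewrite sA; case: eqP => _; [apply: nesym|apply: Hin].
  pose s := (if i < c then i else if i < c + b then i + a
             else if i < c + a + b then i - b else i)%N.
  have Hs : inner be s.
    have [lt|ge] := ltnP i c; first by rewrite /s lt; apply: out; lia.
    have [lt|ge1] := ltnP i (c + b).
      apply: (@inner_between _ (size s1).+1); rewrite Ha1 Ha2 /s; split_ifs; lia.
    have [lt|ge2] := ltnP i (c + a + b).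
      apply: (@inner_between _ (size s1)); rewrite Ha1 Ha /s; split_ifs; lia.
    have -> : s = i by rewrite /s; split_ifs; lia.
    by apply: out; lia.
  have s0 : (0 < s < n)%N by rewrite /s; split_ifs; lia.
  rewrite -mulrA -(Tw_parallel HT (s := s) (s' := i)) //.
  - by rewrite mulrA (xlaR HT) // scalerAl.
  - by move=> x Ex; rewrite wE /f /s in Ex *; move: Ex; split_ifs; lia.
  - by move=> x Ex; rewrite wE /f /s in Ex *; move: Ex; split_ifs; lia.
exists ((poinc q n be')^-1 *: (xla T n be * Tw T w)), V; split=> //.
  by apply: gen_scale; apply: gen_mul; [apply: xla_gen|apply: Tw_gen].
by rewrite -xla_factor // -mulrA EV mulr1.
Qed.

Lemma xla_sort b : (sumn b = n)%N -> exists mu g g',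
  [/\ part_of n mu, dominates mu b, gen T n g, gen T n g' & xla T n b = g * xla T n mu * g'].
Proof.
pose wt b := (\sum_(k < (size b).+1) sumn (take k b))%N.
have wtB s : (sumn s = n)%N -> (wt s <= (size s).+1 * n)%N.
  move=> Hs; rewrite /wt; apply: (@leq_trans (\sum_(k < (size s).+1) n)%N).
    apply: leq_sum => k _.
    by rewrite -[X in (_ <= X)%N]Hs -[X in (_ <= sumn X)%N](cat_take_drop k) sumn_cat leq_addr.
  by rewrite sum_nat_const card_ord.
have [m] := ubnP ((size b).+1 * n - wt b)%N.
elim: m b => // m IH b Hm Hb; case: (boolP (sorted geq b)) => Hs.
  set mu := [seq x <- b | (0 < x)%N]; have dE k : sumn (take k mu) = sumn (take k b).
    exact: sorted_filter_pos.
  exists mu, ((poinc q n mu)^-1 *: xla T n b), 1; split.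
  - rewrite /part_of /is_part filter_all sorted_filter //=; last first.
      by move=> x y z; rewrite /= /geq /=; lia.
    have := dE (size b); rewrite take_size Hb take_oversize ?size_filter ?count_size // => ->.
    exact: eqxx.
  - by move=> k; rewrite dE.
  - by apply: gen_scale; apply: xla_gen.
  - exact: gen_one.
  - rewrite mulr1; apply: xla_factor => i Hi Hin; apply: (xlaR HT) => // r.
    by rewrite -dE.
have [s1 [x [y [s2 [Eb xy]]]]] := unsorted_split Hs.
have [g [g' [Hg Hg' E]]] : exists g g', [/\ gen T n g, gen T n g' &
  xla T n b = g * xla T n (s1 ++ [:: y, x & s2]) * g'] by rewrite Eb; apply: xla_swap; rewrite -Eb.
set b' := s1 ++ [:: y, x & s2] in E.
have Hb' : sumn b' = n by rewrite -Hb Eb /b' !sumn_cat /=; lia.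
have Sb : size b' = size b by rewrite Eb /b' !size_cat.
have dom k : (sumn (take k b) <= sumn (take k b'))%N.
  rewrite Eb sumn_take_swap; case: eqP => // ->.
  by rewrite sumn_take_swap eqxx; lia.
have lt : (wt b < wt b')%N.
  rewrite /wt Sb; have H : ((size s1).+1 < (size b).+1)%N by rewrite Eb size_cat /=; lia.
  rewrite (bigD1 (Ordinal H)) // [X in (_ < X)%N](bigD1 (Ordinal H)) //= -addSn.
  apply: leq_add; last by apply: leq_sum => k _; apply: dom.
  have -> : sumn (take (size s1).+1 b) = (sumn s1 + x)%N by rewrite Eb sumn_take_swap eqxx.
  have -> : sumn (take (size s1).+1 b') = (sumn s1 + y)%N by rewrite /b' sumn_take_swap eqxx.
  lia.
have [|mu [h [h' [H1 H2 H3 H4 H5]]]] := IH b' _ Hb'.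
  by have := wtB _ Hb'; rewrite Sb; move: lt Hm; lia.
exists mu, (g * h), (h' * g'); split=> //; try exact: gen_mul.
  by move=> k; apply: leq_trans (dom k) (H2 k).
by rewrite E H5 !mulrA.
Qed.

End HeckeNbar.

(** * Jucys-Murphy elements *)

Section Products.
Variables (K : fieldType) (A : algType K).
Implicit Types (T : nat -> A).

Definition Tji T (i j : nat) : A := \prod_(k <- rev (index_iota i j)) T k.

Lemma Tij_id T i : Tij T i i = 1.
Proof. by rewrite /Tij big_geq. Qed.

Lemma Tji_id T i : Tji T i i = 1.
Proof. by rewrite /Tji /index_iota subnn big_nil. Qed.

Lemma Tij_recr T i j : (i <= j)%N -> Tij T i j.+1 = Tij T i j * T j.
Proof. by move=> ij; rewrite /Tij big_nat_recr. Qed.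

Lemma Tij_recl T i j : (i < j)%N -> Tij T i j = T i * Tij T i.+1 j.
Proof. by move=> ij; rewrite /Tij big_ltn. Qed.

Lemma Tji_recl T i j : (i <= j)%N -> Tji T i j.+1 = T j * Tji T i j.
Proof.
move=> ij; rewrite /Tji /index_iota subSn // -addn1 iotaD /= rev_cat /= big_cons.
by rewrite subnKC.
Qed.

Lemma Tji_recr T i j : (i < j)%N -> Tji T i j = Tji T i.+1 j * T i.
Proof.
move=> ij; rewrite /Tji /index_iota; have -> : (j - i = (j - i.+1).+1)%N by lia.
by rewrite /= rev_cons big_rcons.
Qed.

Lemma Tij_cat T i j k : (i <= j <= k)%N -> Tij T i j * Tij T j k = Tij T i k.
Proof. by move=> /andP[ij jk]; rewrite /Tij (big_cat_nat ij jk). Qed.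

Lemma Tij_gen T m i j : (0 < i)%N -> (j <= m)%N -> gen T m (Tij T i j).
Proof.
move=> i0 jm; apply: gen_prod => k; rewrite mem_index_iota => Hk _.
by apply: gen_T; lia.
Qed.

Lemma Tji_gen T m i j : (0 < i)%N -> (j <= m)%N -> gen T m (Tji T i j).
Proof.
move=> i0 jm; apply: gen_prod => k; rewrite mem_rev mem_index_iota => Hk _.
by apply: gen_T; lia.
Qed.

Lemma prod_comm (I : eqType) (r : seq I) (F : I -> A) z :
  (forall i, i \in r -> z * F i = F i * z) -> z * (\prod_(i <- r) F i) = (\prod_(i <- r) F i) * z.
Proof.
move=> H; rewrite big_seq; apply: (big_ind (fun x => z * x = x * z)) => [|x y Hx Hy|//].
  by rewrite mulr1 mul1r.
by rewrite mulrA Hx -mulrA Hy mulrA.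
Qed.

End Products.

Lemma hecke_relsS (K : fieldType) (q : K) (A : algType K) (T : nat -> A) m :
  hecke_rels q T m.+1 -> hecke_rels q T m.
Proof. by case=> H1 H2 H3; split=> *; [apply: H1|apply: H2|apply: H3]; lia. Qed.

Section HeckeTij.
Variables (K : fieldType) (q : K) (A : algType K) (T : nat -> A) (n : nat).
Hypothesis HT : hecke_rels q T n.

Lemma Tij_far s i j : (0 < s < n)%N -> (0 < i)%N -> (j <= n)%N -> (s.+1 < i)%N || (j < s)%N ->
  T s * Tij T i j = Tij T i j * T s.
Proof.
move=> Hs i0 jn H; apply: prod_comm => k; rewrite mem_index_iota => Hk.
by apply: (T_far HT); lia.
Qed.

Lemma Tji_far s i j : (0 < s < n)%N -> (0 < i)%N -> (j <= n)%N -> (s.+1 < i)%N || (j < s)%N ->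
  T s * Tji T i j = Tji T i j * T s.
Proof.
move=> Hs i0 jn H; apply: prod_comm => k; rewrite mem_rev mem_index_iota => Hk.
by apply: (T_far HT); lia.
Qed.

Lemma Tij_shift s i j : (0 < i)%N -> (j <= n)%N -> (i <= s)%N -> (s.+1 < j)%N ->
  Tij T i j * T s = T s.+1 * Tij T i j.
Proof.
move=> i0 jn Hi Hj.
rewrite -(@Tij_cat _ _ T i s j); last by lia.
rewrite (@Tij_recl _ _ T s j); last by lia.
rewrite (@Tij_recl _ _ T s.+1 j) //.
rewrite -!mulrA -Tij_far; try lia.
rewrite (mulrA (T s.+1)) (mulrA (T s)) (mulrA (T s)) (T_braid HT); try lia.
rewrite !mulrA; congr (_ * _); congr (_ * _); congr (_ * _).
by rewrite Tij_far //; lia.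
Qed.

Lemma hecke_rels_rev : hecke_rels q (fun k => T (n - k)%N) n.
Proof.
split=> [i j Hi Hj ij|i i0 Hi|i Hi].
- by apply: (T_far HT); lia.
- have -> : (n - i)%N = (n - i.+1).+1 by lia.
  by rewrite (T_braid HT) //; lia.
- by case: HT => _ _; apply; lia.
Qed.

Lemma Tji_rev i j : (i <= j)%N -> (j <= n)%N ->
  Tji T i j = Tij (fun k => T (n - k)%N) (n.+1 - j) (n.+1 - i).
Proof.
elim: j => [|j IH] ij jn; first by rewrite (_ : i = 0%N) ?Tji_id ?Tij_id //; lia.
have [->|lt] := eqVneq i j.+1; first by rewrite Tji_id Tij_id.
rewrite Tji_recl ?IH; try lia.
rewrite [RHS]Tij_recl; last by lia.
by congr (T _ * Tij _ _ _); lia.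
Qed.

End HeckeTij.

Section HeckeTij2.
Variables (K : fieldType) (q : K) (A : algType K) (T : nat -> A) (n : nat).
Hypothesis HT : hecke_rels q T n.

Lemma Tji_shift s i j : (0 < i)%N -> (j <= n)%N -> (i < s)%N -> (s < j)%N ->
  Tji T i j * T s = T s.-1 * Tji T i j.
Proof.
move=> i0 jn Hi Hj; rewrite (@Tji_rev _ _ T n); try lia.
have := @Tij_shift _ _ _ _ _ (hecke_rels_rev HT) (n - s)%N (n.+1 - j) (n.+1 - i).
have -> : (n - (n - s) = s)%N by lia.
have -> : (n - (n - s).+1 = s.-1)%N by lia.
by apply; lia.
Qed.

(* The [Tij T a e] are the coset representatives of the symmetric group on
   [a+1 .. b] in the one on [a .. b]. *)
Lemma coset_sum_up a b y : (0 < a)%N -> (b <= n)%N ->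
  (forall s, (a < s < b)%N -> y * T s = q *: y) ->
  forall s, (a <= s < b)%N ->
  y * (\sum_(a <= e < b.+1) Tij T a e) * T s = q *: (y * \sum_(a <= e < b.+1) Tij T a e).
Proof.
move=> a0 bn Hy s Hs.
have E1 e : (a <= e < b.+1)%N -> e != s -> e != s.+1 -> y * Tij T a e * T s = q *: (y * Tij T a e).
  move=> He N1 N2; have [lt|ge] := ltnP e s.
    by rewrite -mulrA -(Tij_far HT) // ?mulrA ?Hy ?scalerAl //; lia.
  by rewrite -mulrA (Tij_shift HT) ?mulrA ?Hy ?scalerAl //; lia.
have E2 : y * Tij T a s * T s = y * Tij T a s.+1 by rewrite Tij_recr ?mulrA //; lia.
have E3 : y * Tij T a s.+1 * T s = (q - 1) *: (y * Tij T a s.+1) + q *: (y * Tij T a s).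
  rewrite Tij_recr; last by lia.
  rewrite -!mulrA (T_sqr HT); last by lia.
  by rewrite !mulrDr mulr_algr -!scalerAr.
rewrite !mulr_sumr mulr_suml scaler_sumr.
rewrite (@big_cat_nat _ _ _ s) /=; [|lia|lia].
rewrite [RHS](@big_cat_nat _ _ _ s) /=; [|lia|lia].
congr (_ + _).
  by apply: eq_big_nat => e He; apply: E1; lia.
rewrite (@big_cat_nat _ _ _ s.+2) /=; [|lia|lia].
rewrite [RHS](@big_cat_nat _ _ _ s.+2) /=; [|lia|lia].
congr (_ + _); last by apply: eq_big_nat => e He; apply: E1; lia.
rewrite !big_nat_recr //= !big_geq // !add0r E2 E3.
by rewrite addrA scalerBl scale1r [X in X + _]addrC subrK addrC.
Qed.

End HeckeTij2.

Section HeckeJM.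
Variables (K : fieldType) (q : K) (A : algType K) (T : nat -> A) (n : nat).
Hypothesis HT : hecke_rels q T n.

Lemma coset_sum_down a b y : (a <= b)%N -> (b < n)%N ->
  (forall s, (a < s < b)%N -> y * T s = q *: y) ->
  forall s, (a < s <= b)%N ->
  y * (\sum_(a.+1 <= e < b.+2) Tji T e b.+1) * T s = q *: (y * \sum_(a.+1 <= e < b.+2) Tji T e b.+1).
Proof.
move=> ab bn Hy s Hs.
have -> : \sum_(a.+1 <= e < b.+2) Tji T e b.+1 =
  \sum_(n - b <= e < (n - a).+1) Tij (fun k => T (n - k)%N) (n - b) e.
  rewrite [RHS]big_nat_rev [RHS](big_addn 0) [LHS](big_addn 0) !big_mkord.
  have -> : ((n - a).+1 - (n - b) = b.+2 - a.+1)%N by lia.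
  apply: eq_bigr => i _; have Hi := ltn_ord i.
  rewrite (@Tji_rev _ _ T n); try lia.
  by rewrite subSS; congr (Tij _ _ _); lia.
have := @coset_sum_up _ _ _ _ _ (hecke_rels_rev HT) (n - b) (n - a) y.
move=> /(_ _ _ _ (n - s)%N); have -> : (n - (n - s) = s)%N by lia.
apply; try lia.
by move=> k Hk; apply: Hy; lia.
Qed.

Lemma Tij_eigen y i j : (forall s, (i <= s < j)%N -> y * T s = q *: y) ->
  (i <= j)%N -> y * Tij T i j = q ^+ (j - i) *: y.
Proof.
move=> Hy; elim: j Hy => [|j IH] Hy ij.
  by rewrite (_ : i = 0%N) ?Tij_id ?subnn ?mulr1 ?expr0 ?scale1r //; lia.
have [->|N] := eqVneq i j.+1; first by rewrite Tij_id subnn mulr1 expr0 scale1r.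
rewrite Tij_recr ?mulrA ?IH; try lia; last by move=> s Hs; apply: Hy; lia.
rewrite -scalerAl Hy; last by lia.
by rewrite scalerA -exprSr -subSn //; lia.
Qed.

Lemma Tji_Tij_slide k m b : (0 < k)%N -> (b < n)%N -> (k <= m <= b)%N ->
  Tji T k.+1 m.+1 * Tij T k b.+1 = Tij T k b.+1 * Tji T k m.
Proof.
move=> k0 bn; elim: m => [|m IH] Hm; first by lia.
have [E|N] := eqVneq k m.+1; first by rewrite E !Tji_id mulr1 mul1r.
rewrite Tji_recl; last by lia.
rewrite [Tji T k m.+1]Tji_recl; last by lia.
rewrite -mulrA IH; last by lia.
by rewrite !mulrA (Tij_shift HT) //; lia.
Qed.

Lemma palindrome_sum y p b k : (b < n)%N -> (p < k <= b.+1)%N ->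
  (forall s, (p < s < b)%N -> y * T s = q *: y) ->
  y * Tji T k b.+1 * Tij T k b.+1 =
  q ^+ (b.+1 - k) *: y + ((q - 1) * q ^+ (b - k)) *: \sum_(k <= r < b.+1) y * Tji T r b.+1.
Proof.
move=> bn Hk Hy; have [m Em] : exists m, (k + m = b.+1)%N by exists (b.+1 - k)%N; lia.
elim: m k Em Hk => [|m IH] k Em Hk.
  have -> : k = b.+1 by lia.
  by rewrite Tji_id Tij_id subnn big_geq // scaler0 addr0 expr0 scale1r !mulr1.
have Hpal : Tji T k.+1 b.+1 * Tij T k b.+1 = Tij T k b * Tji T k b.+1.
  rewrite Tji_Tij_slide; try lia.
  by rewrite Tij_recr ?Tji_recl -?mulrA //; lia.
have Hkb : y * Tij T k b = q ^+ (b - k) *: y.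
  by apply: Tij_eigen; [move=> s Hs; apply: Hy|]; lia.
have -> : y * Tji T k b.+1 * Tij T k b.+1 =
   (q - 1) *: (y * Tji T k.+1 b.+1 * Tij T k b.+1) + q *: (y * Tji T k.+1 b.+1 * Tij T k.+1 b.+1).
  rewrite (@Tji_recr _ _ T k); last by lia.
  rewrite (@Tij_recl _ _ T k); last by lia.
  rewrite -!mulrA (mulrA (T k) (T k)) (T_sqr HT); last by lia.
  rewrite mulrDl !mulrDr mulr_algl -!scalerAr -!scalerAl.
  by rewrite -!scalerAr.
rewrite IH; try lia.
rewrite -mulrA Hpal mulrA Hkb -scalerAl scalerDr !scalerA [in RHS]big_ltn; last by lia.
rewrite [in RHS]scalerDr addrCA; congr (_ + (_ + _)).
  by rewrite -exprS; congr (_ ^+ _ *: _); lia.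
rewrite mulrCA; have [E|N] := eqVneq k b.
  by rewrite E !big_geq ?scaler0.
by rewrite -exprS; congr ((_ * _ ^+ _) *: _); lia.
Qed.

(* [JM p] is [1 + (q - 1) L_{p+1}]: it acts by [q^content] where [L_{p+1}]
   acts by the residue. *)
Fixpoint JM_def (p : nat) : A :=
  if p is p'.+1 then q^-1 *: (T p * JM_def p' * T p) else 1.
Fact JM_key : unit. Proof. exact: tt. Qed.
Definition JM := locked_with JM_key JM_def.

Lemma JM0 : JM 0 = 1. Proof. by rewrite /JM unlock. Qed.

Lemma JMS p : JM p.+1 = q^-1 *: (T p.+1 * JM p * T p.+1).
Proof. by rewrite /JM unlock. Qed.

Lemma JM_gen p : gen T p.+1 (JM p).
Proof.
elim: p => [|p IH]; rewrite ?JM0 ?JMS; first exact: gen_one.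
apply: gen_scale; apply: gen_mul; first apply: gen_mul; try by apply: gen_T; lia.
by apply: gen_le IH.
Qed.

Lemma JM_comm s p : (0 < s < n)%N -> (p < n)%N -> s != p -> s != p.+1 -> T s * JM p = JM p * T s.
Proof.
have far r p' : (0 < r < n)%N -> (p'.+1 < r)%N -> T r * JM p' = JM p' * T r.
  move=> Hr H; apply: (gen_comm (m := p'.+1)); last exact: JM_gen.
  by move=> i Hi; apply: (T_far HT); lia.
move=> Hs Hp N1 N2; have [lt|ge] := ltnP p s; first by apply: far => //; lia.
elim: p Hp N1 N2 ge => [|p IH] Hp N1 N2 ge; first by rewrite JM0 mulr1 mul1r.
rewrite JMS.
rewrite -scalerAr -scalerAl; congr (_ *: _).
have [E|N] := eqVneq s p; last first.
  rewrite !mulrA (T_far HT) //; try lia.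
  rewrite -(mulrA _ (T s)) IH //; try lia.
  by rewrite -!mulrA (T_far HT) //; lia.
case: p E IH Hp {N1 N2 ge} => [|p] E IH Hp; first by lia.
rewrite E JMS -!scalerAr -!scalerAl -!scalerAr; congr (_ *: _).
rewrite !mulrA (T_braid HT) //.
rewrite -(mulrA _ _ (JM p)) far; try lia.
rewrite -!mulrA; congr (_ * (_ * (_ * _))).
by rewrite [RHS]mulrA (T_braid HT) ?mulrA.
Qed.

Lemma JM_JM a b : (a < n)%N -> (b < n)%N -> JM a * JM b = JM b * JM a.
Proof.
wlog ab : a b / (a <= b)%N.
  by move=> W Ha Hb; have [|/ltnW] := leqP a b => H; [apply: W|symmetry; apply: W].
move=> Ha Hb; have [->//|N] := eqVneq a b.
symmetry; apply: (gen_comm (m := a.+1)); last exact: JM_gen.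
by move=> i Hi; rewrite JM_comm //; lia.
Qed.

Lemma JM_iter p b : (p <= b)%N ->
  JM b = q^-1 ^+ (b - p) *: (Tji T p.+1 b.+1 * JM p * Tij T p.+1 b.+1).
Proof.
elim: b => [|b IH] pb.
  by rewrite (_ : p = 0%N) ?subnn ?Tji_id ?Tij_id ?mulr1 ?mul1r ?expr0 ?scale1r //; lia.
have [->|N] := eqVneq p b.+1.
  by rewrite subnn expr0 scale1r Tji_id Tij_id mul1r mulr1.
rewrite JMS IH; last by lia.
rewrite -!scalerAr -!scalerAl scalerA -exprS -subSn; last by lia.
rewrite (@Tji_recl _ _ T p.+1 b.+1); last by lia.
by rewrite (@Tij_recr _ _ T p.+1 b.+1) ?mulrA //; lia.
Qed.

Hypothesis q0 : q != 0.

Lemma T_JM p : (p.+1 < n)%N -> T p.+1 * JM p.+1 = JM p * T p.+1 + (q - 1) *: JM p.+1.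
Proof.
move=> Hp; rewrite JMS -scalerAr !mulrA (T_sqr HT) // !mulrDl mulr_algl scalerDr.
by rewrite -!scalerAl !scalerA mulVf // scale1r addrC mulrC.
Qed.

Lemma JM_T p : (p.+1 < n)%N -> JM p.+1 * T p.+1 = T p.+1 * JM p + (q - 1) *: JM p.+1.
Proof.
move=> Hp; rewrite JMS -scalerAl -!mulrA (T_sqr HT) // !mulrDr mulr_algr scalerDr.
by rewrite -!scalerAr !scalerA mulVf // scale1r addrC mulrC.
Qed.

Definition zJM m : A := \sum_(p < m) JM p.

Lemma zJM_comm m s : (m <= n)%N -> (0 < s < m)%N -> zJM m * T s = T s * zJM m.
Proof.
move=> mn Hs; rewrite /zJM -(big_mkord xpredT (fun p => JM p)).
rewrite mulr_suml mulr_sumr (@big_cat_nat _ _ _ s.-1) /=; [|lia|lia].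
rewrite [RHS](@big_cat_nat _ _ _ s.-1) /=; [|lia|lia].
congr (_ + _); first by apply: eq_big_nat => e He; rewrite JM_comm //; lia.
rewrite (@big_cat_nat _ _ _ s.+1) /=; [|lia|lia].
rewrite [RHS](@big_cat_nat _ _ _ s.+1) /=; [|lia|lia].
congr (_ + _); last by apply: eq_big_nat => e He; rewrite JM_comm //; lia.
case: s Hs => // s Hs; rewrite /= !big_nat_recr //= !big_geq // !add0r.
rewrite JM_T ?T_JM; try lia.
by rewrite addrCA addrA.
Qed.

Lemma zJM_gen m g : (m <= n)%N -> gen T m g -> zJM m * g = g * zJM m.
Proof. by move=> mn; apply: gen_comm => i Hi; apply: zJM_comm. Qed.

End HeckeJM.

(** * Action on the initial tableau and Garnir relations *)

Section Compositions.
Implicit Types (s b la : seq nat).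

Lemma sumn_takeS s r : sumn (take r.+1 s) = (sumn (take r s) + nth 0%N s r)%N.
Proof.
have [lt|ge] := ltnP r (size s); first by rewrite (take_nth 0%N) // sumn_rcons.
by rewrite !take_oversize ?nth_default ?addn0 // ltnW.
Qed.

Lemma sumn_take_le s r : (sumn (take r s) <= sumn s)%N.
Proof. by rewrite -[X in (_ <= sumn X)%N](cat_take_drop r) sumn_cat leq_addr. Qed.

Lemma part_nth la r r' : is_part la -> (r <= r')%N -> (nth 0%N la r' <= nth 0%N la r)%N.
Proof.
move=> /andP[H _] rr; have [lt|ge] := ltnP r' (size la); last by rewrite nth_default.
have tr : transitive geq by move=> a b c; rewrite /= /geq /=; lia.
by apply: (sorted_leq_nth tr) => //; [move=> x /=; rewrite /geq /=|rewrite inE; lia].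
Qed.

Lemma part_pos la r : is_part la -> (0 < nth 0%N la r)%N = (r < size la)%N.
Proof.
move=> /andP[_ /allP H]; have [lt|ge] := ltnP r (size la); last by rewrite nth_default.
by rewrite H ?mem_nth.
Qed.

Definition move_box la j i : seq nat :=
  mkseq (fun r => (nth 0 la r + (r == j) - (r == i))%N) (size la).

Lemma sumn_take_move la j i r : (j < i)%N -> (i < size la)%N -> (0 < nth 0%N la i)%N ->
  sumn (take r (move_box la j i)) = (sumn (take r la) + (j < r <= i))%N.
Proof.
move=> ji il li; elim: r => [|r IH]; first by rewrite !take0 /=; lia.
rewrite !sumn_takeS IH; have [lt|ge] := ltnP r (size la).
  rewrite nth_mkseq //; case: (r =P i) => [->|]; lia.
by rewrite !nth_default ?size_mkseq //; lia.
Qed.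

End Compositions.

Section HeckeEqN.
Variables (K : fieldType) (q : K) (A : algType K) (T : nat -> A) (n : nat).
Hypothesis HT : hecke_rels q T n.
Hypothesis q0 : q != 0.
Hypothesis poinc0 : forall b, poinc q n b != 0.
Implicit Types (la b : seq nat).

Local Notation N := (in_Nbar T n).

Definition eqN la u v := N la (u - v).

Lemma eqN_refl la u : eqN la u u.
Proof. by rewrite /eqN subrr; apply: Nbar0. Qed.

Lemma eqN_sym la u v : eqN la u v -> eqN la v u.
Proof. by rewrite /eqN => /NbarN; rewrite opprB. Qed.

Lemma eqN_trans la u v w : eqN la u v -> eqN la v w -> eqN la u w.
Proof. by rewrite /eqN => H1 H2; rewrite -(subrKA v); apply: NbarD. Qed.

Lemma eqN_add la u v u' v' : eqN la u v -> eqN la u' v' -> eqN la (u + u') (v + v').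
Proof. by rewrite /eqN => H1 H2; rewrite opprD addrACA; apply: NbarD. Qed.

Lemma eqN_scale la c u v : eqN la u v -> eqN la (c *: u) (c *: v).
Proof. by rewrite /eqN => H; rewrite -scalerBr; apply: NbarZ. Qed.

Lemma eqN_opp la u v : eqN la u v -> eqN la (- u) (- v).
Proof. by rewrite -!scaleN1r; apply: eqN_scale. Qed.

Lemma eqN_sub la u v u' v' : eqN la u v -> eqN la u' v' -> eqN la (u - u') (v - v').
Proof. by move=> H1 H2; apply: eqN_add => //; apply: eqN_opp. Qed.

Lemma eqN_mulr la u v g : eqN la u v -> gen T n g -> eqN la (u * g) (v * g).
Proof. by rewrite /eqN => H Hg; rewrite -mulrBl; apply: (Nbar_mulr HT). Qed.

Lemma eqN0 la u : eqN la u 0 <-> N la u.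
Proof. by rewrite /eqN subr0. Qed.

Lemma Nbar_eigen la b b' y g g' : gen T n y ->
  (forall i, (0 < i < n)%N -> inner b i -> y * T i = q *: y) ->
  gen T n g -> gen T n g' -> xla T n b = g * xla T n b' * g' ->
  sumn b' = n -> dominates b' la -> (exists k, (sumn (take k la) < sumn (take k b'))%N) ->
  N la y.
Proof.
move=> Gy Hy Gg Gg' E Sb Db [k Hk].
have [mu [h [h' [Hmu Dmu Gh Gh' Eb']]]] := xla_sort HT q0 poinc0 Sb.
rewrite (xla_factor poinc0 Hy) E Eb' !mulrA -(mulrA _ h' g').
apply: (Nbar_ideal HT) => //; last exact: gen_mul.
  split; first by move=> r; apply: leq_trans (Db r) (Dmu r).
  by move=> Emu; have := Dmu k; rewrite Emu; lia.
by apply: gen_mul => //; apply: gen_mul => //; apply: gen_scale.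
Qed.

Lemma Tji_cat i j k : (i <= j <= k)%N -> Tji T j k * Tji T i j = Tji T i k.
Proof.
move=> /andP[ij]; elim: k => [|k IH] jk.
  by have -> : j = 0%N; [lia|have -> : i = 0%N; [lia|rewrite Tji_id mulr1]].
have [E|ne] := eqVneq j k.+1; first by rewrite E Tji_id mul1r.
by rewrite Tji_recl ?[RHS]Tji_recl -?mulrA ?IH //; lia.
Qed.

Section Shape.
Variable la : seq nat.
Hypothesis Hla : part_of n la.

Let Pla : is_part la. Proof. by case/andP: Hla. Qed.
Let Sla : sumn la = n. Proof. by case/andP: Hla => _ /eqP. Qed.

Local Notation B r := (sumn (take r la)).
Local Notation x := (xla T n la).

Lemma Bn r : (B r <= n)%N.
Proof. by rewrite -Sla sumn_take_le. Qed.

Lemma BS r : B r.+1 = (B r + nth 0 la r)%N.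
Proof. exact: sumn_takeS. Qed.

(* Pulling the first entry of row [i] into the longer row [j] above it. *)
Lemma pull_up_Nbar i j : (j < i)%N -> (i < size la)%N ->
  N la (x * Tji T (B j.+1).+1 (B i).+1 * \sum_((B j).+1 <= e < (B j.+1).+2) Tji T e (B j.+1).+1).
Proof.
move=> ji il; have li : (0 < nth 0%N la i)%N by rewrite part_pos.
have lj : (0 < nth 0%N la j)%N by rewrite part_pos //; lia.
have mB r1 r2 : (r1 <= r2)%N -> (B r1 <= B r2)%N by apply: sumn_take_mono.
have Hj := BS j; have Hi := BS i; have Hin := Bn i.+1.
have Hij := mB _ _ ji.
set y := x * _; set Q := \sum_(_ <= e < _) _.
have PB r := @sumn_take_move la j i r ji il li.
set be := move_box la j i in PB.
have yT s : (0 < s < n)%N -> (s < B j.+1)%N -> inner la s -> y * T s = q *: y.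
  move=> Hs lt Hin'; rewrite /y -mulrA -(Tji_far HT) //; [|lia|lia].
  by rewrite mulrA (xlaR HT) // scalerAl.
have QT s : (0 < s < n)%N -> (s < B j)%N || ((B j.+1).+1 < s)%N -> T s * Q = Q * T s.
  move=> Hs H; rewrite /Q mulr_sumr mulr_suml; apply: eq_big_nat => e He.
  by apply: (Tji_far HT); lia.
apply: (@Nbar_eigen la be be _ 1 1); try exact: gen_one.
- apply: gen_mul.
    by apply: gen_mul; [apply: xla_gen|apply: Tji_gen; lia].
  by rewrite /Q big_mkcond; apply: gen_sum => e; rewrite mem_index_iota => He _;
     apply: Tji_gen; lia.
- move=> s Hs Hin'; have Nr r := Hin' r; have inn r := PB r.
  have F1 r : (r <= j)%N || (i < r)%N -> B r <> s by move=> H E; have := Nr r; rewrite inn; lia.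
  have F2 r : (j < r <= i)%N -> (B r).+1 <> s by move=> H E; have := Nr r; rewrite inn; lia.
  have G1 : s <> B j by apply: nesym; apply: F1; lia.
  have G2 : s <> (B j.+1).+1 by apply: nesym; apply: F2; lia.
  have G3 : s <> (B i).+1 by apply: nesym; apply: F2; lia.
  have [lt|ge] := ltnP s (B j).
    rewrite -mulrA -QT ?lt // mulrA yT ?scalerAl //; first by lia.
    move=> r; have [rj|jr] := leqP r j; first by apply: F1; rewrite rj.
    by have := mB j r (ltnW jr); lia.
  have [lt|ge1] := ltnP s (B j.+1).+1.
    apply: (coset_sum_down HT); try lia.
    by move=> k Hk; apply: yT; [lia|lia|apply: (@inner_between _ j); lia].
  have QTs : T s * Q = Q * T s by apply: QT; lia.
  rewrite -mulrA -QTs mulrA scalerAl; congr (_ * _).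
  have [lt|ge2] := ltnP s (B i).+1.
    rewrite /y -mulrA (Tji_shift HT); try lia.
    rewrite mulrA (xlaR HT) ?scalerAl //; first by lia.
    move=> r; have [rj|jr] := leqP r j; first by have := mB r j rj; lia.
    have [ri|ir] := leqP r i; first by have := F2 r; lia.
    by have := mB _ _ ir; lia.
  rewrite /y -mulrA -(Tji_far HT) //; try lia.
  rewrite mulrA (xlaR HT) ?scalerAl //.
  move=> r; have [ri|ir] := leqP r i; first by have := mB _ _ ri; lia.
  by apply: F1; lia.
- by rewrite mul1r mulr1.
- have := PB (size la); rewrite take_size [X in take X _](_ : _ = size be); last by rewrite size_mkseq.
  by rewrite take_size; lia.
- by move=> r; rewrite PB leq_addr.
- by exists j.+1; rewrite PB; lia.
Qed.

Lemma xla_JM_first i : (i < size la)%N -> eqN la (x * JM q T (B i)) (q^-1 ^+ i *: x).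
Proof.
move=> il.
have mB r1 r2 : (r1 <= r2)%N -> (B r1 <= B r2)%N by apply: sumn_take_mono.
have bn : (B i < n)%N.
  by have := Bn i.+1; rewrite BS; have := part_pos i Pla; rewrite il; lia.
suff main j : (j <= i)%N -> eqN la (x * Tji T (B j).+1 (B i).+1 * JM q T (B j))
                               (q^-1 ^+ j *: (x * Tji T (B j).+1 (B i).+1)).
  by have := main i (leqnn i); rewrite Tji_id mulr1.
elim: j => [|j IH] ji; first by rewrite take0 JM0 mulr1 expr0 scale1r; apply: eqN_refl.
have Hp := pull_up_Nbar ji il; set y := x * _ in Hp *.
have lj : (0 < nth 0%N la j)%N by rewrite part_pos //; lia.
have Bj := BS j; have Bi := mB _ _ ji.
rewrite (@JM_iter _ q _ T (B j)); last by lia.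
have Ey : y * Tji T (B j).+1 (B j.+1).+1 = x * Tji T (B j).+1 (B i).+1.
  by rewrite /y -mulrA Tji_cat //; lia.
rewrite -scalerAr !mulrA Ey.
have GT : gen T n (Tij T (B j).+1 (B j.+1).+1) by apply: Tij_gen; lia.
apply: eqN_trans (eqN_scale _ (eqN_mulr (IH (ltnW ji)) GT)) _.
rewrite -Ey -scalerAl (@palindrome_sum _ _ _ _ _ HT y (B j)); try lia; last first.
  move=> s Hs; rewrite /y -mulrA -(Tji_far HT); try lia.
  by rewrite mulrA (xlaR HT) ?scalerAl //; [lia|apply: (@inner_between _ j); lia].
set S := \sum_(_ <= r < _) _.
have HS : eqN la S (- y).
  rewrite /eqN opprK; move: Hp; rewrite mulr_sumr big_nat_recr /=; last by lia.
  by rewrite Tji_id mulr1.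
apply: eqN_trans (eqN_scale _ (eqN_scale _ (eqN_add (eqN_refl _ _) (eqN_scale _ HS)))) _.
rewrite scalerN -scalerBl !scalerA.
have -> : ((B j.+1).+1 - (B j).+1 = (B j.+1 - B j))%N by lia.
have -> : (B j.+1 - (B j).+1 = (B j.+1 - B j).-1)%N by lia.
have [d ->] : exists d, (B j.+1 - B j = d.+1)%N by exists (B j.+1 - B j).-1; lia.

rewrite (_ : q^-1 ^+ d.+1 * q^-1 ^+ j * _ = q^-1 ^+ j.+1); first exact: eqN_refl.
by rewrite !exprVn !exprS; field; rewrite q0 !expf_neq0.
Qed.

Lemma xla_JM r c : (c < nth 0%N la r)%N ->
  eqN la (x * JM q T (B r + c)) ((q^-1 ^+ r * q ^+ c) *: x).
Proof.
elim: c => [|c IH] Hc.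
  by rewrite addn0 expr0 mulr1; apply: xla_JM_first; rewrite -part_pos.
have Br := BS r; have Bn' := Bn r.+1.
have Hs : (0 < B r + c.+1 < n)%N by lia.
have Hin : inner la (B r + c.+1) by apply: (@inner_between _ r); lia.
have GT : gen T n (T (B r + c.+1)) by apply: gen_T.
rewrite addnS JMS -addnS -scalerAr !mulrA (xlaR HT) // -!scalerAl scalerA mulVf // scale1r.
apply: eqN_trans (eqN_mulr (IH (ltnW Hc)) GT) _.
rewrite -scalerAl (xlaR HT) // scalerA -mulrA -exprSr; exact: eqN_refl.
Qed.

Lemma garnir i : (0 < nth 0%N la i.+1)%N -> nth 0%N la i = nth 0%N la i.+1 ->
  N la (x * \sum_(B i.+1 <= e < (B i.+2).+1) Tij T (B i.+1) e).
Proof.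
move=> lp El; set l := nth 0%N la i in El.
have il : (i.+1 < size la)%N by rewrite -part_pos.
have Bi := BS i; have Bi1 := BS i.+1; have Bi2 := Bn i.+2; rewrite -/l in Bi; rewrite -El in Bi1 lp.
have mB r1 r2 : (r1 <= r2)%N -> (B r1 <= B r2)%N by apply: sumn_take_mono.
pose s1 := take i la; pose s2 := drop i.+2 la.
have Dla : la = s1 ++ [:: l, l & s2].
  rewrite -[LHS](cat_take_drop i) (drop_nth 0%N); last by lia.
  by rewrite (drop_nth 0%N (n := i.+1)) // -El.
have S1 : size s1 = i by rewrite size_take; have -> : (i < size la)%N by lia.
have pair u v r : (u + v = l + l)%N ->
    sumn (take r (s1 ++ [:: u, v & s2])) = if r == i.+1 then (B i + u)%N else B r.
  by move=> E; rewrite (sumn_take_pair s1 s2 r E) S1 -Dla.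
have Eb : ((l.-1 + l.+1) = l + l)%N by lia.
have Eb' : ((l.+1 + l.-1) = l + l)%N by lia.
have sumE u v : (u + v = l + l)%N -> sumn (s1 ++ [:: u, v & s2]) = n.
  by move=> E; rewrite -Sla [in RHS]Dla !sumn_cat /=; lia.
have [g [g' [Gg Gg' Ex]]] := xla_swap HT q0 poinc0 (sumE _ _ Eb).
set Q := \sum_(_ <= e < _) _.
have QT s : (0 < s < n)%N -> (s.+1 < B i.+1)%N || ((B i.+2) < s)%N -> T s * Q = Q * T s.
  move=> Hs H; rewrite /Q mulr_sumr mulr_suml; apply: eq_big_nat => e He.
  by apply: (Tij_far HT); lia.
apply: (Nbar_eigen _ _ Gg Gg' Ex).
- apply: gen_mul; first exact: xla_gen.
  by apply: gen_sum => e; rewrite mem_index_iota => He _; apply: Tij_gen; lia.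
- move=> s Hs Hin.
  have F1 r : r != i.+1 -> B r <> s by have := Hin r; rewrite pair //; case: eqP.
  have F2 : (B i + l.-1)%N <> s by have := Hin i.+1; rewrite pair // eqxx.
  have F3 := F1 i.+2 ltac:(lia).
  have [lt|ge] := ltnP s (B i.+1).-1.
    have QTs : T s * Q = Q * T s by apply: QT; lia.
    rewrite -mulrA -QTs mulrA (xlaR HT) ?scalerAl // => r.
    by have [->|/F1//] := eqVneq r i.+1; lia.
  have [lt|ge1] := ltnP s (B i.+2).
    apply: (coset_sum_up HT); try lia.
    by move=> k Hk; apply: (xlaR HT); [lia|apply: (@inner_between _ i.+1); lia].
  have QTs : T s * Q = Q * T s by apply: QT; lia.
  rewrite -mulrA -QTs mulrA (xlaR HT) ?scalerAl // => r.
  by have [->|/F1//] := eqVneq r i.+1; lia.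
- exact: sumE.
- by move=> r; rewrite pair //; case: eqP => [->|_]; rewrite ?Bi; lia.
- by exists i.+1; rewrite pair // eqxx; lia.
Qed.

End Shape.
End HeckeEqN.

(** * Contents and central characters *)

Section Nodes.
Implicit Types (la mu : seq nat).

Lemma rowS la r : Defs.row la r.+1 = nth 0%N la r.
Proof. by []. Qed.

Lemma mem_nodes la y : (y \in nodes la) = (0 < y.1)%N && (0 < y.2 <= Defs.row la y.1)%N.
Proof.
case: y => r c /=; apply/flattenP/idP => [[s /mapP[r' Hr' ->] /mapP[c' Hc' [-> ->]]]|].
  by move: Hr' Hc'; rewrite !mem_iota; lia.
move=> H; have Hr : (r.-1 < size la)%N.
  by rewrite ltnNge; apply/negP => ge; move: H; rewrite /Defs.row nth_default //; lia.
exists [seq (r, c') | c' <- iota 1 (Defs.row la r)].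
  by apply/mapP; exists r => //; rewrite mem_iota; lia.
by apply/mapP; exists c => //; rewrite mem_iota; lia.
Qed.

Lemma tla_nodes la : [seq tla la y.1 y.2 | y <- nodes la] = iota 1 (sumn la).
Proof.
suff H m : (m <= size la)%N -> [seq tla la y.1 y.2 | y <-
    flatten [seq [seq (r, c) | c <- iota 1 (Defs.row la r)] | r <- iota 1 m]] = iota 1 (sumn (take m la)).
  by have := H (size la) (leqnn _); rewrite take_size.
elim: m => [|m IH] Hm; first by rewrite take0.
rewrite -[in iota 1 m.+1](addn1 m) iotaD map_cat flatten_cat map_cat IH; last by lia.
rewrite sumn_takeS iotaD; congr (_ ++ _).
rewrite /= cats0 -map_comp rowS add1n (addnC 1%N) iotaDl.
by apply: eq_map => c; rewrite /tla /=.
Qed.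

Lemma nodes_uniq la : uniq (nodes la).
Proof. by apply: (@map_uniq _ _ (fun y => tla la y.1 y.2)); rewrite tla_nodes iota_uniq. Qed.

Lemma size_part la : is_part la -> (size la <= sumn la)%N.
Proof.
move=> /andP[_]; elim: la => //= x la IH /andP[x0 /IH]; lia.
Qed.

Lemma part_ext la mu : is_part la -> is_part mu -> (forall r, nth 0%N la r = nth 0%N mu r) -> la = mu.
Proof.
move=> Hl Hm H; apply: (@eq_from_nth _ 0%N) => //.
have P r : (r < size la)%N = (r < size mu)%N by rewrite -!part_pos // H.
by have := P (size la); have := P (size mu); lia.
Qed.

Lemma mem_cands n k s : (size s <= k)%N -> all (fun x => 0 < x <= n)%N s -> s \in cands n k.
Proof.
elim: k s => [|k IH] [|x s] //= Hk /andP[Hx Hs]; rewrite in_cons /=.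
by apply/allpairsP; exists (x, s); rewrite /= mem_iota IH //; split=> //; lia.
Qed.

Lemma mem_partitions n la : (la \in partitions n) = part_of n la.
Proof.
rewrite mem_filter; case H: (part_of n la) => //=.
case/andP: (H) => Hp /eqP Hs; apply: mem_cands; first by rewrite -Hs size_part.
apply/allP => x Hx; case/andP: (Hp) => _ /allP -> //=.
by rewrite -Hs sumnE (big_rem x) //= leq_addr.
Qed.

(* Only [sumn (take k la)] with [k <= n] is counted, so the weight is strictly
   increasing for dominance on partitions of [n]. *)
Definition dom_weight n la : nat := \sum_(k < n.+1) sumn (take k la).

Lemma sdominates_weight n mu la : part_of n mu -> part_of n la -> sdominates mu la ->
  (dom_weight n la < dom_weight n mu)%N.
Proof.
move=> /andP[Pm /eqP Sm] /andP[Pl /eqP Sl] [D ne].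
rewrite ltn_neqAle leq_sum ?andbT; last by move=> k _; apply: D.
apply/negP => /eqP E; apply: ne; apply: part_ext => // r.
have Ek k : (k <= n)%N -> sumn (take k mu) = sumn (take k la).
  move=> Hk; have Hk' : (k < n.+1)%N by [].
  apply/eqP; rewrite eqn_leq D andbT leqNgt; apply/negP => lt.
  suff : (dom_weight n la < dom_weight n mu)%N by rewrite E ltnn.
  rewrite /dom_weight (bigD1 (Ordinal Hk')) //= [X in (_ < X)%N](bigD1 (Ordinal Hk')) //= -addSn.
  by apply: leq_add => //; apply: leq_sum => i _; apply: D.
have [lt|ge] := ltnP r n.
  by have := Ek r.+1 lt; rewrite !sumn_takeS (Ek r (ltnW lt)) => /addnI.
by rewrite !nth_default //; [rewrite -Sl in ge|rewrite -Sm in ge]; apply: leq_trans ge; apply: size_part.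
Qed.

Lemma count_content n la d : part_of n la ->
  count (pred1 d) [seq (n + y.2 - y.1)%N | y <- nodes la] =
  (\sum_(1 <= r < n.+1) ((n < d + r) && (d + r - n <= Defs.row la r)))%N.
Proof.
move=> /andP[Pl /eqP Sl]; have Hs := size_part Pl; rewrite Sl in Hs.
have E r : (0 < r <= n)%N -> count (fun c => n + c - r == d)%N (iota 1 (Defs.row la r)) =
    ((n < d + r) && (d + r - n <= Defs.row la r))%N :> nat.
  move=> Hr; have -> : count (fun c => n + c - r == d)%N (iota 1 (Defs.row la r)) =
     count (pred1 (d + r - n)%N) [seq c <- iota 1 (Defs.row la r) | (n < d + r)%N].
    rewrite count_filter; apply: eq_in_count => c; rewrite mem_iota /=; lia.
  case: (ltnP n (d + r)) => H.
    by rewrite filter_predT (count_uniq_mem _ (iota_uniq _ _)) mem_iota; lia.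
  by rewrite filter_pred0.
rewrite /nodes map_flatten count_flatten -!map_comp.
have -> : [seq (count (pred1 d) \o map (fun y : nat * nat => n + y.2 - y.1)%N \o
      (fun r => [seq (r, c) | c <- iota 1 (Defs.row la r)])) i | i <- iota 1 (size la)] =
   [seq nat_of_bool ((n < d + r) && (d + r - n <= Defs.row la r))%N | r <- iota 1 (size la)].
  apply/eq_in_map => r; rewrite mem_iota => Hr /=.
  by rewrite -map_comp count_map -E //; lia.
rewrite sumnE big_map [RHS](@big_cat_nat _ _ _ (size la).+1) //=.
have -> : (\sum_((size la).+1 <= r < n.+1) ((n < d + r) && (d + r - n <= Defs.row la r)) = 0)%N.
  by rewrite big_nat big1 // => r Hr; rewrite /Defs.row nth_default; lia.
by rewrite addn0 /index_iota subSS subn0.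
Qed.

Lemma contents_inj n la mu : part_of n la -> part_of n mu ->
  perm_eq [seq (n + y.2 - y.1)%N | y <- nodes la] [seq (n + y.2 - y.1)%N | y <- nodes mu] ->
  la = mu.
Proof.
move=> Hl Hm Hp.
have Pl : is_part la by case/andP: Hl.
have Pm : is_part mu by case/andP: Hm.
have cnt d := (seq.permP Hp) (pred1 d).
apply: part_ext => // r.
have step (a b : seq nat) i : is_part a -> is_part b -> part_of n a -> part_of n b ->
   (i < n)%N ->
   (forall d, count (pred1 d) [seq (n + y.2 - y.1)%N | y <- nodes a] =
              count (pred1 d) [seq (n + y.2 - y.1)%N | y <- nodes b]) ->
   (forall j, (j < i)%N -> nth 0%N a j = nth 0%N b j) -> (nth 0%N a i <= nth 0%N b i)%N.
  move=> Pa Pb Ha Hb Hi E IH; rewrite leqNgt; apply/negP => lt.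
  have := E (n + nth 0 a i - i.+1)%N; rewrite !count_content //.
  rewrite (@big_cat_nat _ _ _ i.+1) //=; last by lia.
  rewrite [RHS](@big_cat_nat _ _ _ i.+1) //=; last by lia.
  rewrite (@big_ltn _ _ _ i.+1) // [in RHS](@big_ltn _ _ _ i.+1) // !rowS.
  have -> : (\sum_(1 <= r0 < i.+1) ((n < n + nth 0 a i - i.+1 + r0) &&
        (n + nth 0 a i - i.+1 + r0 - n <= Defs.row a r0)) =
      \sum_(1 <= r0 < i.+1) ((n < n + nth 0 a i - i.+1 + r0) &&
        (n + nth 0 a i - i.+1 + r0 - n <= Defs.row b r0)))%N.
    by apply: eq_big_nat => -[//|r0] Hr0; rewrite !rowS (IH r0) //; lia.
  have Z c : is_part c -> (nth 0%N c i <= nth 0%N a i)%N ->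
    (\sum_(i.+2 <= r0 < n.+1) ((n < n + nth 0 a i - i.+1 + r0) &&
        (n + nth 0 a i - i.+1 + r0 - n <= Defs.row c r0)) = 0)%N.
    move=> Pc Hc; rewrite big_nat big1 // => -[//|r0] Hr0; rewrite rowS.
    by have := @part_nth c i r0 Pc; lia.
  by rewrite (Z a) // (Z b) //; lia.
have [lt|ge] := ltnP r n; last first.
  case/andP: Hl => _ /eqP Sl; case/andP: Hm => _ /eqP Sm.
  by rewrite !nth_default //; [rewrite -Sm in ge|rewrite -Sl in ge]; apply: leq_trans ge; apply: size_part.
have [k] := ubnP r; elim: k r lt => // k IH r lt rk.
apply/eqP; rewrite eqn_leq !step //.
- by move=> j jr; symmetry; apply: IH; lia.
- by move=> j jr; apply: IH; lia.
Qed.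

End Nodes.

Section Generic.
Variables (K : fieldType) (q : K).
(* [q] is transcendental, in the only form needed: sums of powers of [q]
   determine their multiset of exponents. *)
Hypothesis qinj : forall s1 s2 : seq nat,
  \sum_(i <- s1) q ^+ i = \sum_(i <- s2) q ^+ i -> perm_eq s1 s2.

Lemma q_neq0 : q != 0.
Proof.
apply/eqP => E; have := @qinj [:: 1%N] [::].
by rewrite !big_cons !big_nil E expr1 addr0 => /(_ erefl).
Qed.

Lemma qX_neq1 k : q ^+ k.+1 != 1.
Proof.
apply/eqP => E; have := @qinj [:: k.+1] [:: 0%N].
by rewrite !big_cons !big_nil E expr0 => /(_ erefl) /perm_mem /(_ 0%N); rewrite !inE.
Qed.

Lemma poinc_neq0 n b : poinc q n b != 0.
Proof.
apply/eqP => E; have := @qinj [seq ninv w | w <- index_enum {perm 'I_n} & rowstab b w] [::].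
rewrite big_map big_filter big_nil => /(_ E) /perm_mem /(_ 0%N).
rewrite in_nil => /negP; apply; apply/mapP; exists 1%g; last by rewrite ninv1.
by rewrite mem_filter rowstab1 mem_index_enum.
Qed.

Definition qcontent (y : nat * nat) : K := q^-1 ^+ y.1 * q ^+ y.2.

(* The scalar by which [zJM] acts on the Specht module of [la]. *)
Definition qcharge la : K := \sum_(y <- nodes la) qcontent y.

Lemma qcharge_inj n la mu : part_of n la -> part_of n mu -> qcharge la = qcharge mu -> la = mu.
Proof.
move=> Hl Hm E; apply: (contents_inj Hl Hm); apply: qinj.
have scal ka : part_of n ka ->
    \sum_(i <- [seq (n + y.2 - y.1)%N | y <- nodes ka]) q ^+ i = q ^+ n * qcharge ka.
  move=> /andP[Pk /eqP Sk]; rewrite big_map /qcharge mulr_sumr; apply: eq_big_seq => -[r c].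
  rewrite mem_nodes /qcontent /= => Hy; have := size_part Pk; rewrite Sk => Hs.
  have Hr : (r <= n)%N.
    apply: leq_trans Hs; rewrite -(ltn_predK (m := 0) (n := r)); last by lia.
    by rewrite -part_pos //; move: Hy; rewrite /Defs.row; lia.
  have -> : (n + c - r = (n - r) + c)%N by lia.
  rewrite exprD mulrA; congr (_ * _); have {2}-> : n = (n - r + r)%N by lia.
  by rewrite exprD -mulrA -exprMn divff ?q_neq0 // expr1n mulr1.
by rewrite !scal // E.
Qed.

Section Level.
Variables (A : algType K) (T : nat -> A) (n : nat).
Hypothesis HT : hecke_rels q T n.
Local Notation z := (zJM q T n).
Local Notation x := (xla T n).

Lemma xla_zJM la : part_of n la -> eqN T n la (x la * z) (qcharge la *: x la).
Proof.
move=> Hla; case/andP: (Hla) => Pla /eqP Sla.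
have -> : z = \sum_(y <- nodes la) JM q T (tla la y.1 y.2).-1.
  rewrite -(big_map (fun y : nat * nat => tla la y.1 y.2) xpredT (fun p => JM q T p.-1)).
  rewrite tla_nodes Sla /zJM -(big_mkord xpredT (fun p => JM q T p)) /index_iota subn0.
  by rewrite -[1%N]addn0 iotaDl big_map.
rewrite mulr_sumr /qcharge scaler_suml /eqN -sumrB big_seq_cond; apply: Nbar_sum => -[r c].
rewrite andbT mem_nodes /= => Hy; case: r Hy => // r Hy.
case: c Hy => [|c] Hy; first by lia.
have := @xla_JM _ _ _ _ _ HT q_neq0 (@poinc_neq0 n) la Hla r c.
rewrite /eqN /tla /= addnS /= /qcontent /= !exprS mulrACA.
by rewrite mulVf ?q_neq0 // mul1r; apply; rewrite -rowS; lia.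
Qed.

Lemma Nbar_le_weight la h (p : {poly K}) : part_of n la -> in_Nbar T n la h ->
  (forall mu, part_of n mu -> (dom_weight n la < dom_weight n mu)%N ->
     x mu * horner_alg z p = 0) ->
  h * horner_alg z p = 0.
Proof.
move=> Hla Hh Hp; move: h Hh; apply: Nbar_ind => [|u v Hu Hv|c u Hu|mu u v Hmu Dmu].
- by rewrite mul0r.
- by rewrite mulrDl Hu Hv addr0.
- by rewrite -scalerAl Hu scaler0.
have E : Tw T v * horner_alg z p = horner_alg z p * Tw T v.
  elim/poly_ind: p {Hp} => [|p c IH]; first by rewrite rmorph0 mulr0 mul0r.
  rewrite rmorphD rmorphM /= horner_algX horner_algC mulrDr mulrDl.
  rewrite mulr_algr mulr_algl mulrA IH -!mulrA (zJM_gen HT q_neq0) //.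
  exact: Tw_gen.
rewrite /xst -!mulrA E (mulrA (x mu)) Hp ?mul0r ?mulr0 //.
exact: sdominates_weight.
Qed.

Definition weight_poly w : {poly K} :=
  \prod_(ka <- undup (partitions n) | (w <= dom_weight n ka)%N) ('X - (qcharge ka)%:P).

Lemma weight_poly_dvd w w' : (w <= w')%N -> exists p, weight_poly w = weight_poly w' * p.
Proof.
move=> ww; exists (\prod_(ka <- undup (partitions n) | (w <= dom_weight n ka)%N &&
    ~~ (w' <= dom_weight n ka)%N) ('X - (qcharge ka)%:P)).
rewrite /weight_poly (bigID (fun ka => w' <= dom_weight n ka)%N) /=.
by congr (_ * _); apply: eq_bigl => ka; case: (leqP w' _) => H; rewrite ?andbF ?andbT //; apply: leq_trans H.
Qed.

Lemma xla_weight_poly la : part_of n la -> x la * horner_alg z (weight_poly (dom_weight n la)) = 0.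
Proof.
pose bd := \max_(ka <- undup (partitions n)) dom_weight n ka.
have [k] := ubnP (bd - dom_weight n la); elim: k la => // k IH la Hk Hla.
have Mla : la \in undup (partitions n) by rewrite mem_undup mem_partitions.
have -> : weight_poly (dom_weight n la) = ('X - (qcharge la)%:P) *
   \prod_(ka <- rem la (undup (partitions n)) | (dom_weight n la <= dom_weight n ka)%N) ('X - (qcharge ka)%:P).
  by rewrite /weight_poly (big_rem la) //= leqnn.
rewrite rmorphM /= rmorphB /= horner_algX horner_algC mulrA mulrBr mulr_algr.
apply: (Nbar_le_weight Hla); first exact: xla_zJM.
move=> mu Hmu lt.
have [p ->] : exists p, \prod_(ka <- rem la (undup (partitions n)) |
   (dom_weight n la <= dom_weight n ka)%N) ('X - (qcharge ka)%:P) = weight_poly (dom_weight n mu) * p.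
  exists (\prod_(ka <- rem la (undup (partitions n)) | (dom_weight n la <= dom_weight n ka)%N &&
     ~~ (dom_weight n mu <= dom_weight n ka)%N) ('X - (qcharge ka)%:P)).
  rewrite (bigID (fun ka => dom_weight n mu <= dom_weight n ka)%N) /=; congr (_ * _).
  rewrite /weight_poly [RHS](big_rem la) //= leqNgt lt /= mul1r; apply: eq_bigl => ka.
  by case: (leqP (dom_weight n mu) _) => H; rewrite ?andbF ?andbT //; apply: ltnW; apply: leq_trans H.
rewrite rmorphM /= mulrA IH ?mul0r //.
have : (dom_weight n mu <= bd)%N.
  by apply: (leq_bigmax_seq mu); rewrite ?mem_undup ?mem_partitions.
by lia.
Qed.

Lemma Nbar_weight_poly la h : part_of n la -> in_Nbar T n la h ->
  h * horner_alg z (weight_poly (dom_weight n la).+1) = 0.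
Proof.
move=> Hla Hh; apply: (Nbar_le_weight Hla Hh) => mu Hmu lt.
have [p ->] := weight_poly_dvd lt.
by rewrite rmorphM /= mulrA xla_weight_poly // mul0r.
Qed.

Lemma weight_poly_neq0 la : part_of n la ->
  (weight_poly (dom_weight n la).+1).[qcharge la] != 0.
Proof.
move=> Hla; rewrite /weight_poly horner_prod prodf_seq_neq0; apply/allP => ka.
rewrite mem_undup mem_partitions => Hka; apply/implyP => lt.
rewrite hornerXsubC subr_eq0; apply/eqP => /(qcharge_inj Hla Hka) E.
by rewrite E ltnn in lt.
Qed.

(* The roots are simple by [qcharge_inj]: this replaces semisimplicity. *)
Lemma zJM_poly : horner_alg z (\prod_(ka <- undup (partitions n)) ('X - (qcharge ka)%:P)) = 0.
Proof.
have H1 : part_of n (nseq n 1%N).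
  rewrite /part_of /is_part sumn_nseq mul1n eqxx andbT; apply/andP; split.
    by case: n => //= k; elim: k => //= k ->.
  by apply/allP => i /nseqP[->].
have take1 r : sumn (take r (nseq n 1%N)) = minn r n.
  have [rn|nr] := leqP r n; first by rewrite take_nseq // sumn_nseq mul1n.
  by rewrite take_oversize ?size_nseq ?sumn_nseq ?mul1n // ltnW.
have E1 : (1 : A) = (poinc q n (nseq n 1%N))^-1 *: x (nseq n 1%N).
  rewrite -[x _]mul1r scalerAl; apply: (xla_factor (@poinc_neq0 n)) => i Hi Hin.
  by have := Hin i; rewrite take1; lia.
have [p ->] : exists p, \prod_(ka <- undup (partitions n)) ('X - (qcharge ka)%:P) =
    weight_poly (dom_weight n (nseq n 1%N)) * p.
  have -> : \prod_(ka <- undup (partitions n)) ('X - (qcharge ka)%:P) = weight_poly 0 by [].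
  exact: weight_poly_dvd.
by rewrite -[LHS]mul1r {1}E1 rmorphM /= mulrA -scalerAl xla_weight_poly // scaler0 mul0r.
Qed.

End Level.
End Generic.

(** * Intertwiners and the branching projection *)

Section Walk.
Variables (K : fieldType) (q : K).
Hypothesis qinj : forall s1 s2 : seq nat,
  \sum_(i <- s1) q ^+ i = \sum_(i <- s2) q ^+ i -> perm_eq s1 s2.
Let q0 := q_neq0 qinj.
Variables (A : algType K) (T : nat -> A) (n : nat).
Hypothesis HT : hecke_rels q T n.
Variable la : seq nat.
Hypothesis Hla : part_of n la.

Local Notation x := (xla T n la).
Local Notation J := (JM q T).
Local Notation "u =N v" := (eqN T n la u v) (at level 70).

Lemma gen_horner g p : gen T n g -> gen T n (horner_alg g p).
Proof.
move=> Gg; elim/poly_ind: p => [|p c IH]; first by rewrite rmorph0; apply: gen_zero.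
rewrite rmorphD rmorphM /= horner_algX horner_algC.
by apply: gen_add; [apply: gen_mul|apply: gen_cst].
Qed.

Lemma comm_horner (a g : A) p : g * a = a * g -> g * horner_alg a p = horner_alg a p * g.
Proof.
move=> E; elim/poly_ind: p => [|p c IH]; first by rewrite rmorph0 mulr0 mul0r.
rewrite rmorphD rmorphM /= horner_algX horner_algC mulrDr mulrDl mulr_algr mulr_algl.
by rewrite mulrA IH -!mulrA E.
Qed.

Lemma Jgen p : (p < n)%N -> gen T n (J p).
Proof. by move=> pn; apply: gen_le (JM_gen _ _ _). Qed.

Lemma T_horner_JM p (f : {poly K}) : (p.+1 < n)%N -> exists R, [/\ gen T n R,
  R * J p.+1 = J p.+1 * R &
  T p.+1 * horner_alg (J p.+1) f = horner_alg (J p) f * T p.+1 + R].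
Proof.
move=> pn; elim/poly_ind: f => [|f c [R [GR CR E]]].
  by exists 0; split; rewrite ?rmorph0 ?mulr0 ?mul0r ?addr0 //; apply: gen_zero.
exists ((q - 1) *: (horner_alg (J p) f * J p.+1) + R * J p.+1); split.
- apply: gen_add; last by apply: gen_mul => //; apply: Jgen.
  by apply: gen_scale; apply: gen_mul; [apply: gen_horner|]; apply: Jgen => //; apply: ltnW.
- rewrite mulrDl mulrDr -scalerAl -scalerAr [in RHS]mulrA [in RHS]mulrA CR.
  by rewrite (comm_horner (g := J p.+1)) //; apply: (JM_JM HT) => //; exact: ltnW.
rewrite !rmorphD !rmorphM /= !horner_algX !horner_algC mulrDr mulrA E mulr_algr.
rewrite !mulrDl -(mulrA _ (T p.+1)) (T_JM HT q0) // mulrDr.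
rewrite mulr_algl -scalerAr !mulrA -!addrA; congr (_ + _).
by rewrite addrA addrC.
Qed.

Lemma eig_later g p r k : gen T p g -> (p <= r < n)%N -> x * J r =N k *: x ->
  x * g * J r =N k *: (x * g).
Proof.
move=> Gg Hp E; have -> : x * g * J r = x * J r * g.
  rewrite -!mulrA; congr (_ * _); symmetry; apply: (gen_comm (T := T) (m := p)) => // i Hi.
  by rewrite (JM_comm HT) //; lia.
by rewrite scalerAl; apply: (eqN_mulr HT) => //; apply: gen_le Gg; lia.
Qed.

Variables (kap : nat -> K) (p0 : nat).
Hypothesis Hkap : forall p, (p < n)%N -> x * J p =N kap p *: x.
Hypothesis Hrho : forall p, (p0 < p < n)%N -> kap p != kap p0.

Definition beta p : K := (q - 1) * kap p / (kap p0 - kap p).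

(* The vector reached from [x_la] by moving the entry [p0 + 1] to position
   [p0 + d + 1] with the normalised intertwiners. *)
Definition walk d : A := \prod_(p0 <= p < p0 + d) (T p.+1 + (beta p.+1)%:A).

Lemma walkS d : walk d.+1 = walk d * (T (p0 + d).+1 + (beta (p0 + d).+1)%:A).
Proof. by rewrite /walk addnS big_nat_recr //= leq_addr. Qed.

Lemma walk_gen d : (p0 + d < n)%N -> gen T (p0 + d).+1 (walk d).
Proof.
move=> Hd; apply: gen_prod => p; rewrite mem_index_iota => Hp _.
by apply: gen_add; [apply: gen_T; lia|apply: gen_cst].
Qed.

Lemma walk_eig d : (p0 + d < n)%N -> x * walk d * J (p0 + d) =N kap p0 *: (x * walk d).
Proof.
elim: d => [|d IH] Hd.
  by rewrite /walk addn0 big_geq // mulr1; apply: Hkap; lia.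
have Hd' : ((p0 + d).+1 < n)%N by lia.
have {}IH := IH (ltnW Hd'); set w := x * walk d in IH *.
have -> : x * walk d.+1 = w * T (p0 + d).+1 + beta (p0 + d).+1 *: w.
  by rewrite walkS mulrA mulrDr mulr_algr.
rewrite addnS; set p := (p0 + d)%N in Hd' IH *.
have GT : gen T n (T p.+1) by apply: gen_T.
have Ew : w * J p.+1 =N kap p.+1 *: w.
  by apply: (eig_later (p := p.+1)); [apply: walk_gen; lia|lia|apply: Hkap].
rewrite mulrDl -mulrA (T_JM HT q0) // mulrDr mulrA -scalerAr -scalerAl -addrA.
apply: eqN_trans (eqN_add (eqN_mulr HT IH GT) (eqN_add (eqN_scale _ Ew) (eqN_scale _ Ew))) _.
rewrite scalerDr -scalerAl !scalerA -scalerDl -mulrDl.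
have -> : (q - 1 + beta p.+1) * kap p.+1 = kap p0 * beta p.+1; last exact: eqN_refl.
have D0 : kap p0 - kap p.+1 != 0 by rewrite subr_eq0 eq_sym; apply: Hrho; rewrite /p; lia.
by rewrite /beta; field.
Qed.

Definition walk_poly d : {poly K} := \prod_(p0 <= p < p0 + d) ('X - (kap p.+1)%:P).

Lemma walk_lead d : (p0 + d < n)%N ->
  (x * walk d - x * Tij T p0.+1 (p0 + d).+1) * horner_alg (J (p0 + d)) (walk_poly d) =N 0.
Proof.
elim: d => [|d IH] Hd.
  by rewrite /walk addn0 big_geq // Tij_id subrr mul0r; apply: eqN_refl.
have Hd' : ((p0 + d).+1 < n)%N by lia.
have {}IH := IH (ltnW Hd').
have -> : walk_poly d.+1 = walk_poly d * ('X - (kap (p0 + d).+1)%:P).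
  by rewrite /walk_poly addnS big_nat_recr //= leq_addr.
rewrite addnS walkS Tij_recr; last by lia.
set p := (p0 + d)%N in Hd' IH *; set f := walk_poly d in IH *; set k := kap p.+1.
set w := walk d in IH *; set v := Tij _ _ _ in IH *.
have Gw : gen T p.+1 w by apply: walk_gen; lia.
have Gv : gen T p.+1 v by apply: Tij_gen; lia.
have kill g : gen T p.+1 g -> x * g * (J p.+1 - k%:A) =N 0.
  move=> Gg; rewrite mulrBr mulr_algr -[X in eqN _ _ _ _ X](subrr (k *: (x * g))).
  apply: eqN_sub (eqN_refl _ _ _ _); apply: (eig_later (p := p.+1)) => //; first lia.
  exact: Hkap.
have GJ := Jgen Hd'.
have GJk : gen T n (J p.+1 - k%:A) by apply: gen_sub => //; apply: gen_cst.
rewrite rmorphM /= rmorphB /= horner_algX horner_algC.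
have [R [GR CR ER]] := T_horner_JM f Hd'.
have -> : x * (w * (T p.+1 + (beta p.+1)%:A)) - x * (v * T p.+1) =
          x * (w - v) * T p.+1 + beta p.+1 *: (x * w).
  by rewrite (mulrDr w) mulr_algr (mulrDr x) -scalerAr mulrBr mulrBl !mulrA addrAC.
have Cf : horner_alg (J p.+1) f * (J p.+1 - k%:A) = (J p.+1 - k%:A) * horner_alg (J p.+1) f.
  by rewrite mulrBr mulrBl mulr_algl mulr_algr comm_horner.
rewrite mulrDl -(addr0 (0 : A)); apply: eqN_add; last first.
  rewrite -scalerAl Cf mulrA -(scaler0 A (beta p.+1)); apply: eqN_scale.
  rewrite -(mul0r (horner_alg (J p.+1) f)); apply: (eqN_mulr HT); first exact: kill.
  exact: gen_horner.
rewrite mulrA -(mulrA _ (T p.+1)) ER (mulrDr (x * (w - v))) mulrDl -(addr0 (0 : A)); apply: eqN_add.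
  rewrite (mulrA (x * (w - v))) -(mulrA _ (T p.+1)) -[X in eqN _ _ _ _ X](mul0r (T p.+1 * (J p.+1 - k%:A))).
  apply: (eqN_mulr HT); first by rewrite mulrBr.
  by apply: gen_mul => //; apply: gen_T.
have CR' : R * (J p.+1 - k%:A) = (J p.+1 - k%:A) * R.
  by rewrite mulrBr mulrBl mulr_algl mulr_algr CR.
rewrite -mulrA CR' mulrA -(mul0r R); apply: (eqN_mulr HT) => //.
by apply: kill; apply: gen_sub.
Qed.

End Walk.

Section Semisimple.
Variables (K : fieldType) (q : K).
Hypothesis qinj : forall s1 s2 : seq nat,
  \sum_(i <- s1) q ^+ i = \sum_(i <- s2) q ^+ i -> perm_eq s1 s2.
Let q0 := q_neq0 qinj.
Variables (A : algType K) (T : nat -> A) (m : nat).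
Hypothesis HT : hecke_rels q T m.+1.
Variable la : seq nat.
Hypothesis Hla : part_of m.+1 la.

Local Notation n := m.+1.
Local Notation x := (xla T n la).
Local Notation J := (JM q T m).
Local Notation "u =N v" := (eqN T n la u v) (at level 70).

Lemma Jm_gen : gen T n J.
Proof. exact: JM_gen. Qed.

Lemma eig_zJM g : gen T n g -> x * g * zJM q T n =N qcharge q la *: (x * g).
Proof.
move=> Gg; rewrite -mulrA -(zJM_gen HT q0) // mulrA scalerAl; apply: (eqN_mulr HT) => //.
exact: (xla_zJM qinj HT).
Qed.

Lemma JM_squarefree g : gen T n g ->
  x * g * horner_alg J (\prod_(ka <- undup (partitions m)) ('X - (qcharge q la - qcharge q ka)%:P)) =N 0.
Proof.
move=> Gg; have := zJM_poly qinj (hecke_relsS HT).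
move: (undup _) => s /(congr1 ( *%R (x * g))); rewrite mulr0.
have gz : gen T n (zJM q T m).
  by apply: gen_sum => i _ _; apply: gen_le (JM_gen _ _ _); have := ltn_ord i; lia.
have main : x * g * horner_alg (zJM q T m) (\prod_(ka <- s) ('X - (qcharge q ka)%:P)) =N
   (-1) ^+ size s *: (x * g * horner_alg J (\prod_(ka <- s) ('X - (qcharge q la - qcharge q ka)%:P))).
  elim: s g Gg => [|ka s IH] g Gg.
    by rewrite !big_nil !rmorph1 scale1r; apply: eqN_refl.
  rewrite !big_cons !rmorphM /= !rmorphB /= !horner_algX !horner_algC !mulrA.
  have E : x * g * (zJM q T m - (qcharge q ka)%:A) =N
           - (x * g * (J - ((qcharge q la)%:A - (qcharge q ka)%:A))).
    have -> : zJM q T m = zJM q T n - J by rewrite /zJM big_ord_recr /= addrK.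
    rewrite opprB !mulrDr !mulrN !mulr_algr !opprD !opprK.
    rewrite [X in _ =N X]addrC (addrC (- (qcharge q ka *: _))) [X in _ =N X]addrAC.
    by do 2 (apply: eqN_sub; last exact: eqN_refl); exact: eig_zJM.
  apply: eqN_trans (eqN_mulr HT E _) _.
    exact: gen_horner.
  rewrite mulNr exprS mulN1r scaleNr; apply: eqN_opp; rewrite -(mulrA x).
  apply: IH; apply: gen_mul => //; apply: gen_sub; first exact: Jm_gen.
  by apply: gen_sub; apply: gen_cst.
move=> Z; rewrite Z in main; have := eqN_scale ((-1) ^+ size s) (eqN_sym main).
by rewrite scalerA -expr2 sqrr_sign scale1r scaler0.
Qed.

Lemma undup_qcharge_uniq : uniq [seq qcharge q la - qcharge q ka | ka <- undup (partitions m)].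
Proof.
rewrite map_inj_in_uniq ?undup_uniq // => a b; rewrite !mem_undup !mem_partitions => Ha Hb.
by move/addrI/oppr_inj/(qcharge_inj qinj Ha Hb).
Qed.

Lemma kill_squarefree g (l : seq K) (H : {poly K}) : gen T n g ->
  x * g * horner_alg J (\prod_(k <- l) ('X - k%:P)) =N 0 ->
  (forall k, k \in l -> root H k) ->
  x * g * horner_alg J H =N 0.
Proof.
move=> Gg HG Hroot; set s := [seq qcharge q la - qcharge q ka | ka <- undup (partitions m)].
have HF : x * g * horner_alg J (\prod_(k <- s) ('X - k%:P)) =N 0.
  by rewrite big_map; apply: JM_squarefree.
pose F1 := \prod_(k <- s | root H k) ('X - k%:P).
pose F2 := \prod_(k <- s | ~~ root H k) ('X - k%:P).
pose G := \prod_(k <- l) ('X - k%:P).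
have EF : \prod_(k <- s) ('X - k%:P) = F1 * F2 by rewrite (bigID (root H)).
have cop : coprimep F2 G.
  rewrite /F2 big_seq_cond; apply: (big_ind (fun p => coprimep p G)) => [|p r Hp Hr|k /andP[_ Hk]].
  - exact: coprime1p.
  - by rewrite coprimepMl Hp.
  rewrite coprimep_sym coprimep_XsubC /G root_prod_XsubC.
  by apply/negP => /Hroot; rewrite (negbTE Hk).
have [[a b] /= Eab] := Bezout_eq1_coprimepP _ _ cop.
have HF1 : x * g * horner_alg J F1 =N 0.
  have -> : F1 = \prod_(k <- s) ('X - k%:P) * a + G * (b * F1).
    have E1 : F1 = F1 * (a * F2 + b * G) by rewrite Eab mulr1.
    by rewrite EF {1}E1; ring.
  rewrite rmorphD !rmorphM /= mulrDr !mulrA -(addr0 (0 : A)); apply: eqN_add.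
    by rewrite -(mul0r (horner_alg J a)); apply: (eqN_mulr HT) => //; apply: gen_horner; exact: Jm_gen.
  rewrite -[X in eqN _ _ _ _ X](mul0r (horner_alg J b * horner_alg J F1)) -mulrA.
  apply: (eqN_mulr HT) => //.
  by apply: gen_mul; apply: gen_horner; exact: Jm_gen.
have /dvdpP[c ->] : F1 %| H.
  rewrite /F1 -big_filter; apply: uniq_roots_dvdp.
    by apply/allP => k; rewrite mem_filter => /andP[].
  by rewrite uniq_rootsE filter_uniq // undup_qcharge_uniq.
rewrite mulrC rmorphM /= mulrA -(mul0r (horner_alg J c)).
by apply: (eqN_mulr HT) => //; apply: gen_horner; exact: Jm_gen.
Qed.

End Semisimple.

(** * The element P of a removable node *)

Section Removable.
Implicit Types (la : seq nat).

Lemma row_mono la r r' : is_part la -> (0 < r)%N -> (r <= r')%N -> (Defs.row la r' <= Defs.row la r)%N.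
Proof. by move=> P r0 rr; rewrite /Defs.row; apply: part_nth => //; lia. Qed.

Lemma removableE la r c : is_part la ->
  removable la (r, c) = [&& (0 < r)%N, c == Defs.row la r & (Defs.row la r.+1 < c)%N].
Proof.
move=> P; rewrite /removable mem_nodes /=; apply/andP/and3P => [[Hx /allP H]|[r0 /eqP E lt]].
  have memr y : (y \in rem (r, c) (nodes la)) = (y != (r, c)) && (y \in nodes la).
    by rewrite (mem_rem_uniq _ (nodes_uniq la)) inE.
  split; first lia.
    rewrite eqn_leq; apply/andP; split; first lia.
    rewrite leqNgt; apply/negP => lt.
    have Hin : (r, c.+1) \in rem (r, c) (nodes la) by rewrite memr mem_nodes xpair_eqE /=; lia.
    have /andP[_ /implyP/=] := H _ Hin.
    by rewrite memr eqxx /= => /(_ ltac:(lia)).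
  rewrite ltnNge; apply/negP => le.
  have Hin : (r.+1, c) \in rem (r, c) (nodes la) by rewrite memr mem_nodes xpair_eqE /=; lia.
  have /andP[/implyP/= + _] := H _ Hin.
  by rewrite memr eqxx /= => /(_ ltac:(lia)).
split; first by rewrite r0 E leqnn andbT; lia.
apply/allP => -[r' c']; rewrite !(mem_rem_uniq _ (nodes_uniq la)) !inE mem_nodes /=.
rewrite !mem_nodes !xpair_eqE /= => /andP[ne Hy].
have Hm := @row_mono la r'.-1 r' P.
apply/andP; split; apply/implyP => H1.
  have ne' : ~~ ((r'.-1 == r) && (c' == c)).
    apply/negP => /andP[/eqP E1 /eqP E2]; have E3 : r' = r.+1 by lia.
    by rewrite E3 E2 in Hy; lia.
  rewrite ne' /=; lia.
apply/andP; split; last lia.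
apply/negP => /andP[/eqP E1 /eqP E2]; rewrite E1 in Hy; lia.
Qed.

Lemma flatten_if (I J : Type) (P : pred I) (f : I -> J) (s : seq I) :
  flatten [seq (if P i then [:: f i] else [::]) | i <- s] = [seq f i | i <- s & P i].
Proof. by elim: s => //= i s ->; case: (P i). Qed.

Lemma removable_below la k : is_part la ->
  [seq y <- nodes la | removable la y && (k < y.1)%N] =
  [seq (r, Defs.row la r) | r <- iota k.+1 (size la - k) & (Defs.row la r.+1 < Defs.row la r)%N].
Proof.
move=> P; rewrite /nodes filter_flatten -map_comp.
transitivity (flatten [seq (if (Defs.row la r.+1 < Defs.row la r)%N && (k < r)%N
   then [:: (r, Defs.row la r)] else [::]) | r <- iota 1 (size la)]).
  congr flatten; apply/eq_in_map => r; rewrite mem_iota => Hr /=.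
  rewrite filter_map; case: ifP => /andP H.
    have -> : [seq c <- iota 1 (Defs.row la r) | preim (pair r) (fun y => removable la y && (k < y.1)%N) c]
            = [seq c <- iota 1 (Defs.row la r) | pred1 (Defs.row la r) c].
      apply: eq_in_filter => c; rewrite mem_iota /= removableE // => Hc.
      by case: eqP => [->|_] /=; rewrite ?andbF //; lia.
    by rewrite filter_pred1_uniq ?iota_uniq // mem_iota; lia.
  rewrite (eq_in_filter (a2 := pred0)) ?filter_pred0 // => c; rewrite mem_iota /= removableE // => Hc.
  by apply/negbTE/negP => /andP[/and3P[_ /eqP E lt] kr]; apply: H; split => //; rewrite -E.
rewrite flatten_if; congr map.
have [le|lt] := leqP k (size la); last first.
  have -> : (size la - k = 0)%N by lia.
  rewrite /= (eq_in_filter (a2 := pred0)) ?filter_pred0 // => r; rewrite mem_iota /=; lia.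
have {1}-> : size la = (k + (size la - k))%N by lia.
rewrite iotaD filter_cat (eq_in_filter (a2 := pred0)) ?filter_pred0 /=; last first.
  by move=> r; rewrite mem_iota /=; lia.
by rewrite add1n; apply: eq_in_filter => r; rewrite mem_iota; lia.
Qed.

Fixpoint path_prod (A : nzRingType) (J : Type) (F : J -> J -> A) (x : J) (s : seq J) : A :=
  if s is y :: s' then F x y * path_prod F y s' else 1.

Lemma path_prodE (A : nzRingType) (J : Type) (F : J -> J -> A) d (x : J) (s : seq J) :
  \prod_(j < size s) F (nth d (x :: s) j) (nth d (x :: s) j.+1) = path_prod F x s.
Proof.
elim: s x => [|y s IH] x /=; first by rewrite big_ord0.
by rewrite big_ord_recl /= -IH; congr (_ * _); apply: eq_bigr.
Qed.

Lemma sumn_take_gt0 la r : is_part la -> (0 < r)%N -> (0 < size la)%N -> (0 < sumn (take r la))%N.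
Proof.
move=> Pla r0 s0; have : (0 < sumn (take 1 la))%N by rewrite sumn_takeS take0 add0n part_pos.
by have := sumn_take_mono la r0; lia.
Qed.

End Removable.

Section Products.
Variables (K : fieldType) (q : K) (A : algType K) (T : nat -> A) (la : seq nat).
Local Notation B r := (sumn (take r la)).
Variable be : nat -> K.

Definition steps a b : A := \prod_(a <= p < b) (T p + (be p)%:A).

Lemma steps_cat a b c : (a <= b <= c)%N -> steps a b * steps b c = steps a c.
Proof. by move=> /andP[ab bc]; rewrite /steps (big_cat_nat ab bc). Qed.

Lemma steps_gen a b m : (0 < a)%N -> (b <= m)%N -> gen T m (steps a b).
Proof.
move=> a0 bm; apply: gen_prod => p; rewrite mem_index_iota => Hp _.
by apply: gen_add; [apply: gen_T; lia|apply: gen_cst].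
Qed.

Hypothesis Pla : is_part la.

Lemma Rrow_gen r m : (1 < r)%N -> (0 < size la)%N -> (B r <= m.+1)%N -> gen T m (Rrow T la r).
Proof.
move=> r1 s0 Hm; apply: gen_sum => e; rewrite mem_index_iota => He _.
by apply: Tij_gen; [apply: sumn_take_gt0 => //; lia|lia].
Qed.

Lemma phi_gen kj cj l' i : (0 < kj)%N -> (0 < cj)%N -> (0 < l')%N -> (0 < i)%N ->
  (0 < size la)%N -> (forall i', (0 < i' <= i)%N -> B (kj + i') = cj + i' * l')%N ->
  gen T (cj + i * l').-1 (phi q T la kj cj l' i).
Proof.
move=> kj0 cj0 l0 + s0; elim: i => // -[|i] IH _ HB.
  by rewrite [phi _ _ _ _ _ _ _]/= ; apply: Rrow_gen => //; rewrite -addn1 HB //; lia.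
rewrite [phi _ _ _ _ _ _ _]/= -/(phi q T la kj cj l' i.+1).
have {}IH := IH isT (fun i' Hi' => HB i' ltac:(lia)).
apply: gen_mul; last by apply: Rrow_gen => //; [lia|rewrite HB //; lia].
apply: gen_sub; first by apply: Tij_gen; nia.
by apply: gen_scale; apply: gen_le IH; nia.
Qed.

End Products.

Section HeckePnode.
Variables (K : fieldType) (q : K).
Hypothesis qinj : forall s1 s2 : seq nat,
  \sum_(i <- s1) q ^+ i = \sum_(i <- s2) q ^+ i -> perm_eq s1 s2.
Let q0 := q_neq0 qinj.
Variables (A : algType K) (T : nat -> A) (n : nat).
Hypothesis HT : hecke_rels q T n.
Variable la : seq nat.
Hypothesis Hla : part_of n la.
Let Pla : is_part la. Proof. by case/andP: Hla. Qed.
Let Sla : sumn la = n. Proof. by case/andP: Hla => _ /eqP. Qed.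

Local Notation x := (xla T n la).
Local Notation B r := (sumn (take r la)).
Local Notation "u =N v" := (eqN T n la u v) (at level 70).
Variable be : nat -> K.
Local Notation steps := (steps T be).

Lemma steps_row y a b : (0 < a < b)%N -> (b <= n)%N ->
  (forall s, (a < s < b)%N -> y * T s = q *: y) ->
  (forall p, (a <= p)%N -> (p.+1 < b)%N -> q * be p + be p * be p.+1 = be p.+1) ->
  y * steps a b = y * (Tij T a b + be b.-1 *: \sum_(a <= e < b) Tij T a e).
Proof.
move=> /andP[a0 ab] bn Hy Hb.
elim: b ab bn Hy Hb => // b IH ab bn Hy Hb.
rewrite /steps big_nat_recr /= -/(steps a b); last by lia.
have [E|ne] := eqVneq a b.
  by rewrite -E /steps big_geq // mul1r Tij_recr // Tij_id mul1r big_nat1 Tij_id.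
rewrite mulrA IH; [|lia|lia|by move=> s Hs; apply: Hy; lia|by move=> p Hp1 Hp2; apply: Hb; lia].
have Hbb : b = b.-1.+1 by lia.
rewrite mulrDr mulr_algr Tij_recr; last by lia.
rewrite big_nat_recr /=; last by lia.
set S := \sum_(_ <= _ < _) _; have ST : y * S * T b = q *: (y * S).
  rewrite /S mulr_sumr mulr_suml scaler_sumr; apply: eq_big_nat => e He.
  rewrite -mulrA -(Tij_far HT); try lia.
  by rewrite mulrA Hy ?scalerAl //; lia.
have R := Hb b.-1 ltac:(lia) ltac:(lia); rewrite -Hbb in R.
rewrite !mulrDr !mulrDl -!scalerAr -!scalerAl ST mulrA mulrDr scalerDr.
rewrite [in RHS]scalerDr !scalerA -!addrA; congr (_ + _).
rewrite addrCA [RHS]addrC; congr (_ + _).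
by rewrite -scalerDl -[in RHS]R [be b.-1 * q]mulrC [be b * _]mulrC.
Qed.

(* Rows [kj + 1 .. kj + h] have the same length, so consecutive ones are tied
   together by Garnir relations. *)
Lemma steps_block g kj l' h : (0 < kj)%N -> (0 < h)%N -> (kj + h <= size la)%N ->
  gen T (B kj) g ->
  (forall r, (kj <= r < kj + h)%N -> nth 0%N la r = l') ->
  (forall r p, (kj <= r < kj + h)%N -> (B r <= p)%N -> (p.+1 < B r.+1)%N ->
     q * be p + be p * be p.+1 = be p.+1) ->
  (forall r, (kj <= r)%N -> (r.+1 < kj + h)%N ->
     be (B r.+1).-1 * be (B r.+2).-1 - be (B r.+1).-1 = - (q * be (B r.+2).-1)) ->
  x * g * steps (B kj) (B (kj + h)) =N
  x * g * (Tij T (B kj) (B (kj + h)) + be (B (kj + h)).-1 *: phi q T la kj (B kj) l' h).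
Proof.
move=> kj0 h0 Hsz Gg Hrow Hb1 Hb2; set c := B kj.
have l0 : (0 < l')%N by rewrite -(Hrow kj) ?part_pos //; lia.
have c0 : (0 < c)%N by apply: sumn_take_gt0 => //; lia.
have s0 : (0 < size la)%N by lia.
have HB i : (i <= h)%N -> B (kj + i) = (c + i * l')%N.
  elim: i => [|i IH] Hi; first by rewrite addn0 mul0n addn0.
  by rewrite addnS sumn_takeS IH ?Hrow; try lia; rewrite mulSn; lia.
have Bn' r : (B r <= n)%N by rewrite -Sla sumn_take_le.
have comm (g' : A) m s : gen T m g' -> (m < s)%N -> (0 < s < n)%N -> g' * T s = T s * g'.
  move=> Gg' ms Hs; symmetry; apply: (gen_comm (T := T) (m := m)) => // i Hi.
  by apply: (T_far HT); lia.
have row_eig g' r : gen T (B r) g' -> (r < size la)%N ->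
    forall s, (B r < s < B r.+1)%N -> x * g' * T s = q *: (x * g').
  move=> Gg' Hr s Hs; have := Bn' r.+1 => Hn.
  rewrite -mulrA (comm _ (B r)) //; try lia.
  by rewrite mulrA (xlaR HT) ?scalerAl //; [lia|apply: inner_between Hs].
have HBS i : (i < h)%N -> (B (kj + i) < B (kj + i).+1)%N.
  by move=> Hi; rewrite sumn_takeS -[X in (X < _)%N]addn0 ltn_add2l Hrow //; lia.
elim: h h0 Hsz Hrow Hb1 Hb2 HB HBS => // -[|i] IH _ Hsz Hrow Hb1 Hb2 HB HBS.
  rewrite addn1 -/c; have -> : phi q T la kj c l' 1 = \sum_(c <= e < B kj.+1) Tij T c e by [].
  have := HBS 0%N isT; rewrite addn0 => HBS0.
  rewrite steps_row; first exact: eqN_refl.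
  - by rewrite c0.
  - exact: Bn'.
  - by apply: row_eig => //; lia.
  - by move=> p H1 H2; apply: (Hb1 kj) => //; lia.
have {}IH := IH isT ltac:(lia) (fun r Hr => Hrow r ltac:(lia)) (fun r p Hr => Hb1 r p ltac:(lia))
   (fun r H1 H2 => Hb2 r H1 ltac:(lia)) (fun j Hj => HB j ltac:(lia)) (fun j Hj => HBS j ltac:(lia)).
have Bl : (B (kj + i.+1) < B (kj + i.+1).+1)%N by apply: HBS.
have cB : (c <= B (kj + i.+1))%N by rewrite HB //; lia.
have Gst m a b : (0 < a)%N -> (b <= m)%N -> gen T m (steps a b) by apply: steps_gen.
rewrite addnS -(@steps_cat _ _ T be c (B (kj + i.+1))); last by lia.
rewrite mulrA; apply: eqN_trans (eqN_mulr HT IH (Gst _ _ _ _ _)) _; [lia|exact: Bn'|].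
have Gphi : gen T (B (kj + i.+1)).-1 (phi q T la kj c l' i.+1).
  rewrite HB //; apply: phi_gen => // i' Hi'; apply: HB; lia.
have Gphi' : gen T (B (kj + i.+1)) (phi q T la kj c l' i.+1) by apply: gen_le Gphi; lia.
set f := phi _ _ _ _ _ _ i.+1 in IH Gphi Gphi' *; set b := B (kj + i.+1) in IH Gphi Gphi' Bl cB *.
set b2 := B (kj + i.+1).+1 in Bl *; have b2n : (b2 <= n)%N by apply: Bn'.
have Eb : b = (c + i.+1 * l')%N by apply: HB.
rewrite mulSn in Eb.
pose R := \sum_(b <= e < b2) Tij T b e.
have garn : x * g * f * (Tij T b b2 + R) =N 0.
  have -> : Tij T b b2 + R = \sum_(b <= e < b2.+1) Tij T b e.
    by rewrite big_nat_recr /=; [exact: addrC|lia].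
  have Gfb : gen T b.-1 (g * f) by apply: gen_mul => //; apply: gen_le Gg; rewrite -/c; lia.
  have -> : x * g * f * \sum_(b <= e < b2.+1) Tij T b e = x * (\sum_(b <= e < b2.+1) Tij T b e) * (g * f).
    rewrite -!mulrA; congr (_ * _); rewrite mulrA !mulr_sumr !mulr_suml; apply: eq_big_nat => e He.
    apply: prod_comm => j; rewrite mem_index_iota => Hj.
    by apply: (comm _ b.-1) => //; lia.
  apply/eqN0; apply: (Nbar_mulr HT); last by apply: gen_le Gfb; lia.
  have := @garnir _ _ _ _ _ HT q0 (@poinc_neq0 _ _ qinj n) la Hla (kj + i)%N.
  by rewrite -addnS !Hrow //; [apply|lia|lia].
rewrite -(mulrA x g) steps_row; last first.
- by move=> p H1 H2; apply: (Hb1 (kj + i.+1)%N) => //; lia.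
- apply: row_eig; last by lia.
  apply: gen_mul; first by apply: gen_le Gg.
  by apply: gen_add; [apply: Tij_gen; lia|apply: gen_scale].
- exact: b2n.
- lia.
rewrite -/R; set bb := be b.-1; set bb2 := be b2.-1.
have -> : phi q T la kj c l' i.+2 = (Tij T c b - q *: f) * R.
  have -> : phi q T la kj c l' i.+2 =
    (Tij T c (c + i.+1 * l') - q *: f) * Rrow T la (kj + i.+2) by [].
  by rewrite -HB // /Rrow /R /b2 /b !addnS.
have Hbb : bb * bb2 - bb = - (q * bb2) 
  by rewrite /bb /bb2 /b2 /b !addnS; apply: Hb2; lia.
rewrite (mulrA x g) -(addr0 (x * g * (_ + _ *: (_ * R)))).
have -> : x * g * (Tij T c b + bb *: f) * (Tij T b b2 + bb2 *: R) =
   x * g * (Tij T c b2 + bb2 *: ((Tij T c b - q *: f) * R)) + bb *: (x * g * f * (Tij T b b2 + R)).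
  rewrite -(@Tij_cat _ _ T c b b2); last by lia.
  move: (x * g) (Tij T c b) (Tij T b b2) => y t t'.
  rewrite (mulrDr y t) -(scalerAr bb y f) [in RHS](mulrDr y) -(scalerAr bb2 y).
  rewrite (mulrA y (t - _)) (mulrBr y) -(scalerAr q y f) (mulrA y t t').
  move: (y * t) (y * f) => a f'.
  rewrite mulrDl !mulrDr -!scalerAl -!scalerAr mulrBl -scalerAl scalerBr !scalerDr !scalerA -!addrA.
  congr (_ + (_ + _)); rewrite addrCA; congr (_ + _).
  have -> : bb * bb2 = bb - bb2 * q by rewrite -(mulrC q) -[q * bb2]opprK -Hbb; ring.
  by rewrite scalerBl addrC.
apply: eqN_add; first exact: eqN_refl.
by rewrite -(scaler0 A bb); apply: eqN_scale.
Qed.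

End HeckePnode.

Section NodeOf.
Implicit Types (la : seq nat).

Lemma uniq_map_eq (I J : eqType) (f : I -> J) (s : seq I) a b :
  uniq (map f s) -> a \in s -> b \in s -> f a = f b -> a = b.
Proof.
elim: s => //= c s IH /andP[Hc U]; rewrite !inE => /orP[/eqP->|Ha] /orP[/eqP->|Hb] // E.
- by case/negP: Hc; rewrite E; apply: map_f.
- by case/negP: Hc; rewrite -E; apply: map_f.
- exact: IH.
Qed.

Lemma nodeofE la (t : nat -> nat -> nat) y :
  uniq [seq t y.1 y.2 | y <- nodes la] -> y \in nodes la -> nodeof la t (t y.1 y.2) = y.
Proof.
move=> U Hy; rewrite /nodeof.
have -> : [seq y0 <- nodes la | t y0.1 y0.2 == t y.1 y.2] = [seq y0 <- nodes la | pred1 y y0].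
  apply: eq_in_filter => z Hz /=; apply/eqP/eqP => [E|->//].
  exact: (uniq_map_eq U Hz Hy E).
by rewrite filter_pred1_uniq // nodes_uniq.
Qed.

Lemma nodeof_tla la r c : (0 < r)%N -> (0 < c <= Defs.row la r)%N ->
  nodeof la (tla la) (tla la r c) = (r, c).
Proof.
move=> r0 Hc; apply: (@nodeofE la (tla la) (r, c)); first by rewrite tla_nodes iota_uniq.
by rewrite mem_nodes r0.
Qed.

Lemma position_row la p : (p < sumn la)%N ->
  exists r c, (c < nth 0%N la r)%N /\ p = (sumn (take r la) + c)%N.
Proof.
move=> Hp; have : p.+1 \in [seq tla la y.1 y.2 | y <- nodes la].
  by rewrite tla_nodes mem_iota; lia.
case/mapP=> -[r c]; rewrite mem_nodes /= => Hy E.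
case: r c Hy E => // r [|c] Hy E; first by lia.
exists r, c; split; first by rewrite -rowS; lia.
by move: E; rewrite /tla /=; lia.
Qed.

End NodeOf.

Section HeckePnode.
Variables (K : fieldType) (q : K).
Hypothesis qinj : forall s1 s2 : seq nat,
  \sum_(i <- s1) q ^+ i = \sum_(i <- s2) q ^+ i -> perm_eq s1 s2.
Let q0 := q_neq0 qinj.
Variables (A : algType K) (T : nat -> A) (n : nat).
Hypothesis HT : hecke_rels q T n.
Variable la : seq nat.
Hypothesis Hla : part_of n la.
Let Pla : is_part la. Proof. by case/andP: Hla. Qed.
Let Sla : sumn la = n. Proof. by case/andP: Hla => _ /eqP. Qed.

Local Notation x := (xla T n la).
Local Notation B r := (sumn (take r la)).
Local Notation "u =N v" := (eqN T n la u v) (at level 70).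

Definition kap p : K := qcontent q (nodeof la (tla la) p.+1).

Lemma kapE r c : (c < nth 0%N la r)%N -> kap (B r + c) = q^-1 ^+ r * q ^+ c.
Proof.
move=> Hc; rewrite /kap -addnS -[(B r + _)%N]/(tla la r.+1 c.+1) nodeof_tla //.
by rewrite /qcontent /= !exprS mulrACA mulVf // mul1r.
Qed.

Lemma kap_eig p : (p < n)%N -> x * JM q T p =N kap p *: x.
Proof.
rewrite -[X in (_ < X)%N]Sla => /position_row[r [c [Hc ->]]]; rewrite kapE //.
exact: (xla_JM HT q0 (@poinc_neq0 _ _ qinj n) Hla).
Qed.

Variables (k l : nat).
Hypothesis Hkl : removable la (k, l).

Let k0 : (0 < k)%N. Proof. by move: Hkl; rewrite removableE // => /and3P[]. Qed.
Let El : l = Defs.row la k. Proof. by move: Hkl; rewrite removableE // => /and3P[_ /eqP]. Qed.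
Let lk : (Defs.row la k.+1 < l)%N. Proof. by move: Hkl; rewrite removableE // => /and3P[]. Qed.

Let Bk : B k = (B k.-1 + l)%N.
Proof. by rewrite El /Defs.row -sumn_takeS prednK. Qed.

Lemma kap0 : kap (B k).-1 = q^-1 ^+ k * q ^+ l.
Proof.
have -> : (B k).-1 = (B k.-1 + l.-1)%N by rewrite Bk; lia.
rewrite kapE -/(Defs.row la k) -?El; last by lia.
rewrite -[in RHS](prednK k0) -[in RHS](prednK (n := l)); last by lia.
by rewrite !exprS mulrACA mulVf // mul1r.
Qed.

(* [s] is the radial distance from the node [(r.+1, c.+1)] to [(k, l)]. *)
Lemma kap_ratio r c : (k <= r)%N -> (c < nth 0%N la r)%N ->
  exists s, [/\ (s.+1 = l + r - c - k)%N & kap (B k).-1 = q ^+ s.+1 * kap (B r + c)].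
Proof.
move=> kr Hc; have Hl : (nth 0%N la r < l)%N.
  by apply: leq_ltn_trans lk; rewrite rowS part_nth.
exists (l + r - c - k).-1; split; first lia.
rewrite kap0 kapE // prednK; last lia.
have -> : (l + r - c - k = (l - c) + (r - k))%N by lia.
have {1}-> : l = (l - c + c)%N by lia.
rewrite -[in RHS](subnK kr) [q^-1 ^+ (r - k + k)]exprD !exprD subnK // !exprVn.
by field; rewrite !expf_neq0.
Qed.

Lemma kap_neq p : ((B k).-1 < p < n)%N -> kap p != kap (B k).-1.
Proof.
move=> /andP[kp]; rewrite -Sla => /position_row[r [c [Hc Ep]]]; rewrite Ep.
have kr : (k <= r)%N.
  rewrite leqNgt; apply/negP => rk.
  by have := @sumn_take_mono la r.+1 k rk; rewrite sumn_takeS; lia.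
have [s [_ ->]] := kap_ratio kr Hc; apply/eqP => E.
have K0 : kap (B r + c) != 0 by rewrite kapE // mulf_neq0 // expf_neq0 // invr_neq0.
have /eqP := qX_neq1 qinj s; apply; apply: (mulIf K0).
by rewrite mul1r -E.
Qed.

Local Notation be := (beta q kap (B k).-1).

Lemma beta_rat K0 s : K0 != 0 -> forall p, kap p = K0 -> kap (B k).-1 = q ^+ s.+1 * K0 ->
  be p = (q - 1) / (q ^+ s.+1 - 1).
Proof.
move=> KN p E1 E2; rewrite /beta E1 E2.
have D : q ^+ s.+1 - 1 != 0 by rewrite subr_eq0 qX_neq1.
have -> : q ^+ s.+1 * K0 - K0 = (q ^+ s.+1 - 1) * K0 by ring.
by field; rewrite D KN.
Qed.

Lemma beta_row r p : (k <= r)%N -> (B r <= p)%N -> (p.+1 < B r.+1)%N ->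
  q * be p + be p * be p.+1 = be p.+1.
Proof.
rewrite sumn_takeS => kr H1 H2; have [c Ep] : exists c, p = (B r + c)%N by exists (p - B r)%N; lia.
have Hc : (c.+1 < nth 0%N la r)%N by lia.
have [s [_ E1]] := kap_ratio kr Hc.
have K1 := @kapE r c.+1 Hc; have K0 := @kapE r c (ltnW Hc).
have N1 : q^-1 ^+ r * q ^+ c.+1 != 0 by rewrite mulf_neq0 ?expf_neq0 ?invr_neq0.
have N0 : q^-1 ^+ r * q ^+ c != 0 by rewrite mulf_neq0 ?expf_neq0 ?invr_neq0.
rewrite Ep -addnS (beta_rat N1 K1 (s := s)); last by rewrite -K1.
rewrite (beta_rat N0 K0 (s := s.+1)); last by rewrite E1 K1 !exprS; ring.
have D1 : q ^+ s.+1 - 1 != 0 by rewrite subr_eq0 qX_neq1.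
have D2 : q ^+ s.+2 - 1 != 0 by rewrite subr_eq0 qX_neq1.
move: D1 D2; rewrite (exprS q s.+1) => D1 D2; field.
by rewrite D1 D2.
Qed.

Lemma beta_ends r : (k <= r)%N -> (0 < nth 0%N la r)%N -> nth 0%N la r = nth 0%N la r.+1 ->
  be (B r.+1).-1 * be (B r.+2).-1 - be (B r.+1).-1 = - (q * be (B r.+2).-1).
Proof.
move=> kr l0 E.
have Hc : ((nth 0 la r).-1 < nth 0 la r)%N by lia.
have Hc' : ((nth 0 la r).-1 < nth 0 la r.+1)%N by lia.
have -> : (B r.+1).-1 = (B r + (nth 0 la r).-1)%N by rewrite sumn_takeS; lia.
have -> : (B r.+2).-1 = (B r.+1 + (nth 0 la r).-1)%N by rewrite (sumn_takeS _ r.+1); lia.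
move: (_.-1) Hc Hc' => c Hc Hc'.
have [s [_ E1]] := kap_ratio kr Hc.
have K0 := kapE Hc; have K1 := kapE Hc'.
have N0 : q^-1 ^+ r * q ^+ c != 0 by rewrite mulf_neq0 ?expf_neq0 ?invr_neq0.
have N1 : q^-1 ^+ r.+1 * q ^+ c != 0 by rewrite mulf_neq0 ?expf_neq0 ?invr_neq0.
rewrite (beta_rat N0 K0 (s := s)); last by rewrite -K0.
rewrite (beta_rat N1 K1 (s := s.+1)); last first.
  by rewrite E1 K0 !exprS; field.
have D1 : q ^+ s.+1 - 1 != 0 by rewrite subr_eq0 qX_neq1.
have D2 : q ^+ s.+2 - 1 != 0 by rewrite subr_eq0 qX_neq1.
move: D1 D2; rewrite (exprS q s.+1) => D1 D2; field.
by rewrite D1 D2.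
Qed.

Lemma beta_qint r : (k < r)%N -> (0 < Defs.row la r)%N ->
  (qint q (Defs.rad r (Defs.row la r) k l))^-1 = be (B r).-1.
Proof.
case: r => // r kr; rewrite rowS => l0.
have Hc : ((nth 0 la r).-1 < nth 0 la r)%N by lia.
have [s [Es E1]] := kap_ratio kr Hc.
have K0 := kapE Hc.
have N0 : q^-1 ^+ r * q ^+ (nth 0%N la r).-1 != 0 by rewrite mulf_neq0 ?expf_neq0 ?invr_neq0.
have -> : (B r.+1).-1 = (B r + (nth 0 la r).-1)%N by rewrite sumn_takeS; lia.
rewrite (beta_rat N0 K0 (s := s)); last by rewrite -K0.
have -> : Defs.rad r.+1 (nth 0%N la r) k l = s.+1%:Z by rewrite /Defs.rad; lia.
by rewrite /qint invf_div.
Qed.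

Definition Pfactor (a b : nat * nat) : A :=
  Tij T (tla la a.1 a.2) (tla la b.1 b.2) +
  (qint q (Defs.rad b.1 b.2 k l))^-1 *: phi q T la a.1 (tla la a.1 a.2) b.2 (b.1 - a.1).

Lemma Pnode_path : Pnode q T la (k, l) = path_prod Pfactor (k, l)
  [seq (r, Defs.row la r) | r <- iota k.+1 (size la - k) & (Defs.row la r.+1 < Defs.row la r)%N].
Proof.
rewrite /Pnode -removable_below // -(path_prodE _ (0%N, 0%N)) /=.
apply: eq_bigr => j _; rewrite /Pfactor.
by case: (nth _ (_ :: _) j) => a b; case: (nth _ _ _) => c d.
Qed.

Lemma tla_end r : (0 < r)%N -> tla la r (Defs.row la r) = B r.
Proof. by case: r => // r _; rewrite /tla rowS /= -sumn_takeS. Qed.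

Lemma Pfactor_gen r r' : (0 < r)%N -> (r < r')%N -> (r' <= size la)%N ->
  gen T n (Pfactor (r, Defs.row la r) (r', Defs.row la r')).
Proof.
move=> r0 rr rs; rewrite /Pfactor /= !tla_end //; last by lia.
have Bn r1 : (B r1 <= n)%N by rewrite -Sla sumn_take_le.
have Bp r1 : (0 < r1)%N -> (0 < B r1)%N by move=> H; apply: sumn_take_gt0 => //; lia.
have GR i : gen T n (Rrow T la (r + i.+1)).
  by apply: Rrow_gen; [exact: Pla|lia|lia|have := Bn (r + i.+1)%N; lia].
have lr : (0 < Defs.row la r')%N by rewrite /Defs.row part_pos //; lia.
apply: gen_add; first by apply: Tij_gen; [apply: Bp|apply: Bn].
apply: gen_scale.
suff : forall i, (i <= r' - r)%N -> gen T n (phi q T la r (B r) (Defs.row la r') i) by apply.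
have HB i : (i <= r' - r)%N -> (B r + i * Defs.row la r' <= B (r + i))%N.
  elim: i => [|i IH] Hi; first by rewrite addn0 mul0n addn0.
  rewrite addnS sumn_takeS mulSn addnCA addnC leq_add //; first by apply: IH; lia.
  by rewrite -rowS; apply: row_mono => //; lia.
elim=> [|i IH] Hi; first exact: gen_one.
case: i IH Hi => [|i] IH Hi.
  by rewrite [phi _ _ _ _ _ _ _]/= -addn1; apply: GR.
have -> : phi q T la r (B r) (Defs.row la r') i.+2 =
  (Tij T (B r) (B r + i.+1 * Defs.row la r') - q *: phi q T la r (B r) (Defs.row la r') i.+1)
    * Rrow T la (r + i.+2) by [].
apply: gen_mul; last exact: GR.
apply: gen_sub; last by apply: gen_scale; apply: IH; lia.
apply: Tij_gen; first exact: Bp.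
by apply: leq_trans (Bn (r + i.+1)%N); apply: HB; lia.
Qed.

Lemma path_gen r s : (0 < r)%N -> path ltn r s -> all (fun r' => r' <= size la)%N s ->
  gen T n (path_prod Pfactor (r, Defs.row la r) [seq (r', Defs.row la r') | r' <- s]).
Proof.
elim: s r => [|r' s IH] r r0 /=; first by move=> _ _; apply: gen_one.
move=> /andP[rr Hp] /andP[Hr' Hs]; apply: gen_mul; first exact: Pfactor_gen.
by apply: IH => //; lia.
Qed.

Lemma Pnode_gen : gen T n (Pnode q T la (k, l)).
Proof.
rewrite Pnode_path El; apply: path_gen => //.
  by apply: path_filter; [exact: ltn_trans|exact: (iota_ltn_sorted k (size la - k).+1)].
by apply/allP => r; rewrite mem_filter mem_iota => /andP[_]; lia.
Qed.

Lemma Pnode_steps : x * Pnode q T la (k, l) =N x * steps T be (B k) n.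
Proof.
have main m r1 r2 g : (k <= r1)%N -> (r1 <= r2)%N -> (r2 + m = size la)%N ->
    (forall r, (r1 < r <= r2)%N -> Defs.row la r.+1 = Defs.row la r) -> gen T (B r1) g ->
    x * g * path_prod Pfactor (r1, Defs.row la r1)
      [seq (r, Defs.row la r) | r <- iota r2.+1 m & (Defs.row la r.+1 < Defs.row la r)%N] =N
    x * g * steps T be (B r1) n.
  elim: m r1 r2 g => [|m IH] r1 r2 g kr1 r12 Hm Hrow Gg.
    have E : r1 = size la.
      apply/eqP; rewrite eqn_leq; apply/andP; split; first by lia.
      rewrite leqNgt; apply/negP => lt.
      have C d : (d < size la - r1)%N -> Defs.row la (r1 + d.+2) = Defs.row la r1.+1.
        elim: d => [|d IHd] Hd; first by rewrite addn2 Hrow //; lia.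
        rewrite -IHd; last by lia.
        by rewrite addnS; apply: Hrow; lia.
      have := C (size la - r1).-1 ltac:(lia); rewrite {1}/Defs.row nth_default; last by lia.
      by move/esym/eqP; rewrite -leqn0 leqNgt rowS part_pos // lt.
    rewrite /= mulr1 E take_size Sla /steps big_geq // mulr1; exact: eqN_refl.
  rewrite [iota _ _]/= [filter _ _]/=; case: ifP => Hrem; last first.
    apply: IH => //; try lia.
    move=> r Hr; have [E|ne] := eqVneq r r2.+1; last by apply: Hrow; lia.
    have := @row_mono la r r.+1 Pla ltac:(lia) ltac:(lia).
    by move: Hrem; rewrite E; lia.
  have lr : (0 < Defs.row la r2.+1)%N by lia.
  have Erow r : (r1 <= r < r2.+1)%N -> nth 0%N la r = Defs.row la r2.+1.
    move=> Hr; have [d Ed] : exists d, (r + d = r2)%N by exists (r2 - r)%N; lia.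
    elim: d r Ed Hr => [|d IHd] r Ed Hr; first by rewrite -Ed addn0.
    rewrite -(IHd r.+1); try lia.
    by rewrite -!rowS (Hrow r.+1) //; lia.
  rewrite [path_prod _ _ _]/= mulrA.
  have Bn r : (B r <= n)%N by rewrite -Sla sumn_take_le.
  have Bp r : (0 < r)%N -> (0 < B r)%N by move=> H; apply: sumn_take_gt0 => //; lia.
  have Bm : (B r1 <= B r2.+1)%N by apply: sumn_take_mono; lia.
  have E1 : x * g * Pfactor (r1, Defs.row la r1) (r2.+1, Defs.row la r2.+1) =N
            x * g * steps T be (B r1) (B r2.+1).
    have := @steps_block _ _ qinj _ _ _ HT _ Hla be g r1 (Defs.row la r2.+1) (r2.+1 - r1).
    have -> : (r1 + (r2.+1 - r1) = r2.+1)%N by lia.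
    move=> H; apply: eqN_sym.
    rewrite /Pfactor /= !tla_end //; last by lia.
    rewrite beta_qint; [|lia|done].
    apply: H => //; try lia.
    - by move=> r p Hr; apply: beta_row; lia.
    - by move=> r H1 H2; apply: beta_ends; rewrite ?Erow //; lia.
  set s := [seq r <- iota r2.+2 m | _].
  have Gs : gen T n (path_prod Pfactor (r2.+1, Defs.row la r2.+1) [seq (r, Defs.row la r) | r <- s]).
    apply: path_gen => //.
      by apply: path_filter; [exact: ltn_trans|exact: (iota_ltn_sorted r2.+1 m.+1)].
    by apply/allP => r; rewrite mem_filter mem_iota => /andP[_]; lia.
  apply: eqN_trans (eqN_mulr HT E1 Gs) _.
  rewrite -(@steps_cat _ _ T be (B r1) (B r2.+1) n); last by rewrite Bm Bn.
  rewrite mulrA -(mulrA x g); apply: IH => //; try lia.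
  apply: gen_mul; first by apply: gen_le Gg.
  by apply: steps_gen => //; apply: Bp; lia.
have := main (size la - k)%N k k 1 (leqnn k) (leqnn k).
rewrite Pnode_path El mulr1; apply.
- have := part_pos k.-1 Pla; rewrite -/(Defs.row la k) -El; lia.
- by move=> r; lia.
- exact: gen_one.
Qed.

End HeckePnode.

(** * Branching *)

Section Generic.
Variables (K : fieldType) (q : K).
Hypothesis qinj : forall s1 s2 : seq nat,
  \sum_(i <- s1) q ^+ i = \sum_(i <- s2) q ^+ i -> perm_eq s1 s2.
Let q0 := q_neq0 qinj.
Variables (A : algType K) (T : nat -> A).

Lemma q1_neq0 : q - 1 != 0.
Proof. by rewrite subr_eq0; have := qX_neq1 qinj 0; rewrite expr1. Qed.

Lemma tpE n i j (x : 'I_n) : (i < n)%N -> (j < n)%N ->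
  tp n i j x = (if x == i :> nat then j else if x == j :> nat then i else x) :> nat.
Proof.
move=> Hi Hj; rewrite /tp !insubT /= permE /= -!val_eqE /=.
by case: eqP => // _; case: eqP.
Qed.

Lemma Tw_tp_next n i p : hecke_rels q T n -> (i < p)%N -> (p.+1 < n)%N ->
  Tw T (tp n i p.+1) = T p.+1 * Tw T (tp n i p) * T p.+1.
Proof.
move=> HT ip pn; have Hp : (0 < p.+1 < n)%N by [].
have Hi : (i < n)%N by lia.
have Hpn : (p < n)%N by lia.
have -> : tp n i p.+1 = (sgen n p.+1 * (tp n i p * sgen n p.+1))%g.
  apply/permP => x; apply: val_inj; rewrite /= !permM.
  by rewrite !(sgenE _ Hp, tpE _ Hi Hpn, tpE _ Hi pn); split_ifs; lia.
rewrite (Tw_lasc HT) //; last first.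
  by move=> a b Ea Eb; rewrite !permM !(sgenE _ Hp, tpE _ Hi Hpn); split_ifs; lia.
rewrite (Tw_asc HT) ?mulrA // => a b; rewrite !(tpE _ Hi Hpn); split_ifs; lia.
Qed.

Lemma LpS n p : hecke_rels q T n -> (p.+2 <= n)%N ->
  Lp q T n p.+2 = q^-1 *: (T p.+1 + T p.+1 * Lp q T n p.+1 * T p.+1).
Proof.
move=> HT pn; have Hp : (0 < p.+1 < n)%N by [].
rewrite /Lp big_ltn // expr1 subn1 /= scalerDr; congr (_ + _).
  congr (_ *: _); have -> : tp n p p.+1 = (1 * sgen n p.+1)%g by rewrite mul1g.
  by rewrite (Tw_asc HT) ?Tw1 ?mul1r // => a b; rewrite !perm1; lia.
rewrite mulr_sumr mulr_suml scaler_sumr -[in LHS](addn1 1) big_addn.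
have -> : (p.+2 - 1 = p.+1)%N by lia.
apply: eq_big_nat => i Hi; rewrite -scalerAr -scalerAl scalerA addn1 exprS; congr (_ *: _).
have -> : ((p.+2 - i.+1).-1 = (p.+1 - i).-1)%N by lia.
by rewrite Tw_tp_next //; lia.
Qed.

Lemma Lp_JM n p : hecke_rels q T n -> (p < n)%N ->
  Lp q T n p.+1 = (q - 1)^-1 *: (JM q T p - 1).
Proof.
move=> HT; have q1 := q1_neq0.
elim: p => [|p IH] pn; first by rewrite JM0 subrr scaler0 /Lp big_geq.
have EY : JM q T p = 1 + (q - 1) *: Lp q T n p.+1.
  rewrite IH; last by lia.
  by rewrite scalerA divff // scale1r addrC subrK.
rewrite LpS // JMS EY mulrDr mulr1 mulrDl (T_sqr HT); last by lia.
rewrite -scalerAr -scalerAl; set Z := T _ * _ * _.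
have -> : (q - 1) *: T p.+1 + q%:A + (q - 1) *: Z = (q - 1) *: (T p.+1 + Z) + q%:A.
  by rewrite scalerDr addrAC.
rewrite [q^-1 *: (_ + q%:A)]scalerDr [q^-1 *: q%:A]scalerA mulVf //.
by rewrite scale1r addrK !scalerA; congr (_ *: _); field; rewrite q1 q0.
Qed.

Section Level.
Variable m : nat.
Hypothesis HT : hecke_rels q T m.+1.
Variable la : seq nat.
Hypothesis Hla : part_of m.+1 la.
Variables (k l : nat).
Hypothesis Hkl : removable la (k, l).

Local Notation n := m.+1.
Local Notation x := (xla T n la).
Local Notation J := (JM q T m).
Local Notation B r := (sumn (take r la)).
Local Notation "u =N v" := (eqN T n la u v) (at level 70).

Let Pla : is_part la. Proof. by case/andP: Hla. Qed.
Let Sla : sumn la = n. Proof. by case/andP: Hla => _ /eqP. Qed.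

Variable R : seq K.
Hypothesis HR : forall y, y \in nodes la -> res q y \in R.

Definition Efac : A :=
  \prod_(c <- R | c != res q (k, l)) ((res q (k, l) - c)^-1 *: (Lp q T n n - c%:A)).

Lemma qcontent_res y : qcontent q y = 1 + (q - 1) * res q y.
Proof.
have q1 := q1_neq0.
rewrite /res /qint mulrC divfK // addrC subrK expfzDr // mulrC.
by rewrite /qcontent -exprnN exprVn.
Qed.

Lemma res_eq y y' : (res q y == res q y') = (qcontent q y == qcontent q y').
Proof.
have q1 := q1_neq0; rewrite !qcontent_res; apply/eqP/eqP => [->//|/addrI/(mulfI q1)//].
Qed.

Let rho := qcontent q (k, l).
Let H : {poly K} := \prod_(c <- R | c != res q (k, l)) ('X - (1 + (q - 1) * c)%:P).

Let H_neq0 : H.[rho] != 0.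
Proof.
have q1 := q1_neq0; rewrite horner_prod prodf_seq_neq0; apply/allP => c _; apply/implyP => Hc.
rewrite hornerXsubC /rho qcontent_res opprD addrACA subrr add0r -mulrBr mulf_neq0 //.
by rewrite subr_eq0 eq_sym.
Qed.

Lemma EfacE : Efac = H.[rho]^-1 *: horner_alg J H.
Proof.
have q1 := q1_neq0.
rewrite /Efac /H; elim: R => [|c s IH]; first by rewrite !big_nil hornerC invr1 rmorph1 scale1r.
rewrite !big_cons; case: ifP => // Hc.
rewrite IH Lp_JM //; set h := horner _ rho.
have -> : (q - 1)^-1 *: (J - 1) - c%:A = (q - 1)^-1 *: (J - (1 + (q - 1) * c)%:A).
  by rewrite scalerDl scale1r opprD addrA [in RHS]scalerBr scalerA mulrA mulVf // mul1r.
rewrite hornerM hornerXsubC rmorphM /= rmorphB /= horner_algX horner_algC -/h.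
rewrite scalerA -scalerAl -scalerAr scalerA !invfM; congr (_ *: _); congr (_ * _).
rewrite -invfM; congr (_^-1); rewrite /rho qcontent_res; ring.
Qed.

Lemma horner_eigen u c (p : {poly K}) : u * J =N c *: u -> u * horner_alg J p =N p.[c] *: u.
Proof.
move=> Hu; elim/poly_ind: p => [|p d IH].
  by rewrite rmorph0 mulr0 horner0 scale0r; apply: eqN_refl.
rewrite rmorphD rmorphM /= horner_algX horner_algC hornerMXaddC mulrDr mulr_algr scalerDl.
apply: eqN_add; last exact: eqN_refl.
rewrite mulrA; apply: eqN_trans (eqN_mulr HT IH (JM_gen _ _ _)) _.
by rewrite -scalerAl -scalerA; apply: eqN_scale.
Qed.

Lemma Efac_gen : gen T n Efac.
Proof. by rewrite EfacE; apply: gen_scale; apply: gen_horner; apply: JM_gen. Qed.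

Lemma Efac_comm g : gen T m g -> Efac * g = g * Efac.
Proof.
move=> Gg; rewrite EfacE -scalerAl -scalerAr; congr (_ *: _); symmetry.
apply: comm_horner; symmetry; apply: (gen_comm (T := T) (m := m)) => // i Hi.
by rewrite (JM_comm HT) //; lia.
Qed.

Let El : l = Defs.row la k. Proof. by move: Hkl; rewrite removableE // => /and3P[_ /eqP]. Qed.
Let k0 : (0 < k)%N. Proof. by move: Hkl; rewrite removableE // => /and3P[]. Qed.
Let Bk : B k = (B k.-1 + l)%N.
Proof. by rewrite El /Defs.row -sumn_takeS prednK. Qed.
Let l0 : (0 < l)%N. Proof. by move: Hkl; rewrite removableE // => /and3P[_ _]; lia. Qed.
Let Bn : (B k <= n)%N. Proof. by rewrite -Sla sumn_take_le. Qed.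

(* Since the node [(k, l)] carries [n] in the tableau with lead term [Tij], this
   vector spans the copy of the Specht module of [la] minus [(k, l)]. *)
Definition branch : A := x * Tij T (B k) n * Efac.

Local Notation kp := (kap q la).
Local Notation be := (beta q kp (B k).-1).

Let steps_walk : steps T be (B k) n = walk q T kp (B k).-1 (m - (B k).-1).
Proof.
rewrite /walk /steps; have -> : ((B k).-1 + (m - (B k).-1) = m)%N by lia.
by rewrite -[in LHS](prednK (n := B k)) ?big_add1 //; lia.
Qed.

Let kp_res p : (p < n)%N -> exists2 y, y \in nodes la & kp p = qcontent q y.
Proof.
move=> pn; exists (nodeof la (tla la) p.+1) => //.
have := pn; rewrite -[X in (_ < X)%N]Sla => /position_row[r [c [Hc Ep]]].
rewrite Ep -addnS -[(B r + _)%N]/(tla la r.+1 c.+1) nodeof_tla // mem_nodes /=.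
by rewrite rowS Hc.
Qed.

Lemma kap_rho : kp (B k).-1 = rho.
Proof. by rewrite /rho /qcontent /= -(kap0 qinj Hla Hkl). Qed.

Lemma walk_eigen : x * steps T be (B k) n * J =N rho *: (x * steps T be (B k) n).
Proof.
have := walk_eig qinj HT Hla (kap_eig qinj HT Hla) (kap_neq qinj Hla Hkl) (d := m - (B k).-1).
rewrite steps_walk; have -> : ((B k).-1 + (m - (B k).-1) = m)%N by lia.
by rewrite kap_rho; apply.
Qed.

Lemma walk_Efac : x * steps T be (B k) n * Efac =N x * steps T be (B k) n.
Proof.
rewrite EfacE -scalerAr; apply: eqN_trans (eqN_scale _ (horner_eigen H walk_eigen)) _.
by rewrite scalerA mulVf // scale1r; apply: eqN_refl.
Qed.

Lemma branch_walk : branch =N x * steps T be (B k) n.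
Proof.
apply: eqN_trans _ walk_Efac; apply: eqN_sym.
have E0 : (x * steps T be (B k) n - x * Tij T (B k) n) * horner_alg J H =N 0.
  have := walk_lead qinj HT Hla (kap_eig qinj HT Hla) (p0 := (B k).-1) (d := m - (B k).-1).
  rewrite -steps_walk; have -> : ((B k).-1 + (m - (B k).-1) = m)%N by lia.
  rewrite prednK; last by lia.
  move=> /(_ (ltnSn m)); rewrite -mulrBr => HW.
  apply: (kill_squarefree qinj HT Hla (l := [seq kp p.+1 | p <- index_iota (B k).-1 m])).
  - by apply: gen_sub; [apply: steps_gen; lia|apply: Tij_gen; lia].
  - move: HW; rewrite /walk_poly big_map.
    by have -> : ((B k).-1 + (m - (B k).-1) = m)%N by lia.
  move=> c /mapP[p]; rewrite mem_index_iota => Hp ->.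
  have pn : (p.+1 < n)%N by lia.
  have [y Hy Ey] := kp_res pn.
  have ne : qcontent q y != rho.
    by rewrite -Ey -kap_rho; apply: (kap_neq qinj Hla Hkl); lia.
  rewrite /H Ey qcontent_res; have := HR Hy; rewrite -res_eq in ne.
  elim: R => // c' s IH; rewrite in_cons big_cons => /orP[/eqP <-|Hs].
    by rewrite ne rootM root_XsubC eqxx.
  by case: ifP => _; rewrite ?rootM IH ?orbT.
rewrite /eqN -mulrBl EfacE -scalerAr; apply: NbarZ.
by apply/eqN0.
Qed.

Lemma branch_Pnode : branch =N x * Pnode q T la (k, l).
Proof.
apply: eqN_trans branch_walk _; apply: eqN_sym.
exact: (Pnode_steps qinj HT Hla Hkl).
Qed.

Lemma branch_eigen : branch * J =N rho *: branch.
Proof.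
apply: eqN_trans (eqN_mulr HT branch_walk (JM_gen _ _ _)) _.
by apply: eqN_trans walk_eigen _; apply: eqN_scale; apply: eqN_sym; apply: branch_walk.
Qed.

Variable mu : seq nat.
Hypothesis Hmu : part_of m mu.
Hypothesis Bmu : forall r, sumn (take r mu) = (B r - (k <= r))%N.
Hypothesis nodes_mu : perm_eq (nodes la) ((k, l) :: nodes mu).

Lemma branch_inner s : (0 < s < m)%N -> inner mu s -> branch * T s = q *: branch.
Proof.
move=> Hs Hin; have Hin' r : (B r - (k <= r))%N <> s by rewrite -Bmu; apply: Hin.
have GT : gen T m (T s) by apply: gen_T.
rewrite /branch -mulrA (Efac_comm GT) mulrA scalerAl; congr (_ * _).
have mB r1 r2 : (r1 <= r2)%N -> (B r1 <= B r2)%N by apply: sumn_take_mono.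
have Nk := Hin' k; rewrite leqnn subn1 in Nk.
have [lt|ge] := ltnP s (B k).
  rewrite -mulrA -(Tij_far HT) //; try lia.
  rewrite mulrA (xlaR HT) ?scalerAl //; first by lia.
  move=> r E; have := Hin' r; rewrite E; case: leqP => kr /=; last by lia.
  by have := mB _ _ kr; lia.
rewrite -mulrA (Tij_shift HT) //; try lia.
rewrite mulrA (xlaR HT) ?scalerAl //; first by lia.
move=> r E; have := Hin' r; rewrite E; case: leqP => kr /=; first by lia.
by have := mB _ _ (ltnW kr); lia.
Qed.

Lemma qcharge_branch : qcharge q la - rho = qcharge q mu.
Proof. by rewrite /qcharge (perm_big _ nodes_mu) big_cons /= addrAC subrr add0r. Qed.

Lemma branch_Nbar h : gen T m h -> in_Nbar T m mu h -> in_Nbar T n la (branch * h).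
Proof.
move=> Gh Hh; have HTm := hecke_relsS HT.
pose p := weight_poly q m (dom_weight m mu).+1.
have Z0 : h * horner_alg (zJM q T m) p = 0 by apply: (Nbar_weight_poly qinj HTm).
have Gz : gen T n (zJM q T m).
  by apply: gen_sum => i _ _; apply: gen_le (JM_gen _ _ _); have := ltn_ord i; lia.
have Ez : branch * zJM q T m =N qcharge q mu *: branch.
  have -> : zJM q T m = zJM q T n - J by rewrite /zJM big_ord_recr /= addrK.
  rewrite mulrBr -qcharge_branch scalerBl; apply: eqN_sub; last exact: branch_eigen.
  have -> : branch = x * (Tij T (B k) n * Efac) by rewrite /branch mulrA.
  apply: (eig_zJM qinj HT Hla).
  by apply: gen_mul; [apply: Tij_gen; lia|apply: Efac_gen].
have Ep (p' : {poly K}) : branch * horner_alg (zJM q T m) p' =N p'.[qcharge q mu] *: branch.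
  elim/poly_ind: p' => [|p' d IH].
    by rewrite rmorph0 mulr0 horner0 scale0r; apply: eqN_refl.
  rewrite rmorphD rmorphM /= horner_algX horner_algC hornerMXaddC mulrDr mulr_algr scalerDl.
  apply: eqN_add; last exact: eqN_refl.
  rewrite mulrA; apply: eqN_trans (eqN_mulr HT IH Gz) _.
  by rewrite -scalerAl -scalerA; apply: eqN_scale.
have C : horner_alg (zJM q T m) p * h = h * horner_alg (zJM q T m) p.
  by symmetry; apply: comm_horner; symmetry; apply: (zJM_gen HTm q0).
have := eqN_mulr HT (Ep p) (gen_le (leqnSn m) Gh).
rewrite -mulrA C Z0 mulr0 -scalerAl => /eqN_sym /eqN0.
have P0 : p.[qcharge q mu] != 0 by apply: (weight_poly_neq0 qinj).
by move/(NbarZ (p.[qcharge q mu])^-1); rewrite scalerA mulVf // scale1r.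
Qed.

Lemma branch_transfer h h' : gen T m h -> gen T m h' ->
  eqN T m mu (xla T m mu * h) (xla T m mu * h') -> branch * h =N branch * h'.
Proof.
move=> Gh Gh'; rewrite /eqN -!mulrBr => Hh.
rewrite (xla_factor (@poinc_neq0 _ _ qinj m) branch_inner) -mulrA -scalerAl; apply: NbarZ.
apply: branch_Nbar => //; apply: gen_mul; last exact: gen_sub.
exact: xla_gen.
Qed.

End Level.
End Generic.

(** * Removing the largest entry of a standard tableau *)

Section Tableaux.
Implicit Types (la mu : seq nat) (t : nat -> nat -> nat).

Lemma size_nodes la : size (nodes la) = sumn la.
Proof. by rewrite -(size_map (fun y => tla la y.1 y.2)) tla_nodes size_iota. Qed.

Definition entries_le t i la r : nat := count (fun c => t r c <= i)%N (iota 1 (Defs.row la r)).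

Lemma sub_shapeE la t i M : (size la <= M)%N ->
  sub_shape la t i = [seq x <- [seq entries_le t i la r | r <- iota 1 M] | x != 0%N].
Proof.
move=> HM; rewrite /sub_shape -/(entries_le _ _ _).
have -> : iota 1 M = iota 1 (size la) ++ iota (1 + size la) (M - size la).
  by rewrite -iotaD; congr iota; lia.
rewrite map_cat filter_cat [X in _ = _ ++ X](_ : _ = [::]) ?cats0 //.
apply/eqP; rewrite -[_ == _]negbK -has_filter; apply/hasPn => y /mapP[r]; rewrite mem_iota => Hr ->.
by rewrite /entries_le /Defs.row nth_default //; lia.
Qed.

Section Tableau.
Variables (m : nat) (la : seq nat) (t : nat -> nat -> nat).
Hypotheses (Hla : part_of m.+1 la) (Ht : is_tableau m.+1 la t) (Hstd : standard la t).

Let Pla : is_part la. Proof. by case/andP: Hla. Qed.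
Let Sla : sumn la = m.+1. Proof. by case/andP: Hla => _ /eqP. Qed.

Lemma tab_uniq : uniq [seq t y.1 y.2 | y <- nodes la].
Proof. by case/andP: Ht. Qed.

Lemma tab_range y : y \in nodes la -> (0 < t y.1 y.2 <= m.+1)%N.
Proof. by case/andP: Ht => /andP[_ /allP H] _ /H. Qed.

Lemma tab_perm : perm_eq [seq t y.1 y.2 | y <- nodes la] (iota 1 m.+1).
Proof.
apply: uniq_perm; [exact: tab_uniq|exact: iota_uniq|].
have [] // := uniq_min_size tab_uniq (s2 := iota 1 m.+1).
  by move=> a /mapP[y /tab_range Hy ->]; rewrite mem_iota add1n ltnS.
by rewrite size_map size_nodes size_iota Sla.
Qed.

Lemma tab_node p : (0 < p <= m.+1)%N -> exists2 y, y \in nodes la & t y.1 y.2 = p.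
Proof.
move=> Hp; have : p \in [seq t y.1 y.2 | y <- nodes la].
  by rewrite (perm_mem tab_perm) mem_iota; lia.
by case/mapP=> y Hy ->; exists y.
Qed.

Variables (k l : nat).
Hypothesis Hk : (k, l) \in nodes la.
Hypothesis Htk : t k l = m.+1.

Lemma nodeof_top : nodeof la t m.+1 = (k, l).
Proof. by rewrite -Htk; apply: (nodeofE tab_uniq Hk). Qed.

Lemma top_removable : removable la (k, l).
Proof.
have := Hk; rewrite mem_nodes /= => /andP[k0 Hl].
have Hs := allP Hstd (k, l) Hk.
case/andP: Hs => /= H1 H2; rewrite removableE // k0 /=; apply/andP; split.
  rewrite eqn_leq; apply/andP; split; first lia.
  rewrite leqNgt; apply/negP => lt.
  have Hin : (k, l.+1) \in nodes la by rewrite mem_nodes /= k0.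
  by move: H1; rewrite Hin /= Htk; have := tab_range Hin; rewrite /=; lia.
rewrite ltnNge; apply/negP => le.
have Hin : (k.+1, l) \in nodes la by rewrite mem_nodes /=; lia.
by move: H2; rewrite Hin /= Htk; have := tab_range Hin; rewrite /=; lia.
Qed.

Let El : l = Defs.row la k. Proof. by move: top_removable; rewrite removableE // => /and3P[_ /eqP]. Qed.
Let lk : (Defs.row la k.+1 < l)%N. Proof. by move: top_removable; rewrite removableE // => /and3P[]. Qed.
Let k0 : (0 < k)%N. Proof. by move: top_removable; rewrite removableE // => /and3P[]. Qed.

Lemma tab_lt y : y \in nodes la -> y != (k, l) -> (t y.1 y.2 <= m)%N.
Proof.
move=> Hy ne; have /andP[_] := tab_range Hy.
rewrite leq_eqVlt => /orP[/eqP E|] //.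
by case/eqP: ne; apply: (uniq_map_eq tab_uniq Hy Hk); rewrite /= Htk.
Qed.

Lemma entries_le_top r : (0 < r)%N -> entries_le t m la r = (Defs.row la r - (r == k))%N.
Proof.
move=> r0; rewrite /entries_le; have [->|ne] := eqVneq r k; last first.
  rewrite subn0 -[RHS](size_iota 1); apply/eqP; rewrite -all_count; apply/allP => c.
  rewrite mem_iota => Hc; apply: (@tab_lt (r, c)); first by rewrite mem_nodes /=; lia.
  by rewrite xpair_eqE (negbTE ne).
rewrite -El; have -> : l = (l.-1 + 1)%N by lia.
rewrite iotaD count_cat addnK /= addn0.
have -> : (1 + l.-1 = l)%N by lia.
rewrite Htk ltnn addn0 -[RHS](size_iota 1); apply/eqP; rewrite -all_count; apply/allP => c.
rewrite mem_iota => Hc; apply: (@tab_lt (k, c)); first by rewrite mem_nodes /=; lia.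
by rewrite xpair_eqE eqxx /=; lia.
Qed.

Local Notation mu := (sub_shape la t m).
Let L := [seq entries_le t m la r | r <- iota 1 (size la)].

Let nthL r : nth 0%N L r = (nth 0%N la r - (r.+1 == k))%N.
Proof.
have [lt|ge] := ltnP r (size la); last by rewrite !nth_default ?size_map ?size_iota.
by rewrite (nth_map 0%N) ?size_iota // nth_iota // add1n entries_le_top // rowS.
Qed.

Let sortedL : sorted geq L.
Proof.
apply/(sortedP 0%N) => i; rewrite size_map size_iota => Hi.
rewrite /geq /= !nthL.
have := @part_nth la i i.+1 Pla (leqnSn i); have := lk; rewrite El.
case: (i.+1 =P k) => [<-|ne]; rewrite ?rowS; case: eqP; lia.
Qed.

Let muE : mu = [seq x <- L | (0 < x)%N].
Proof. by apply: eq_filter => x; rewrite lt0n. Qed.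

Lemma sumn_take_sub r : sumn (take r mu) = (sumn (take r la) - (k <= r))%N.
Proof.
rewrite muE sorted_filter_pos //; elim: r => [|r IH]; first by rewrite !take0 /=; case: (k).
rewrite !sumn_takeS IH nthL.
have kB : (k <= r)%N -> (0 < sumn (take r la))%N.
  move=> kr; have := sumn_take_mono la kr.
  have : sumn (take k la) = (sumn (take k.-1 la) + l)%N by rewrite El /Defs.row -sumn_takeS prednK.
  by lia.
have Ek : r.+1 = k -> nth 0%N la r = l by move=> E; rewrite El -E rowS.
by case: (r.+1 =P k) => [E|ne]; [have := Ek E; lia|lia].
Qed.

Lemma nth_sub r : nth 0%N mu r = (nth 0%N la r - (r.+1 == k))%N.
Proof.
have := sumn_take_sub r.+1; rewrite sumn_takeS (sumn_take_sub r) sumn_takeS.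
have kB : (k <= r)%N -> (0 < sumn (take r la))%N.
  move=> kr; have := sumn_take_mono la kr.
  have : sumn (take k la) = (sumn (take k.-1 la) + l)%N by rewrite El /Defs.row -sumn_takeS prednK.
  by lia.
have Ek : r.+1 = k -> nth 0%N la r = l by move=> E; rewrite El -E rowS.
by case: (r.+1 =P k) => [E|ne]; [have := Ek E; lia|lia].
Qed.

Lemma row_sub r : (0 < r)%N -> Defs.row mu r = (Defs.row la r - (r == k))%N.
Proof. by case: r => // r _; rewrite !rowS nth_sub. Qed.

Lemma size_sub : (size mu <= size la)%N.
Proof. by rewrite muE size_filter (leq_trans (count_size _ _)) // size_map size_iota. Qed.

Lemma sub_part : part_of m mu.
Proof.
rewrite /part_of /is_part [X in sorted _ X]muE sorted_filter //; last first.
  by move=> a b c; rewrite /= /geq /=; lia.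
rewrite [X in all _ X]muE filter_all /=.
have := sumn_take_sub (size la); rewrite take_size Sla take_oversize ?size_sub // => ->.
have : (k <= size la)%N by rewrite -ltnS -(prednK k0) ltnS -part_pos // -/(Defs.row la k) -El; lia.
by move=> ->; rewrite subn1.
Qed.

Lemma mem_nodes_sub y : (y \in nodes mu) = (y \in nodes la) && (y != (k, l)).
Proof.
case: y => r c; rewrite !mem_nodes /= xpair_eqE.
case: (posnP r) => [->|r0] //; rewrite row_sub //.
by case: (r =P k) => [->|ne] /=; rewrite -?El; lia.
Qed.

Lemma perm_nodes_sub : perm_eq (nodes la) ((k, l) :: nodes mu).
Proof.
apply: uniq_perm; [exact: nodes_uniq| |].
  by rewrite /= mem_nodes_sub eqxx andbF nodes_uniq.
by move=> y; rewrite in_cons mem_nodes_sub; have [->|] := eqVneq y (k, l); rewrite ?Hk ?andbT.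
Qed.

Lemma sub_tableau : is_tableau m mu t.
Proof.
rewrite /is_tableau; case/andP: (sub_part) => _ -> /=; apply/andP; split.
  apply/allP => y; rewrite mem_nodes_sub => /andP[Hy ne].
  by rewrite tab_lt // andbT; case/andP: (tab_range Hy).
have := tab_uniq; rewrite (perm_uniq (perm_map _ perm_nodes_sub)) /=.
by case/andP.
Qed.

Lemma sub_standard : standard mu t.
Proof.
apply/allP => y; rewrite mem_nodes_sub => /andP[Hy _].
have /andP[H1 H2] := allP Hstd y Hy; rewrite !mem_nodes_sub.
by apply/andP; split; apply/implyP => /andP[Hy' _]; [move/implyP: H1|move/implyP: H2]; apply.
Qed.

Lemma nodeof_sub p : (0 < p <= m)%N -> nodeof la t p = nodeof mu t p.
Proof.
move=> Hp; have [|y Hy Ey] := @tab_node p; first lia.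
rewrite -Ey (nodeofE tab_uniq Hy) nodeofE //; first by case/andP: sub_tableau.
by rewrite mem_nodes_sub Hy /=; apply/eqP => E; move: Ey; rewrite E /= Htk; lia.
Qed.

Lemma sub_shape_sub p : (p <= m)%N -> sub_shape la t p = sub_shape mu t p.
Proof.
move=> Hp; rewrite (sub_shapeE t p (leqnn _)) (sub_shapeE t p size_sub); congr filter.
apply/eq_in_map => r; rewrite mem_iota => Hr; rewrite /entries_le row_sub; last by lia.
case: (r =P k) => [->|_]; last by rewrite subn0.
have -> : Defs.row la k = (l.-1 + 1)%N by rewrite -El; lia.
rewrite addnK iotaD count_cat /= addn0; have -> : (1 + l.-1 = l)%N by lia.
by rewrite Htk ltnNge Hp addn0.
Qed.

Lemma sub_shape_id : sub_shape la t m.+1 = la.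
Proof.
have -> : sub_shape la t m.+1 = [seq x <- la | x != 0%N].
  rewrite /sub_shape; congr filter; apply: (@eq_from_nth _ 0%N); rewrite ?size_map ?size_iota // => i Hi.
  rewrite (nth_map 0%N) ?size_iota // nth_iota // add1n.
  rewrite -[RHS](size_iota 1) -rowS; apply/eqP; rewrite -all_count; apply/allP => c.
  by rewrite mem_iota => Hc; have := @tab_range (i.+1, c); rewrite mem_nodes /=; lia.
apply/all_filterP; case/andP: Pla => _ /allP H; apply/allP => a /H; lia.
Qed.

End Tableau.

(* [d] is the permutation d(t), with 0-based entries. *)
Definition dspec n la t (d : 'S_n) : Prop :=
  forall y, y \in nodes la -> forall i : 'I_n, i.+1 = tla la y.1 y.2 -> (d i).+1 = t y.1 y.2.

Lemma dspec_dperm n la t : part_of n la -> is_tableau n la t -> dspec la t (dperm n la t).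
Proof.
move=> Hla Ht; have Sla : sumn la = n by case/andP: Hla => _ /eqP.
have Ut : uniq [seq t y.1 y.2 | y <- nodes la] by case/andP: Ht.
have Rt y : y \in nodes la -> (0 < t y.1 y.2 <= n)%N.
  by case/andP: Ht => /andP[_ /allP H] _ /H.
pose f x := let y := nodeof la (tla la) x in t y.1 y.2.
have node (i : 'I_n) : exists2 y, y \in nodes la & tla la y.1 y.2 = i.+1.
  have : i.+1 \in [seq tla la y.1 y.2 | y <- nodes la].
    by rewrite tla_nodes mem_iota Sla /= add1n ltnS ltn_ord.
  by case/mapP=> y Hy ->; exists y.
have Utla : uniq [seq tla la y.1 y.2 | y <- nodes la] by rewrite tla_nodes iota_uniq.
have fE y : y \in nodes la -> f (tla la y.1 y.2) = t y.1 y.2.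
  by move=> Hy; rewrite /f (nodeofE Utla Hy).
have fn (i : 'I_n) : ((f i.+1).-1 < n)%N.
  by have [y Hy <-] := node i; rewrite fE //; have := Rt y Hy; lia.
have fI : injective (fun i => Ordinal (fn i)).
  move=> i j /(congr1 val) /=; have [y Hy Ey] := node i; have [z Hz Ez] := node j.
  rewrite -Ey -Ez !fE // => E; have E' : t y.1 y.2 = t z.1 z.2.
    by have := Rt y Hy; have := Rt z Hz; lia.
  have Eyz := uniq_map_eq Ut Hy Hz E'.
  by apply: val_inj; apply: succn_inj; rewrite -Ey -Ez Eyz.
have Hex : [forall i : 'I_n, (perm fI i : nat) == (f i.+1).-1] by apply/forallP => i; rewrite permE.
pose P (s : 'S_n) := [forall i : 'I_n, (s i : nat) == (f i.+1).-1].
have -> : dperm n la t = odflt 1%g (pick P) by [].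
case: (pickP P) => [s /forallP Hs|/(_ (perm fI))]; last by rewrite /P Hex.
move=> y Hy i Ei; have /eqP -> /= := Hs i.
by rewrite Ei fE // prednK //; case/andP: (Rt y Hy).
Qed.

Lemma dspec_uniq n la t (d d' : 'S_n) : sumn la = n -> dspec la t d -> dspec la t d' -> d = d'.
Proof.
move=> Sla H H'; apply/permP => i; apply: val_inj; apply: succn_inj => /=.
have : i.+1 \in [seq tla la y.1 y.2 | y <- nodes la].
  by rewrite tla_nodes mem_iota Sla /= add1n ltnS ltn_ord.
by case/mapP=> y Hy Ei; rewrite (H y Hy) // (H' y Hy).
Qed.

Lemma dperm_tla n la : part_of n la -> dperm n la (tla la) = 1%g.
Proof.
move=> Hla; have Sla : sumn la = n by case/andP: Hla => _ /eqP.
apply: (dspec_uniq Sla (t := tla la)); last by move=> y Hy i Ei; rewrite perm1.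
apply: dspec_dperm => //; rewrite /is_tableau Sla eqxx tla_nodes iota_uniq andbT /=.
apply/allP => y Hy; have : tla la y.1 y.2 \in iota 1 (sumn la).
  by rewrite -tla_nodes; apply: map_f.
by rewrite mem_iota Sla add1n ltnS.
Qed.

End Tableaux.

(** * Proof of the theorem *)

Section LiftPerm.
Variable m : nat.
Local Notation n := m.+1.

Definition lift_last (w : 'S_m) : 'S_n := lift_perm ord_max ord_max w.

Lemma lift_last_max w (x : 'I_n) : x = m :> nat -> lift_last w x = m :> nat.
Proof.
by move=> E; have -> : x = ord_max by [apply: val_inj]; rewrite /lift_last lift_perm_id.
Qed.

Lemma lift_lastE w (x : 'I_n) (y : 'I_m) : x = y :> nat -> lift_last w x = w y :> nat.
Proof.
move=> E; have -> : x = lift ord_max y by apply: val_inj; rewrite [RHS]lift_max.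
by rewrite /lift_last lift_perm_lift lift_max.
Qed.

Lemma lift_last1 : lift_last 1 = 1%g.
Proof. exact: lift_perm1. Qed.

Lemma lift_last_sgen w i : (0 < i < m)%N -> lift_last (w * sgen m i)%g = (lift_last w * sgen n i)%g.
Proof.
move=> Hi; have Hi' : (0 < i < n)%N by lia.
apply/permP => x; apply: val_inj; rewrite /= permM (sgenE _ Hi').
have [lt|ge] := ltnP x m.
  by rewrite !(@lift_lastE _ x (Ordinal lt)) // permM (sgenE _ Hi).
have Ex : x = m :> nat by have := ltn_ord x; lia.
by rewrite !lift_last_max //; split_ifs; lia.
Qed.

Fixpoint cyc c d : 'S_n := if d is d'.+1 then (cyc c d' * sgen n (c + d))%g else 1%g.

Lemma cycE c d (x : 'I_n) : (c + d < n)%N ->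
  cyc c d x = (if x < c then x : nat else if x == c :> nat then c + d
               else if x <= c + d then x.-1 else x)%N :> nat.
Proof.
elim: d => [|d IH] Hd /=; first by rewrite perm1; split_ifs; lia.
rewrite permM sgenE; last by lia.
by rewrite IH; [split_ifs; lia|lia].
Qed.

End LiftPerm.

Section Main.
Variables (K : fieldType) (q : K).
Hypothesis qinj : forall s1 s2 : seq nat,
  \sum_(i <- s1) q ^+ i = \sum_(i <- s2) q ^+ i -> perm_eq s1 s2.
Variables (A : algType K) (T : nat -> A).

Lemma Tw_cyc m c d : hecke_rels q T m.+1 -> (c + d <= m)%N ->
  Tw T (cyc m c d) = Tij T c.+1 (c + d).+1.
Proof.
move=> HT; elim: d => [|d IH] Hd; first by rewrite /= Tw1 addn0 Tij_id.
rewrite [cyc _ _ _]/= (Tw_asc HT); [|lia|].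
  rewrite IH; last by lia.
  by rewrite addnS [RHS]Tij_recr //; lia.
by move=> a b; rewrite !cycE; try lia; split_ifs; lia.
Qed.

Lemma Tw_cyc_lift m c (w : 'S_m) : hecke_rels q T m.+1 -> (c <= m)%N ->
  Tw T (cyc m c (m - c) * lift_last w)%g = Tij T c.+1 m.+1 * Tw T w.
Proof.
move=> HT cm; have [j] := ubnP (ninv w); elim: j w => // j IH w Hj.
have [->|/eqP w1] := eqVneq w 1%g.
  by rewrite lift_last1 mulg1 Tw1 mulr1 Tw_cyc //; [congr (Tij _ _ _)|]; lia.
have [i [Hi Di Ei]] := Tw_rec T w1; have Li := ninv_desc Hi Di.
have Hi' : (0 < i < m.+1)%N by lia.
rewrite -{1}(mulsgK w i) lift_last_sgen // mulgA (Tw_asc HT) //; last first.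
  move=> a b; rewrite !permM => Ea Eb.
  have As := asc_sgen Hi Di; set w' := (w * sgen m i)%g in Ea Eb As.
  have low (z : 'I_m.+1) : (lift_last w' z < m)%N -> (z < m)%N.
    move=> H; rewrite ltnNge; apply/negP => ge.
    by move: H; rewrite lift_last_max ?ltnn //; have := ltn_ord z; lia.
  have La : (cyc m c (m - c) a < m)%N by apply: low; lia.
  have Lb : (cyc m c (m - c) b < m)%N by apply: low; lia.
  have := As (Ordinal La) (Ordinal Lb).
  rewrite -(@lift_lastE _ w' _ (Ordinal La) erefl) -(@lift_lastE _ w' _ (Ordinal Lb) erefl) => /(_ Ea Eb).
  move: La Lb; rewrite /= !cycE; try lia.
  by split_ifs; lia.
by rewrite IH ?Ei ?mulrA //; lia.
Qed.

Lemma Tw_dspec m la t k l (d : 'S_m.+1) (d' : 'S_m) :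
  hecke_rels q T m.+1 -> part_of m.+1 la -> is_tableau m.+1 la t -> standard la t ->
  (k, l) \in nodes la -> t k l = m.+1 -> dspec la t d -> dspec (sub_shape la t m) t d' ->
  Tw T d = Tij T (sumn (take k la)) m.+1 * Tw T d'.
Proof.
move=> HT Hla Ht Hstd Hk Htk Dd Dd'.
have Pla : is_part la by case/andP: Hla.
have Sla : sumn la = m.+1 by case/andP: Hla => _ /eqP.
have := top_removable Hla Ht Hstd Hk Htk; rewrite removableE // => /and3P[k0 /eqP El lk].
set Bk := sumn (take k la); have EBk : Bk = (sumn (take k.-1 la) + l)%N.
  by rewrite /Bk El /Defs.row -sumn_takeS prednK.
have Bkm : (Bk <= m.+1)%N by rewrite -Sla sumn_take_le.
pose c := Bk.-1; have Ec : c.+1 = Bk by rewrite prednK //; lia.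
rewrite -Ec -Tw_cyc_lift //; last by lia.
congr (Tw T _); apply: (dspec_uniq Sla Dd) => -[r r'] Hy i.
have [E|ne] := eqVneq (r, r') (k, l).
  case: E => -> -> /=; rewrite /tla -{1}(prednK k0) /= -EBk => Ei.
  rewrite permM lift_last_max ?Htk // cycE; last by lia.
  by split_ifs; lia.
have Hmu : (r, r') \in nodes (sub_shape la t m) by rewrite (mem_nodes_sub Hla Ht Hstd Hk Htk) Hy.
have Hin := Dd' _ Hmu; move: (Hy) ne; rewrite mem_nodes xpair_eqE /= => /andP[r0 Hr'] ne Ei.
have im : (i < m.+1)%N := ltn_ord i.
have Emu : tla (sub_shape la t m) r r' = (tla la r r' - (k < r))%N.
  rewrite /tla (sumn_take_sub Hla Ht Hstd Hk Htk).
  have H : (k <= r.-1)%N -> (0 < sumn (take r.-1 la))%N.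
    by move=> kr; have := sumn_take_mono la kr; rewrite -/Bk; lia.
  by case: (leqP k r.-1) H => ? H; [have := H isT|]; lia.
have Hlow : (r <= k)%N -> (i < c)%N.
  move=> rk; have Er : sumn (take r la) = (sumn (take r.-1 la) + Defs.row la r)%N.
    by rewrite /Defs.row -sumn_takeS prednK.
  move: Ei; rewrite /tla; have [E|ne'] := eqVneq r k.
    by rewrite E in Hr' ne *; move: ne; rewrite eqxx /= -El in Hr' *; rewrite -/(Defs.row _ _); lia.
  have := @sumn_take_mono la r k.-1; lia.
have Hhigh : (k < r)%N -> (c < i)%N.
  by move=> kr; have := @sumn_take_mono la k r.-1; move: Ei; rewrite /tla -/Bk; lia.
have Es : cyc m c (m - c) i = (i - (k < r))%N :> nat.
  rewrite cycE; last by lia.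
  by case: (leqP r k) => rk; [have := Hlow rk|have := Hhigh rk]; split_ifs; lia.
have sm : (cyc m c (m - c) i < m)%N.
  by rewrite Es; case: (leqP r k) => rk; [have := Hlow rk|have := Hhigh rk]; lia.
rewrite permM (@lift_lastE _ d' _ (Ordinal sm)) //; apply: Hin.
by rewrite /= Es Emu -Ei; case: (leqP r k) => rk; [have := Hlow rk|have := Hhigh rk]; lia.
Qed.

Definition Et_over (R : seq K) n la t : A :=
  \prod_(1 <= p < n.+1)
    let r := res q (nodeof la t p) in
    \prod_(c <- R | c != r) ((r - c)^-1 *: (Lp q T n p - c%:A)).

Lemma Lp_gen n p : hecke_rels q T n -> (0 < p <= n)%N -> gen T p (Lp q T n p).
Proof.
move=> HT; case: p => // p Hp; rewrite (Lp_JM qinj HT Hp).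
by apply: gen_scale; apply: gen_sub; [apply: JM_gen|apply: gen_one].
Qed.

Lemma Lp_level n m p : hecke_rels q T n -> hecke_rels q T m -> (0 < p <= n)%N -> (p <= m)%N ->
  Lp q T n p = Lp q T m p.
Proof. by move=> Hn Hm; case: p => // p Hp pm; rewrite (Lp_JM qinj Hn Hp) (Lp_JM qinj Hm pm). Qed.

Lemma Et_gen R n la t : hecke_rels q T n -> gen T n (Et_over R n la t).
Proof.
move=> HT; apply: gen_prod => p; rewrite mem_index_iota => Hp _; apply: gen_prod => c _ _.
apply: gen_scale; apply: gen_sub; last exact: gen_cst.
by apply: gen_le (Lp_gen HT _); lia.
Qed.

Lemma seminormal_Pt n : hecke_rels q T n -> forall la t (R : seq K) (d : 'S_n),
  part_of n la -> is_tableau n la t -> standard la t ->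
  (forall y, y \in nodes la -> res q y \in R) -> dspec la t d ->
  gen T n (Pt q T n la t) /\
  eqN T n la (xla T n la * (Tw T d * Et_over R n la t)) (xla T n la * Pt q T n la t).
Proof.
elim: n => [|m IH] HT la t R d Hla Ht Hstd HR Dd.
  have -> : d = 1%g by apply/permP => -[].
  rewrite Tw1 /Et_over big_geq // /Pt big_ord0 !mulr1; split; [exact: gen_one|exact: eqN_refl].
have [|[k l] Hk Htk] := @tab_node m la t Hla Ht Hstd m.+1; first by rewrite leqnn.
have Hrem := top_removable Hla Ht Hstd Hk Htk.
pose mu := sub_shape la t m.
have HTm := hecke_relsS HT.
have Hmu : part_of m mu := sub_part Hla Ht Hstd Hk Htk.
have Htmu : is_tableau m mu t := sub_tableau Hla Ht Hstd Hk Htk.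
have Hsmu : standard mu t := sub_standard Hla Ht Hstd Hk Htk.
have HRmu y : y \in nodes mu -> res q y \in R.
  by rewrite (mem_nodes_sub Hla Ht Hstd Hk Htk) => /andP[/HR].
have Dmu := dspec_dperm Hmu Htmu.
have [GP EP] := IH HTm mu t R _ Hmu Htmu Hsmu HRmu Dmu.
have EPt : Pt q T m.+1 la t = Pnode q T la (k, l) * Pt q T m mu t.
  rewrite /Pt big_ord_recl subn0; congr (_ * _).
    by rewrite /Defs.Pi (sub_shape_id Hla Ht Hstd Hk Htk) (nodeof_top Ht Hk Htk).
  apply: eq_bigr => j _; rewrite lift0 subSS /Defs.Pi.
  rewrite (sub_shape_sub Hla Ht Hstd Hk Htk); last by lia.
  by rewrite (nodeof_sub Hla Ht Hstd Hk Htk) //; have := ltn_ord j; lia.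
have GPn := Pnode_gen qinj T Hla Hrem.
split; first by rewrite EPt; apply: gen_mul => //; apply: gen_le GP.
have EEt : Et_over R m.+1 la t = Et_over R m mu t * Efac q T m k l R.
  rewrite /Et_over big_nat_recr //=; congr (_ * _); last first.
    by rewrite /Efac (nodeof_top Ht Hk Htk).
  apply: eq_big_nat => p Hp; rewrite (nodeof_sub Hla Ht Hstd Hk Htk) //.
  by apply: eq_bigr => c _; rewrite (@Lp_level m.+1 m p) //; lia.
have GE := Et_gen R mu t HTm.
rewrite (Tw_dspec HT Hla Ht Hstd Hk Htk Dd Dmu) EEt EPt.
set e := Et_over R m mu t in EP GE *; set w := Tw T (dperm m mu t) in EP *.
have Gw : gen T m w by apply: Tw_gen.
have -> : xla T m.+1 la * (Tij T (sumn (take k la)) m.+1 * w * (e * Efac q T m k l R)) =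
   branch q T m la k l R * (w * e).
  rewrite /branch -!mulrA; congr (_ * (_ * _)).
  by rewrite mulrA (Efac_comm qinj HT Hla Hrem) //; apply: gen_mul.
have Hsum := sumn_take_sub Hla Ht Hstd Hk Htk.
have Hperm := perm_nodes_sub Hla Ht Hstd Hk Htk.
apply: (eqN_trans (branch_transfer qinj HT Hla Hrem HR Hmu Hsum Hperm _ GP EP)).
  exact: gen_mul.
rewrite mulrA; apply: (eqN_mulr HT); last by apply: gen_le GP.
exact: branch_Pnode.
Qed.

End Main.

Lemma count_coef (s : seq nat) d : (\sum_(i <- s) 'X^i : {poly CC})`_d = (count_mem d s)%:R.
Proof.
elim: s => [|i s IH]; first by rewrite big_nil coef0.
by rewrite big_cons coefD IH coefXn natrD eq_sym.
Qed.

Lemma qq_inj (s1 s2 : seq nat) : \sum_(i <- s1) qq ^+ i = \sum_(i <- s2) qq ^+ i -> perm_eq s1 s2.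
Proof.
have E s : \sum_(i <- s) qq ^+ i = FracField.tofrac (\sum_(i <- s) 'X^i : {poly CC}).
  by rewrite rmorph_sum; apply: eq_bigr => i _; rewrite rmorphXn.
rewrite !E => /eqP; rewrite tofrac_eq => /eqP Ep; apply/allP => d _ /=.
have := congr1 (fun p : {poly CC} => p`_d) Ep; rewrite !count_coef.
by move/eqP; rewrite (Num.Theory.eqr_nat (Rdefinitions.R)[i]).
Qed.

(* A ranges over K-algebras generated by T_1..T_{n-1} subject to the Hecke
   relations (in particular A = H_{K,n}); see NOTES.md. *)
Theorem theorem4 (n : nat) (A : algType KK) (T : nat -> A)
  (HT : hecke_rels qq T n)
  (la : seq nat) (t : nat -> nat -> nat)
  (Hla : part_of n la) (Ht : is_tableau n la t) (Hstd : standard la t) :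
  in_Nbar T n la (xtt T n la t * Et qq T n la t - xla T n la * Pt qq T n la t).
Proof.
have HR y : y \in nodes la -> res qq y \in Rset qq n.
  move=> Hy; rewrite mem_undup; apply: map_f; apply/flattenP; exists (nodes la) => //.
  by apply: map_f; rewrite mem_partitions.
have [_] := seminormal_Pt qq_inj HT Hla Ht Hstd HR (dspec_dperm Hla Ht).
by rewrite /xtt /xst (dperm_tla Hla) invg1 Tw1 mul1r mulrA.
Qed.
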